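(* Let $k$ be a field and $E=A\#_fH$ a crossed product with convolution invertible cocycle $f$. If $M$ and $N$ are left $E$-modules, then there is a convergent spectral sequence $$E_2^{rs}=H^r(H,\mathrm{Ext}_A^s(M,N))\ \Rightarrow\ \mathrm{Ext}_E^{r+s}(M,N).$$ As a corollary, $\mathrm{gl.dim}(E)\le\mathrm{gl.dim}(A)+\mathrm{gl.dim}(H)$, where $\mathrm{gl.dim}$ denotes the left global dimension.
   Context: $\otimes=\otimes_k$, $H$ is a Hopf $k$-algebra with counit $\epsilon$, antipode $S$ and Sweedler notation $\Delta(h)=h^{(1)}\otimes h^{(2)}$ (sum understood), $A$ is a $k$-algebra. A weak action of $H$ on $A$ is a bilinear map $(h,a)\mapsto a^h$, $H\times A\to A$, with $(ab)^h=a^{h^{(1)}}b^{h^{(2)}}$, $1^h=\epsilon(h)1$, $a^1=a$. Given a weak action and a $k$-linear map $f:H\otimes H\to A$, $A\#_fH$ is $A\otimes H$ (elements written $a\#h$) with product $(a\#h)(b\#l)=ab^{h^{(1)}}f(h^{(2)},l^{(1)})\#h^{(3)}l^{(2)}$; it is called a crossed product if it is associative with unit $1\#1$, equivalently: $f(h,1)=f(1,h)=\epsilon(h)1_A$; $f(l^{(1)},m^{(1)})^{h^{(1)}}f(h^{(2)},l^{(2)}m^{(2)})=f(h^{(1)},l^{(1)})f(h^{(2)}l^{(2)},m)$; and $(a^{l^{(1)}})^{h^{(1)}}f(h^{(2)},l^{(2)})=f(h^{(1)},l^{(1)})a^{h^{(2)}l^{(2)}}$ for all $h,l,m\in H$,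 $a\in A$. $A$ is regarded as the subalgebra $A\#1$ of $E$. When $f$ is convolution invertible, $h\mapsto1\#h$ is convolution invertible with inverse $h\mapsto(1\#h)^{-1}:=f^{-1}(S(h^{(2)}),h^{(3)})\#S(h^{(1)})$. $\mathrm{Ext}_A^s(M,N)$ is identified with the Hochschild cohomology $H^s(A,\mathrm{Hom}_k(M,N))$, where $P=\mathrm{Hom}_k(M,N)$ is an $E$-bimodule via $(x\varphi y)(m)=x\varphi(ym)$; it is a right $H$-module with $h\in H$ acting through the map induced on cohomology by the endomorphism $\varphi\mapsto\big(a_1\otimes\cdots\otimes a_s\mapsto(1\#h^{(1)})^{-1}\varphi(a_1^{h^{(2)}}\otimes\cdots\otimes a_s^{h^{(s+1)}})(1\#h^{(s+2)})\big)$ of the normalized Hochschild complex $(\mathrm{Hom}_k(\overline A^*,P),b^* )$, $\overline A=A/k$. For a right $H$-module $L$, $H^*(H,L)=\mathrm{Ext}_H^*(k,L)$ (right modules), with $k$ the trivial right $H$-module. *)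

(* Defs.v *)
From HB Require Import structures.
From mathcomp Require Import all_boot all_algebra.
From mathcomp Require Import boolp classical_sets functions constructive_ereal.

Set Implicit Arguments.
Unset Strict Implicit.
Unset Printing Implicit Defensive.

Import GRing.Theory.
Local Open Scope quotient_scope.
Local Open Scope ring_scope.

Section Subspaces.
Variable k : pzRingType.

Record submod (V : lmodType k) := Submod {
  submod_set :> V -> Prop;
  submod0 : submod_set 0;
  submodP : forall a u v,
    submod_set u -> submod_set v -> submod_set (a *: u + v) }.

Definition kiso (U V : lmodType k) : Prop :=
  exists f : {linear U -> V}, bijective f.

Lemma ker_subproof (U V : lmodType k) (f : {linear U -> V}) a u v :
  f u = 0 -> f v = 0 -> f (a *: u + v) = 0.
Proof. by move=> fu fv; rewrite linearP fu fv scaler0 addr0. Qed.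

Definition kernel (U V : lmodType k) (f : {linear U -> V}) : submod U :=
  @Submod U (fun u => f u = 0) (linear0 f) (ker_subproof (f := f)).

Lemma im0_subproof (U V : lmodType k) (f : {linear U -> V}) :
  exists u, f u = 0.
Proof. by exists 0; rewrite linear0. Qed.

Lemma im_subproof (U V : lmodType k) (f : {linear U -> V}) a v w :
  (exists u, f u = v) -> (exists u, f u = w) -> exists u, f u = a *: v + w.
Proof. by move=> [x <-] [y <-]; exists (a *: x + y); rewrite linearP. Qed.

Definition image (U V : lmodType k) (f : {linear U -> V}) : submod V :=
  @Submod V (fun v => exists u, f u = v) (im0_subproof f)
    (im_subproof (f := f)).

Variable V : lmodType k.
Implicit Type Z : submod V.

Definition mem_submod Z : {pred V} := fun x => `[< Z x >].

Lemma mem_submod_closed Z : submod_closed (mem_submod Z).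
Proof.
split; first exact/asboolP/submod0.
by move=> a u v /asboolP Zu /asboolP Zv; apply/asboolP/submodP.
Qed.

HB.instance Definition _ Z :=
  GRing.isSubmodClosed.Build k V (mem_submod Z) (mem_submod_closed Z).

Record subspace Z := Subspace {
  subspace_val :> V;
  subspace_valP : subspace_val \in mem_submod Z }.

HB.instance Definition _ Z := [isSub for @subspace_val Z].
HB.instance Definition _ Z := [Choice of subspace Z by <:].
HB.instance Definition _ Z := [SubChoice_isSubLmodule of subspace Z by <:].

End Subspaces.

Section Subquotient.
Variables (k : pzRingType) (V : lmodType k) (Z B : submod V).

Definition subquot_pred : {pred subspace Z} := fun x => val x \in mem_submod B.

Lemma subquot_predE x : (x \in subquot_pred) = (val x \in mem_submod B).
Proof. by []. Qed.

Lemma subquot_pred_closed : zmod_closed subquot_pred.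
Proof.
split=> [|x y]; rewrite !subquot_predE ?raddf0 ?rpred0 //.
by move=> Bx By; rewrite raddfB rpredB.
Qed.

HB.instance Definition _ :=
  GRing.isZmodClosed.Build (subspace Z) subquot_pred subquot_pred_closed.

(* The quotient Z / B when B is contained in Z; Z / (Z :&: B) in general. *)
Definition subquot : Type := {ideal_quot subquot_pred}.

HB.instance Definition _ := GRing.Zmodule.on subquot.

Definition subquot_class (x : subspace Z) : subquot :=
  \pi_{ideal_quot subquot_pred} x.

Definition subquot_scale (a : k) (q : subquot) : subquot :=
  subquot_class (a *: (repr (q : {ideal_quot subquot_pred}))).

Lemma subquot_classP x y :
  subquot_class x = subquot_class y <-> B (val x - val y).
Proof.
have -> : B (val x - val y) <-> x - y \in subquot_pred.
  by rewrite subquot_predE raddfB; split=> [|/asboolP//] ?; apply/asboolP.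
by rewrite Quotient.idealrBE; split=> /eqP.
Qed.

Lemma subquot_classB : {morph subquot_class : x y / x - y}.
Proof. by move=> x y; rewrite /subquot_class !piE. Qed.

Lemma subquot_classD : {morph subquot_class : x y / x + y}.
Proof. by move=> x y; rewrite /subquot_class !piE. Qed.

Lemma subquot_classK (q : subquot) :
  subquot_class (repr (q : {ideal_quot subquot_pred})) = q.
Proof. exact: (@reprK _ {ideal_quot subquot_pred}). Qed.

Lemma subquot_scaleE a x :
  subquot_scale a (subquot_class x) = subquot_class (a *: x).
Proof.
apply/subquot_classP; set y := repr _.
have By : B (val y - val x) by apply/subquot_classP/subquot_classK.
have -> : val (a *: y) - val (a *: x) = a *: (val y - val x) + 0.
  by rewrite addr0 scalerBr.
exact/submodP/submod0.
Qed.

Lemma subquot_ind (P : subquot -> Prop) :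
  (forall x, P (subquot_class x)) -> forall q, P q.
Proof. by move=> Px q; rewrite -[q]subquot_classK. Qed.

Fact subquot_scaleA a b q :
  subquot_scale a (subquot_scale b q) = subquot_scale (a * b) q.
Proof. by elim/subquot_ind: q => x; rewrite !subquot_scaleE scalerA. Qed.

Fact subquot_scale1 : left_id 1 subquot_scale.
Proof. by elim/subquot_ind=> x; rewrite subquot_scaleE scale1r. Qed.

Fact subquot_scaleDr : right_distributive subquot_scale +%R.
Proof.
move=> a; elim/subquot_ind=> x; elim/subquot_ind=> y.
by rewrite -subquot_classD !subquot_scaleE -subquot_classD scalerDr.
Qed.

Fact subquot_scaleDl q : {morph subquot_scale^~ q : a b / a + b}.
Proof.
elim/subquot_ind: q => x a b.
by rewrite !subquot_scaleE -subquot_classD scalerDl.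
Qed.

HB.instance Definition _ := GRing.Zmodule_isLmodule.Build k subquot
  subquot_scaleA subquot_scale1 subquot_scaleDr subquot_scaleDl.

End Subquotient.

Section Tensor.
Variable k : comPzRingType.

Definition bilin (U V W : lmodType k) (beta : U -> V -> W) : Prop :=
  (forall v, linear (beta^~ v)) /\ (forall u, linear (beta u)).

Variables U V : lmodType k.

Definition formal_eval (W : lmodType k) (beta : U -> V -> W)
  (s : seq (U * V)) : W := \sum_(p <- s) beta p.1 p.2.

(* A formal sum of pairs represents a tensor, and two formal sums represent
   the same tensor when no bilinear map separates them. *)
Definition tensor_eq (s t : seq (U * V)) : bool :=
  `[< forall (W : lmodType k) (beta : U -> V -> W),
        bilin beta -> formal_eval beta s = formal_eval beta t >].

Lemma tensor_eq_refl : reflexive tensor_eq.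
Proof. by move=> s; apply/asboolP. Qed.

Lemma tensor_eq_sym : symmetric tensor_eq.
Proof.
by move=> s t; apply/asboolP/asboolP => e W beta bl; rewrite (e W beta bl).
Qed.

Lemma tensor_eq_trans : transitive tensor_eq.
Proof.
move=> t s u /asboolP e1 /asboolP e2; apply/asboolP => W beta bl.
by rewrite (e1 _ _ bl) (e2 _ _ bl).
Qed.

Canonical tensor_equiv :=
  EquivRel tensor_eq tensor_eq_refl tensor_eq_sym tensor_eq_trans.

Definition tensor : Type := {eq_quot tensor_eq}.

HB.instance Definition _ := Choice.on tensor.

Definition tclass (s : seq (U * V)) : tensor := \pi_{eq_quot tensor_eq} s.
Definition trepr (t : tensor) : seq (U * V) :=
  repr (t : {eq_quot tensor_eq}).

Lemma treprK t : tclass (trepr t) = t.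
Proof. exact: (@reprK _ {eq_quot tensor_eq}). Qed.

Lemma tclassP s t : tclass s = tclass t <->
  forall (W : lmodType k) (beta : U -> V -> W),
    bilin beta -> formal_eval beta s = formal_eval beta t.
Proof.
split=> [/eqmodP/asboolP //|e]; by apply/eqmodP/asboolP.
Qed.

Lemma formal_evalE (W : lmodType k) (beta : U -> V -> W) s : bilin beta ->
  formal_eval beta (trepr (tclass s)) = formal_eval beta s.
Proof. by move: W beta; apply/tclassP; rewrite treprK. Qed.

Lemma formal_eval_cat (W : lmodType k) (beta : U -> V -> W) s t :
  formal_eval beta (s ++ t) = formal_eval beta s + formal_eval beta t.
Proof. by rewrite /formal_eval big_cat. Qed.

Definition tscale_seq (a : k) (s : seq (U * V)) := [seq (a *: p.1, p.2) | p <- s].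

Lemma formal_eval_scale (W : lmodType k) (beta : U -> V -> W) a s :
  bilin beta -> formal_eval beta (tscale_seq a s) = a *: formal_eval beta s.
Proof.
move=> [bl _]; rewrite /formal_eval big_map scaler_sumr.
apply: eq_bigr => p _ /=; have := bl p.2 a p.1 0.
have b0 : beta 0 p.2 = 0.
  by apply: (@addIr _ (beta 0 p.2)); rewrite add0r -{3}[0]addr0 -{3}(scale1r 0) bl scale1r.
by rewrite addr0 b0 addr0.
Qed.

Definition tadd (s t : tensor) := tclass (trepr s ++ trepr t).
Definition tscale a (t : tensor) := tclass (tscale_seq a (trepr t)).
Definition topp := tscale (-1).
Definition tzero := tclass [::].

(* The map out of the tensor product induced by beta; it is meaningful when
   beta is bilinear. *)
Definition tlift (W : lmodType k) (beta : U -> V -> W) (t : tensor) : W :=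
  \sum_(p <- trepr t) beta p.1 p.2.

Lemma tensorP s t : s = t <-> forall (W : lmodType k) (beta : U -> V -> W),
  bilin beta -> tlift beta s = tlift beta t.
Proof. by split=> [->//|e]; rewrite -[s]treprK -[t]treprK; apply/tclassP. Qed.

Section Lift.
Variables (W : lmodType k) (beta : U -> V -> W).
Hypothesis bl : bilin beta.

Lemma tliftD s t : tlift beta (tadd s t) = tlift beta s + tlift beta t.
Proof. by rewrite [LHS]formal_evalE // formal_eval_cat. Qed.

Lemma tliftZ a t : tlift beta (tscale a t) = a *: tlift beta t.
Proof. by rewrite [LHS]formal_evalE // formal_eval_scale. Qed.

Lemma tlift0 : tlift beta tzero = 0.
Proof. by rewrite [LHS]formal_evalE // /formal_eval big_nil. Qed.
End Lift.

Fact taddA : associative tadd.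
Proof. by move=> s t u; apply/tensorP => W b bl; rewrite !tliftD // addrA. Qed.
Fact taddC : commutative tadd.
Proof. by move=> s t; apply/tensorP => W b bl; rewrite !tliftD // addrC. Qed.
Fact tadd0 : left_id tzero tadd.
Proof. by move=> s; apply/tensorP => W b bl; rewrite tliftD // tlift0 // add0r. Qed.
Fact taddN : left_inverse tzero topp tadd.
Proof.
move=> s; apply/tensorP => W b bl.
by rewrite tliftD // tlift0 // tliftZ // scaleN1r addNr.
Qed.

HB.instance Definition _ := GRing.isZmodule.Build tensor taddA taddC tadd0 taddN.

Fact tscaleA a b t : tscale a (tscale b t) = tscale (a * b) t.
Proof. by apply/tensorP => W be bl; rewrite !tliftZ // scalerA. Qed.
Fact tscale1 : left_id 1 tscale.
Proof. by move=> t; apply/tensorP => W be bl; rewrite tliftZ // scale1r. Qed.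
Fact tscaleDr : right_distributive tscale +%R.
Proof.
move=> a s t; apply/tensorP => W b bl.
by rewrite tliftZ // ![tlift _ (_ + _)]tliftD // !tliftZ // scalerDr.
Qed.
Fact tscaleDl t : {morph tscale^~ t : a b / a + b}.
Proof.
move=> a b; apply/tensorP => W be bl.
by rewrite [tlift _ (_ + _)]tliftD // !tliftZ // scalerDl.
Qed.

HB.instance Definition _ := GRing.Zmodule_isLmodule.Build k tensor
  tscaleA tscale1 tscaleDr tscaleDl.

Definition tpure (u : U) (v : V) : tensor := tclass [:: (u, v)].

Lemma tlift_pure (W : lmodType k) (beta : U -> V -> W) u v :
  bilin beta -> tlift beta (tpure u v) = beta u v.
Proof. by move=> bl; rewrite [LHS]formal_evalE // /formal_eval big_seq1. Qed.

Lemma tlift_linear (W : lmodType k) (beta : U -> V -> W) :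
  bilin beta -> linear (tlift beta).
Proof.
by move=> bl a s t; rewrite [LHS]tliftD // tliftZ.
Qed.

Lemma tpure_bilin : bilin tpure.
Proof.
by split=> [v|u] a x y; apply/tensorP => W b bl;
  rewrite [RHS]tliftD // tliftZ // !tlift_pure //; case: bl => bl1 bl2;
  rewrite ?bl1 ?bl2.
Qed.

End Tensor.

Notation "u ⊗ v" := (tpure u v) (at level 40, left associativity) : ring_scope.

Lemma trepr_sum (k : comPzRingType) (U V : lmodType k) (t : tensor U V) :
  t = \sum_(p <- trepr t) p.1 ⊗ p.2.
Proof.
rewrite -[LHS]treprK; elim: (trepr t) => [|[u v] s IHs]; first by rewrite big_nil.
rewrite big_cons -IHs; apply/tensorP => W b bl.
rewrite [RHS]tliftD // tlift_pure // ![tlift _ _]formal_evalE //.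
by rewrite /formal_eval big_cons.
Qed.

Section Sweedler.
Variables (k : fieldType) (H : algType k) (Delta : H -> tensor H H).

(* Sweedler notation: the sum of x.1 (x) x.2 over x <- sw h is Delta h.  The
   choice of the list is immaterial in expressions bilinear in (x.1, x.2). *)
Definition sw (h : H) : seq (H * H) := trepr (Delta h).

(* The n-fold iterated coproduct, as a list of words of length n.+1. *)
Fixpoint sweedler (n : nat) (h : H) : seq (seq H) :=
  if n is n'.+1 then [seq x.1 :: w | x <- sw h, w <- sweedler n' x.2]
  else [:: [:: h]].

End Sweedler.

Record hopfAlgebra (k : fieldType) := HopfAlgebra {
  hopf_alg :> algType k;
  comul : {linear hopf_alg -> tensor hopf_alg hopf_alg};
  counit : {lrmorphism hopf_alg -> k^o};
  antipode : {linear hopf_alg -> hopf_alg};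
  comul1 : comul 1 = 1 ⊗ 1;
  comulM : forall h l, comul (h * l) =
    \sum_(x <- sw comul h) \sum_(y <- sw comul l) (x.1 * y.1) ⊗ (x.2 * y.2);
  comulA : forall h,
    \sum_(x <- sw comul h) \sum_(y <- sw comul x.1) y.1 ⊗ (y.2 ⊗ x.2) =
    \sum_(x <- sw comul h) x.1 ⊗ comul x.2;
  counitl : forall h, \sum_(x <- sw comul h) (counit x.1 : k) *: x.2 = h;
  counitr : forall h, \sum_(x <- sw comul h) (counit x.2 : k) *: x.1 = h;
  antipodel : forall h,
    \sum_(x <- sw comul h) antipode x.1 * x.2 = (counit h : k)%:A;
  antipoder : forall h,
    \sum_(x <- sw comul h) x.1 * antipode x.2 = (counit h : k)%:A }.

Local Notation ε := (counit _).
Local Notation S := (antipode _).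
Local Notation Sw h := (sw (comul _) h).

Section CrossedProduct.
Variables (k : fieldType) (A : algType k) (H : hopfAlgebra k).

Record weakAction := WeakAction {
  wact :> H -> A -> A;
  wact_bilin : bilin wact;
  wactM : forall h a b,
    wact h (a * b) = \sum_(x <- Sw h) wact x.1 a * wact x.2 b;
  wact1 : forall h, wact h 1 = (ε h : k)%:A;
  wact1l : forall a, wact 1 a = a }.

Variables (w : weakAction) (f : {linear tensor H H -> A}).

Definition cross_pure (a : A) (h : H) (b : A) (l : H) : tensor A H :=
  \sum_(x <- Sw h) \sum_(y <- Sw x.2) \sum_(z <- Sw l)
    (a * w x.1 b * f (y.1 ⊗ z.1)) ⊗ (y.2 * z.2).

(* The bilinear extension of cross_pure to A (x) H, see cross_mulE. *)
Definition cross_mul (s t : tensor A H) : tensor A H :=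
  \sum_(p <- trepr s) \sum_(q <- trepr t) cross_pure p.1 p.2 q.1 q.2.

Lemma tpureDl (U V : lmodType k) a (x y : U) (v : V) :
  (a *: x + y) ⊗ v = a *: (x ⊗ v) + y ⊗ v.
Proof. by case: (tpure_bilin U V) => bl _; rewrite bl. Qed.

Lemma tpureDr (U V : lmodType k) a (u : U) (x y : V) :
  u ⊗ (a *: x + y) = a *: (u ⊗ x) + u ⊗ y.
Proof. by case: (tpure_bilin U V) => _ bl; rewrite bl. Qed.

Lemma linear_sum (U V : lmodType k) (I : Type) (r : seq I) (g : I -> U -> V) :
  (forall i, linear (g i)) -> linear (fun u => \sum_(i <- r) g i u).
Proof.
move=> lg a u v; rewrite scaler_sumr -big_split; apply: eq_bigr => i _ /=.
by rewrite lg.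
Qed.

Lemma sw_linear (W : lmodType k) (beta : H -> H -> W) : bilin beta ->
  linear (fun h => \sum_(x <- Sw h) beta x.1 x.2).
Proof.
move=> bl a h l; have := tlift_linear bl a (comul H h) (comul H l).
by rewrite -linearP.
Qed.

Lemma cross_pure_bilin1 b l : bilin (fun a h => cross_pure a h b l).
Proof.
split=> [h|a].
  do 3![apply: linear_sum => ?] => c x y.
  by rewrite !mulrDl -!scalerAl tpureDl.
pose g h1 h' : tensor A H := \sum_(y <- Sw h') \sum_(z <- Sw l)
  (a * w h1 b * f (y.1 ⊗ z.1)) ⊗ (y.2 * z.2).
apply: (sw_linear (beta := g)); split=> [h'|h1].
  apply: linear_sum => y; apply: linear_sum => z c x x'.
  case: (wact_bilin w) => + _ => /(_ b c x x') ->.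
  by rewrite mulrDr -scalerAr mulrDl -scalerAl tpureDl.
pose g' h2 h3 : tensor A H := \sum_(z <- Sw l)
  (a * w h1 b * f (h2 ⊗ z.1)) ⊗ (h3 * z.2).
apply: (sw_linear (beta := g')); split=> [h3|h2].
  apply: linear_sum => z c x x'.
  by rewrite tpureDl linearP mulrDr -scalerAr tpureDl.
apply: linear_sum => z c x x'.
by rewrite mulrDl -scalerAl tpureDr.
Qed.

Lemma cross_pure_bilin2 a h : bilin (cross_pure a h).
Proof.
split=> [l|b].
  do 3![apply: linear_sum => ?] => c x y.
  case: (wact_bilin w) => _ /(_ _ c x y) ->.
  by rewrite mulrDr -scalerAr mulrDl -scalerAl tpureDl.
apply: linear_sum => x; apply: linear_sum => y.
apply: (sw_linear (beta := fun l1 l2 =>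
  (a * w x.1 b * f (y.1 ⊗ l1)) ⊗ (y.2 * l2))).
split=> [l2|l1] c u v.
  by rewrite tpureDr linearP mulrDr -scalerAr tpureDl.
by rewrite mulrDr -scalerAr tpureDr.
Qed.

Lemma cross_mul_linearl t : linear (cross_mul^~ t).
Proof.
apply: (tlift_linear (beta := fun a h =>
  \sum_(q <- trepr t) cross_pure a h q.1 q.2)).
split=> [h|a]; apply: linear_sum => q.
  by case: (cross_pure_bilin1 q.1 q.2).
by case: (cross_pure_bilin1 q.1 q.2).
Qed.

Lemma cross_mul_linearr s : linear (cross_mul s).
Proof.
by apply: linear_sum => p; apply: tlift_linear; apply: cross_pure_bilin2.
Qed.

Lemma cross_mulE a h b l : cross_mul (a ⊗ h) (b ⊗ l) = cross_pure a h b l.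
Proof.
transitivity (\sum_(p <- trepr (a ⊗ h)) cross_pure p.1 p.2 b l).
  by apply: eq_bigr => p _; apply: tlift_pure (cross_pure_bilin2 _ _).
exact: (tlift_pure _ _ (cross_pure_bilin1 b l)).
Qed.

Definition is_crossed_product : Prop :=
  [/\ associative cross_mul, left_id (1 ⊗ 1) cross_mul
    & right_id (1 ⊗ 1) cross_mul].

Definition conv_inverse (g : {linear tensor H H -> A}) : Prop :=
  forall h l,
    \sum_(x <- Sw h) \sum_(y <- Sw l) f (x.1 ⊗ y.1) * g (x.2 ⊗ y.2) =
      (ε h * ε l : k)%:A /\
    \sum_(x <- Sw h) \sum_(y <- Sw l) g (x.1 ⊗ y.1) * f (x.2 ⊗ y.2) =
      (ε h * ε l : k)%:A.

Lemma tensor_one_neq0 : (1 : A) ⊗ (1 : H) != 0.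
Proof.
apply/eqP => /tensorP/(_ A (fun a h => (ε h : k) *: a)).
have bl : bilin (fun (a : A) (h : H) => (ε h : k) *: a).
  split=> [h|a] c x y; first by rewrite scalerDr !scalerA mulrC.
  by rewrite linearP scalerDl -scalerA.
move=> /(_ bl); rewrite tlift_pure // [RHS]tlift0 // rmorph1 scale1r.
by move/eqP; rewrite oner_eq0.
Qed.

End CrossedProduct.

Section CrossedAlgebra.
Variables (k : fieldType) (A : algType k) (H : hopfAlgebra k).
Variables (w : weakAction A H) (f : {linear tensor H H -> A}).
Variable wf : is_crossed_product w f.

Definition crossed : Type := let _ := wf in tensor A H.

HB.instance Definition _ := GRing.Lmodule.copy crossed (tensor A H).

Fact crossedA : associative (cross_mul w f). Proof. by case: wf. Qed.
Fact crossed1l : left_id (1 ⊗ 1) (cross_mul w f). Proof. by case: wf. Qed.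
Fact crossed1r : right_id (1 ⊗ 1) (cross_mul w f). Proof. by case: wf. Qed.
Fact crossedDl : left_distributive (cross_mul w f) +%R.
Proof. by move=> x y z; have := cross_mul_linearl w f z 1 x y; rewrite !scale1r. Qed.
Fact crossedDr : right_distributive (cross_mul w f) +%R.
Proof. by move=> x y z; have := cross_mul_linearr w f x 1 y z; rewrite !scale1r. Qed.

HB.instance Definition _ := GRing.Zmodule_isNzRing.Build crossed
  crossedA crossed1l crossed1r crossedDl crossedDr (tensor_one_neq0 A H).

Fact crossed_scalerAl (a : k) (x y : crossed) : a *: (x * y) = a *: x * y.
Proof.
have := cross_mul_linearl w f y a x 0.
have -> : cross_mul w f 0 y = 0 by exact: (@mul0r crossed).
by rewrite !addr0.
Qed.

HB.instance Definition _ :=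
  GRing.Lmodule_isLalgebra.Build k crossed crossed_scalerAl.

Fact crossed_scalerAr (a : k) (x y : crossed) : a *: (x * y) = x * (a *: y).
Proof.
have := cross_mul_linearr w f x a y 0.
have -> : cross_mul w f x 0 = 0 by exact: (@mulr0 crossed).
by rewrite !addr0.
Qed.

HB.instance Definition _ :=
  GRing.Lalgebra_isAlgebra.Build k crossed crossed_scalerAr.

Definition cpure (a : A) (h : H) : crossed := a ⊗ h.

Lemma cpureM a h b l : cpure a h * cpure b l = cross_pure w f a h b l.
Proof. exact: cross_mulE. Qed.

End CrossedAlgebra.

Definition scalars (k : pzRingType) (R : algType k) (M : lmodType R) : Type := M.

Section Scalars.
Variables (k : pzRingType) (R : algType k) (M : lmodType R).

HB.instance Definition _ := GRing.Zmodule.on (scalars M).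

Definition res_scale (c : k) (m : scalars M) : scalars M := (c%:A : R) *: (m : M).

Fact res_scaleA a b m : res_scale a (res_scale b m) = res_scale (a * b) m.
Proof. by rewrite /res_scale scalerA mulr_algl scalerA. Qed.
Fact res_scale1 : left_id 1 res_scale.
Proof. by move=> m; rewrite /res_scale scale1r [LHS]scale1r. Qed.
Fact res_scaleDr : right_distributive res_scale +%R.
Proof. by move=> a m n; rewrite /res_scale [LHS]scalerDr. Qed.
Fact res_scaleDl m : {morph res_scale^~ m : a b / a + b}.
Proof. by move=> a b; rewrite /res_scale scalerDl [LHS]scalerDl. Qed.

HB.instance Definition _ := GRing.Zmodule_isLmodule.Build k (scalars M)
  res_scaleA res_scale1 res_scaleDr res_scaleDl.
End Scalars.

(* The opposite of a k-algebra is a k-algebra.  Right modules over R are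
   left modules over R^c. *)
Section Converse.
Variables (k : pzRingType) (R : algType k).

HB.instance Definition _ := GRing.Nmodule_isLSemiModule.Build k R^c
  (@scalerA k R) (@scale0r k R) (@scale1r k R) (@scalerDr k R)
  (fun v a b => @scalerDl k R v a b).
HB.instance Definition _ := GRing.Lmodule_isLalgebra.Build k R^c
  (fun a u v => @scalerAr k R a v u).
HB.instance Definition _ := GRing.Lalgebra_isAlgebra.Build k R^c
  (fun a u v => @scalerAl k R a v u).
End Converse.

Definition projective (R : pzRingType) (P : lmodType R) : Prop :=
  forall (U V : lmodType R) (g : {linear U -> V}) (f : {linear P -> V}),
    (forall v, exists u, g u = v) ->
    exists f' : {linear P -> U}, forall x, g (f' x) = f x.

Record projResolution (R : pzRingType) (M : lmodType R) := ProjResolution {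
  pres :> nat -> lmodType R;
  pres_d : forall n, {linear pres n.+1 -> pres n};
  pres_aug : {linear pres 0%N -> M};
  pres_proj : forall n, projective (pres n);
  pres_surj : forall m, exists x, pres_aug x = m;
  pres_exact0 : forall x, pres_aug x = 0 <-> exists y, pres_d 0 y = x;
  pres_exact : forall n x, pres_d n x = 0 <-> exists y, pres_d n.+1 y = x }.

Section Ext.
Variables (k : fieldType) (R : algType k) (M N : lmodType R).
Variable P : projResolution M.

Definition ext_cocycle n (f : P n -> scalars N) : Prop :=
  linear (f : P n -> N) /\ forall x, f (pres_d P n x) = 0.

Definition ext_coboundary n : (P n -> scalars N) -> Prop :=
  match n with
  | 0 => fun f => f = 0
  | n'.+1 => fun f => exists2 g : P n' -> scalars N,
      linear (g : P n' -> N) & f = g \o pres_d P n'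
  end.

Lemma ext_linear_subproof (U : lmodType R) a (f g : U -> scalars N) :
  linear (f : U -> N) -> linear (g : U -> N) ->
  linear (a *: f + g : U -> N).
Proof.
move=> lf lg b x y; rewrite !fctE.
rewrite lf lg.
have e u v : a *: (b *: u + v : scalars N) = b *: (a *: (u : scalars N) : N) + (a *: (v : scalars N) : N).
  rewrite scalerDr; congr (_ + _).
  change ((a%:A : R) *: (b *: (u : N)) = b *: ((a%:A : R) *: (u : N))).
  by rewrite !scalerA mulr_algl -scalerAr mulr1.
by rewrite [X in X + _]e scalerDr addrACA.
Qed.

Lemma linear_zero_fct (U : lmodType R) : linear ((0 : U -> scalars N) : U -> N).
Proof. by move=> a x y; rewrite scaler0 addr0. Qed.

Lemma ext_cocycle0 n : @ext_cocycle n 0.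
Proof. by split=> //; apply: linear_zero_fct. Qed.

Lemma ext_cocycleP n a (f g : P n -> scalars N) :
  ext_cocycle f -> ext_cocycle g -> ext_cocycle (a *: f + g).
Proof.
move=> [lf df] [lg dg]; split; first exact: ext_linear_subproof.
by move=> x; rewrite !fctE df dg scaler0 addr0.
Qed.

Lemma ext_coboundary0 n : @ext_coboundary n 0.
Proof. by case: n => [//|n]; exists 0 => //; apply: linear_zero_fct. Qed.

Lemma ext_coboundaryP n a (f g : P n -> scalars N) :
  ext_coboundary f -> ext_coboundary g -> ext_coboundary (a *: f + g).
Proof.
case: n f g => [f g -> ->|n f g [f' lf ->] [g' lg ->]] /=.
  by rewrite scaler0 addr0.
by exists (a *: f' + g') => //; apply: ext_linear_subproof.
Qed.

Definition Ext (n : nat) : lmodType k :=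
  subquot (Submod (@ext_cocycle0 n) (@ext_cocycleP n))
          (Submod (@ext_coboundary0 n) (@ext_coboundaryP n)).
End Ext.

Section GlobalDimension.
Variable R : pzRingType.

Definition pdim_le (M : lmodType R) (n : nat) : Prop :=
  exists P : projResolution M, forall m (x : P m), (n < m)%N -> x = 0.

Definition gldim_le (n : nat) : Prop := forall M : lmodType R, pdim_le M n.

Definition gldim : \bar int :=
  if pselect (exists n, `[< gldim_le n >]) is left e then (ex_minn e)%:Z%:E
  else +oo%E.
End GlobalDimension.

Section TrivialModule.
Variables (k : fieldType) (H : hopfAlgebra k).

(* The trivial right H-module k, as a left module over H^c. *)
Definition trivial_module : Type := let _ := H in k.

HB.instance Definition _ := GRing.Zmodule.copy trivial_module k.

Definition triv_scale (h : (H : algType k)^c) (x : trivial_module) :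
  trivial_module := (ε h : k) * x.

Fact triv_scaleA a b x : triv_scale a (triv_scale b x) = triv_scale (a * b) x.
Proof.
rewrite /triv_scale [in RHS](_ : ε (a * b) = ε a * ε b :> k); last first.
  by rewrite [RHS]mulrC; apply: (rmorphM (counit H)).
by rewrite mulrA.
Qed.
Fact triv_scale1 : left_id 1 triv_scale.
Proof.
by move=> x; rewrite /triv_scale (rmorph1 (counit H) : ε 1 = 1 :> k) mul1r.
Qed.
Fact triv_scaleDr : right_distributive triv_scale +%R.
Proof. by move=> a x y; rewrite /triv_scale [LHS]mulrDr. Qed.
Fact triv_scaleDl x : {morph triv_scale^~ x : a b / a + b}.
Proof.
move=> a b; rewrite /triv_scale.
by rewrite (raddfD (counit H) a b : ε (a + b) = ε a + ε b :> k) [LHS]mulrDl.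
Qed.

HB.instance Definition _ := GRing.Zmodule_isLmodule.Build (H : algType k)^c
  trivial_module triv_scaleA triv_scale1 triv_scaleDr triv_scaleDl.
End TrivialModule.

Section Hochschild.
Variables (k : fieldType) (A : algType k) (H : hopfAlgebra k).
Variables (w : weakAction A H) (f : {linear tensor H H -> A}).
Variable wf : is_crossed_product w f.
Local Notation E := (crossed wf).
Local Notation "a ## h" := (cpure wf a h) (at level 38).
Variables M N : lmodType E.

(* s-cochains are k-multilinear maps from A^s to Hom_k(M, N). *)
Definition cochain (s : nat) : lmodType k :=
  ('I_s -> A) -> scalars M -> scalars N.

Definition subst_arg s (a : 'I_s -> A) (i : 'I_s) (x : A) : 'I_s -> A :=
  fun j => if j == i then x else a j.

Definition multilinear s (phi : cochain s) : Prop :=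
  (forall a, linear (phi a)) /\
  (forall a i, linear (fun x => phi (subst_arg a i x))).

(* phi factors through the s-th power of A / k. *)
Definition normalized s (phi : cochain s) : Prop :=
  forall a i c, a i = c%:A -> phi a = 0.

Definition normalized_cochain s (phi : cochain s) : Prop :=
  multilinear phi /\ normalized phi.

(* (a_0, .., a_s) |-> (a_0, .., a_i a_{i+1}, .., a_s) *)
Definition merge_args s (a : 'I_s.+1 -> A) (i : 'I_s) : 'I_s -> A :=
  fun j => if (j < i)%N then a (widen_ord (leqnSn s) j)
           else if j == i then a (widen_ord (leqnSn s) j) * a (lift ord0 j)
           else a (lift ord0 j).

Definition hochschild_d s (phi : cochain s) : cochain s.+1 := fun a m =>
  ((a ord0 ## 1) *: (phi (fun j => a (lift ord0 j)) m : N) : scalars N)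
  + \sum_(i < s) (-1) ^+ i.+1 *: phi (merge_args a i) m
  + (-1) ^+ s.+1 *: phi (fun j => a (widen_ord (leqnSn s) j))
                        ((a ord_max ## 1) *: (m : M)).

Definition hoch_cocycle s (phi : cochain s) : Prop :=
  normalized_cochain phi /\ hochschild_d phi = 0.

Definition hoch_coboundary s : cochain s -> Prop :=
  match s with
  | 0 => fun phi => phi = 0
  | s'.+1 => fun phi => exists2 psi : cochain s',
      normalized_cochain psi & phi = hochschild_d psi
  end.

Lemma linear_fct (U V : lmodType k) a (g h : U -> V) :
  linear g -> linear h -> linear (a *: g + h).
Proof.
move=> lg lh c x y; rewrite !fctE lg lh !scalerDr !scalerA mulrC.
by rewrite addrACA.
Qed.

Lemma normalized_cochain0 s : normalized_cochain (0 : cochain s).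
Proof.
split=> //; split=> [a|a i] c x y; first by rewrite scaler0 addr0.
by rewrite [RHS](_ : _ = c *: 0 + 0) // scaler0 addr0.
Qed.

Lemma normalized_cochainP s a (phi psi : cochain s) :
  normalized_cochain phi -> normalized_cochain psi ->
  normalized_cochain (a *: phi + psi).
Proof.
move=> [[phi1 phi2] phi3] [[psi1 psi2] psi3]; split; first split.
- by move=> b; apply: linear_fct.
- by move=> b i; apply: linear_fct.
move=> b i c bi; change (a *: phi b + psi b = 0).
by rewrite (phi3 b i c) // (psi3 b i c) // scaler0 addr0.
Qed.

Lemma scalars_scaleC (R : algType k) (P : lmodType R) (c : k) (r : R) (p : P) :
  r *: (c *: (p : scalars P) : P) = (c *: (r *: p : scalars P) : P).
Proof.
change (r *: ((c%:A : R) *: p) = (c%:A : R) *: (r *: p)).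
by rewrite !scalerA mulr_algl -scalerAr mulr1.
Qed.

Lemma hochschild_d_linear s : linear (@hochschild_d s).
Proof.
move=> c phi psi; apply/funext => a; apply/funext => m.
rewrite !fctE /hochschild_d.
set b := fun j => a (lift ord0 j); set b' := fun j => a (widen_ord _ j).
set m' := (a ord_max ## 1) *: (m : M).
have -> : (a ord0 ## 1) *: (((c *: phi + psi) b m : scalars N) : N) =
    (c *: ((a ord0 ## 1) *: (phi b m : N) : scalars N)
     + ((a ord0 ## 1) *: (psi b m : N) : scalars N) : scalars N).
  by rewrite -scalars_scaleC; apply: scalerDr.
have -> : \sum_(i < s) (-1) ^+ i.+1 *: (c *: phi + psi) (merge_args a i) m =
    c *: (\sum_(i < s) (-1) ^+ i.+1 *: phi (merge_args a i) m)
    + \sum_(i < s) (-1) ^+ i.+1 *: psi (merge_args a i) m.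
  rewrite scaler_sumr -big_split; apply: eq_bigr => i _ /=.
  by rewrite !fctE scalerDr !scalerA mulrC.
rewrite !fctE scalerDr !scalerDr !scalerA [c * _]mulrC.
by rewrite [in RHS]addrACA; congr (_ + _); rewrite addrACA.
Qed.

Lemma hoch_cocycle0 s : hoch_cocycle (0 : cochain s).
Proof.
split; first exact: normalized_cochain0.
have := @hochschild_d_linear s (-1) 0 0.
by rewrite scaler0 addr0 scaleN1r addNr.
Qed.

Lemma hoch_cocycleP s a (phi psi : cochain s) :
  hoch_cocycle phi -> hoch_cocycle psi -> hoch_cocycle (a *: phi + psi).
Proof.
move=> [n1 d1] [n2 d2]; split; first exact: normalized_cochainP.
by rewrite hochschild_d_linear d1 d2 scaler0 addr0.
Qed.

Lemma hoch_coboundary0 s : @hoch_coboundary s 0.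
Proof.
case: s => [//|s]; exists 0; first exact: normalized_cochain0.
by case: (hoch_cocycle0 s) => _ ->.
Qed.

Lemma hoch_coboundaryP s a (phi psi : cochain s) :
  hoch_coboundary phi -> hoch_coboundary psi ->
  hoch_coboundary (a *: phi + psi).
Proof.
case: s phi psi => [phi psi -> ->|s phi psi [p np ->] [q nq ->]] /=.
  by rewrite scaler0 addr0.
exists (a *: p + q); first exact: normalized_cochainP.
by rewrite hochschild_d_linear.
Qed.

Definition hoch_cocycles s : submod (cochain s) :=
  Submod (@hoch_cocycle0 s) (@hoch_cocycleP s).
Definition hoch_coboundaries s : submod (cochain s) :=
  Submod (@hoch_coboundary0 s) (@hoch_coboundaryP s).

(* H^s(A, Hom_k(M, N)), that is, Ext_A^s(M, N). *)
Definition HochH (s : nat) : lmodType k :=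
  subquot (hoch_cocycles s) (hoch_coboundaries s).

Variable finv : {linear tensor H H -> A}.

(* The convolution inverse of h |-> 1 # h. *)
Definition cinv (h : H) : E :=
  \sum_(x <- Sw h) \sum_(y <- Sw x.2) (finv (S y.1 ⊗ y.2) ## S x.1).

(* The cochain phi . h; a word v of sweedler (comul H) s.+1 h lists
   h^(1), .., h^(s+2). *)
Definition cochain_act s (h : H) (phi : cochain s) : cochain s := fun a m =>
  \sum_(v <- sweedler (comul H) s.+1 h)
    (cinv v`_0 *: (phi (fun i : 'I_s => w v`_i.+1 (a i))
                       ((1 ## v`_s.+1) *: (m : M)) : N) : scalars N).

(* L is the vector space H^s(A, Hom_k(M, N)) with the right H-action induced
   by the maps cochain_act h on cocycles. *)
Definition induced_module s (L : lmodType (H : algType k)^c) : Prop :=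
  exists2 theta : {linear HochH s -> scalars L}, bijective theta &
  forall (h : H) (z : subspace (hoch_cocycles s)),
    exists2 z' : subspace (hoch_cocycles s),
      val z' = cochain_act h (val z) &
      theta (subquot_class (hoch_coboundaries s) z') =
      (h : (H : algType k)^c) *:
        (theta (subquot_class (hoch_coboundaries s) z) : L).

End Hochschild.

Section SpectralSequence.
Variable k : fieldType.

(* The differentials of the r-th page have bidegree (r, 1 - r); they are given
   as families indexed by a source (p, q) and a target (p', q'), vanishing off
   this bidegree.  With truncated subtraction, an index (p - r, q + r - 1) or
   (p + r, q + 1 - r) outside of the first quadrant is replaced by one at which
   the differential vanishes. *)
Record spectralSequence := SpectralSequence {
  page : nat -> nat -> nat -> lmodType k;
  diff : forall r p q p' q', {linear page r p q -> page r p' q'};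
  diff_bidegree : forall r p q p' q' x, (2 <= r)%N ->
    ~~ [&& p' == (p + r)%N & (q' + r)%N == q.+1] -> diff r p q p' q' x = 0;
  diff_diff : forall r p q p' q' p'' q'' x, (2 <= r)%N ->
    diff r p' q' p'' q'' (diff r p q p' q' x) = 0;
  page_next : forall r p q, (2 <= r)%N ->
    kiso (page r.+1 p q)
         (subquot (kernel (diff r p q (p + r)%N (q.+1 - r)%N))
                  (image (diff r (p - r)%N (q + r)%N.-1 p q))) }.

(* Convergence to T: each T n has a finite decreasing filtration F n whose
   p-th graded piece, for n = p + q, is the stable value of page r p q. *)
Definition converges (ss : spectralSequence) (T : nat -> lmodType k) : Prop :=
  exists F : forall n, nat -> submod (T n),
    [/\ forall n x, F n 0%N x,
        forall n x, F n n.+1 x -> x = 0,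
        forall n p x, F n p.+1 x -> F n p x
      & forall p q r, (p < r)%N -> (q.+1 < r)%N ->
        kiso (page ss r p q) (subquot (F (p + q)%N p) (F (p + q)%N p.+1))].

End SpectralSequence.

(* Main.v *)
Require Import Defs.
From HB Require Import structures.
From mathcomp Require Import all_boot all_algebra.
From mathcomp Require Import boolp classical_sets functions constructive_ereal.
From mathcomp Require Import zify.

(* Let Q be a projective resolution of M over E = A #_f H and P one of the
   trivial right H-module k.  The space Hom_A(Q_s, N) is a right H-module under
   (psi h)(q) = (1 # h^(1))^-1 psi ((1 # h^(2)) q), and H-linear maps from P_r
   into it are the same as E-linear maps Q_s -> Hom_k(P_r, N), where
   (a # h) g = (p |-> (a # h^(1)) g(p h^(2))).  Since Q_s is projective, the
   double complex Hom_H(P_r, Hom_A(Q_s, N)) is therefore exact in the direction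
   of r, so that its total cohomology is Ext_E(M, N), while the filtration by r
   yields the second page H^r(H, H^s(Hom_A(Q, N))).

   The double complex of normalized Hochschild cochains of A with values in
   Hom_k(Q_t, N) identifies H^s(Hom_A(Q, N)) with H^s(A, Hom_k(M, N)).  It is
   exact in the Hochschild direction because Q_t has an A-linear section into
   A (x) Q_t, and exact in the direction of t because k is a field.  The action
   of H extends to the whole double complex, hence the identification is
   H-equivariant and the coefficients do not depend on Q.

   For the global dimensions, the same Hochschild double complex over an
   A-projective resolution of M shows that H^s(A, Hom_k(M, N)) vanishes for
   s > gl.dim A.  As gl.dim H concerns left modules, H^r(H, L) is computed by
   Hom_H(P_r, Hom_k(W_s, L)) for a left resolution W of k; exchanging P and W by
   means of the antipode makes it vanish for r > gl.dim H.  The spectral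
   sequence then annihilates Ext_E^(d+1), d = gl.dim A + gl.dim H, and
   Ext^(d+1)(M, K) = 0 for K the (d+1)-st syzygy of M splits off a projective
   d-th syzygy. *)

Set Implicit Arguments.
Unset Strict Implicit.
Unset Printing Implicit Defensive.

Import GRing.Theory.
Local Open Scope ring_scope.

(** * Linear algebra over a field *)

Section LinearAlgebra.

(** The spaces of linear maps and of cochains are treated as subspaces of spaces of all functions,
    and the identities of a complex are required on these subspaces only. Cohomology spaces are
    compared by linear relations: two classes correspond when one cocycle of a total complex
    represents both, so no choice of lift has to be linear or natural. An operator on the whole
    double complex respects such a relation, and this is how the [H]-action is carried across.
    Splittings over [k] come from complements, hence from Zorn's lemma, and need not respect the
    action of [A] or [H]. Each exactness claim is therefore first brought to a form where a
    [k]-linear splitting or a lift from a projective module suffices. The antipode is not assumed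
    bijective, so twisting along it need not be an equivalence between right and left [H]-modules.
    This is why the passage from left modules to the cohomology of right modules goes through a
    double complex with a resolution of [k] on each side. *)

Lemma submod_scale (k : pzRingType) (V : lmodType k) (Z : submod V) a x :
  Z x -> Z (a *: x).
Proof. by move=> Zx; rewrite -[_ *: _]addr0; apply/submodP/submod0. Qed.

Lemma submod_add (k : pzRingType) (V : lmodType k) (Z : submod V) x y :
  Z x -> Z y -> Z (x + y).
Proof. by move=> Zx Zy; rewrite -[x]scale1r; apply: submodP. Qed.

Lemma submod_opp (k : pzRingType) (V : lmodType k) (Z : submod V) x :
  Z x -> Z (- x).
Proof. by rewrite -scaleN1r; apply: submod_scale. Qed.

Lemma submod_sub (k : pzRingType) (V : lmodType k) (Z : submod V) x y :
  Z x -> Z y -> Z (x - y).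
Proof. by move=> Zx /submod_opp; apply: submod_add. Qed.

Lemma scale_comm (k : comPzRingType) (V : lmodType k) a b (v : V) :
  a *: (b *: v) = b *: (a *: v).
Proof. by rewrite !scalerA mulrC. Qed.

Definition lin_pack (k : pzRingType) (U V : lmodType k) (f : U -> V)
  (lf : linear f) : {linear U -> V} :=
  HB.pack f (GRing.isLinear.Build k U V *:%R f lf).

Lemma lin0 (k : pzRingType) (U V : lmodType k) (f : U -> V) :
  linear f -> f 0 = 0.
Proof. by move=> lf; apply: (linear0 (lin_pack lf)). Qed.

Lemma linD (k : pzRingType) (U V : lmodType k) (f : U -> V) :
  linear f -> {morph f : x y / x + y}.
Proof. by move=> lf; apply: (linearD (lin_pack lf)). Qed.

Lemma linB (k : pzRingType) (U V : lmodType k) (f : U -> V) :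
  linear f -> {morph f : x y / x - y}.
Proof. by move=> lf; apply: (linearB (lin_pack lf)). Qed.

Lemma linZ (k : pzRingType) (U V : lmodType k) (f : U -> V) :
  linear f -> forall a, {morph f : x / a *: x}.
Proof. by move=> lf a x; apply: (linearZZ (lin_pack lf)). Qed.

Lemma lin_sum (k : pzRingType) (U V : lmodType k) (f : U -> V) :
  linear f -> forall I (r : seq I) (F : I -> U),
  f (\sum_(i <- r) F i) = \sum_(i <- r) f (F i).
Proof. by move=> lf I r F; apply: (linear_sum (lin_pack lf)). Qed.

(** Such a relation is the graph of an isomorphism: two partners of [u] differ by a partner of 0,
    which is 0. It serves where a comparison is known only through auxiliary choices. *)
Lemma lin_rel_iso (k : pzRingType) (U V : lmodType k) (rho : U -> V -> Prop) :
  (forall a u u' v v', rho u v -> rho u' v' -> rho (a *: u + u') (a *: v + v')) ->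
  (forall u, exists v, rho u v) -> (forall v, exists u, rho u v) ->
  (forall u v, rho u v -> (u = 0 <-> v = 0)) ->
  exists2 th : {linear U -> V}, bijective th & forall u v, rho u v <-> th u = v.
Proof.
move=> lr tot srj ker.
have subr u v u' v' : rho u v -> rho u' v' -> rho (u - u') (v - v').
  move=> r1 r2; have := lr (-1) _ _ _ _ r2 r1.
  by rewrite !scaleN1r ![- _ + _]addrC.
have [t tP] := choice tot; have [t' t'P] := choice srj.
have fn u v : rho u v -> t u = v.
  move=> r; apply/eqP; rewrite -subr_eq0; apply/eqP.
  by apply/(ker _ _ (subr _ _ _ _ (tP u) r)); rewrite subrr.
have lt : linear t.
  by move=> a u v; apply: fn; apply: lr.
exists (lin_pack lt); last by move=> u v; split=> [/fn//|/= <-].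
exists t' => [u|v] /=; last exact: fn.
apply/eqP; rewrite -subr_eq0; apply/eqP.
by apply/(ker _ _ (subr _ _ _ _ (t'P _) (tP u))); rewrite subrr.
Qed.

Lemma kiso_trans (k : pzRingType) (U V W : lmodType k) :
  kiso U V -> kiso V W -> kiso U W.
Proof.
move=> [f bf] [g bg].
have l : linear (g \o f) by move=> a x y /=; rewrite !linearP.
by exists (lin_pack l); apply: bij_comp.
Qed.

Definition subel (k : pzRingType) (V : lmodType k) (Z : submod V) x (Zx : Z x) :
  subspace Z := Subspace (asboolT Zx).

Lemma subspaceP (k : pzRingType) (V : lmodType k) (Z : submod V)
  (x : subspace Z) : Z (val x).
Proof. by case: x => x /= /asboolP. Qed.

Lemma subquot_class_eq0 (k : pzRingType) (V : lmodType k) (Z B : submod V)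
  (x : subspace Z) : subquot_class B x = 0 <-> B (val x).
Proof.
have -> : 0 = subquot_class B (0 : subspace Z).
  by rewrite -(subrr (0 : subspace Z)) subquot_classB subrr.
have e0 : val (0 : subspace Z) = 0 by exact: raddf0.
by rewrite subquot_classP e0 subr0.
Qed.

Lemma subquot_class_linear (k : pzRingType) (V : lmodType k) (Z B : submod V) :
  linear (subquot_class B : subspace Z -> subquot Z B).
Proof.
move=> a x y; rewrite subquot_classD; congr (_ + _).
by rewrite [RHS]subquot_scaleE.
Qed.

Lemma submap_linear (k : pzRingType) (U V : lmodType k) (Z : submod U)
  (Y : submod V) (g : U -> V) : (forall a x y, Z x -> Z y ->
    g (a *: x + y) = a *: g x + g y) ->
  forall gZ : (forall x, Z x -> Y (g x)),
  linear (fun x : subspace Z => subel (gZ _ (subspaceP x))).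
Proof.
move=> lg gZ a x y; apply: val_inj => /=; rewrite lg //; exact: subspaceP.
Qed.

Definition submap (k : pzRingType) (U V : lmodType k) (Z : submod U)
  (Y : submod V) (g : {linear U -> V}) (gZ : forall x, Z x -> Y (g x)) :
  {linear subspace Z -> subspace Y} :=
  lin_pack (submap_linear (fun a x y _ _ => linearP g a x y) gZ).

(** The relation lives on representatives and need not be functional; it only has to match the two
    denominators, so arbitrary lifts may enter it. *)
Lemma subquot_iso (k : pzRingType) (U V : lmodType k) (Z B : submod U)
    (Z' B' : submod V) (R : U -> V -> Prop) :
  (forall a u u' v v', R u v -> R u' v' -> R (a *: u + u') (a *: v + v')) ->
  (forall u, Z u -> exists2 v, Z' v & R u v) ->
  (forall v, Z' v -> exists2 u, Z u & R u v) ->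
  (forall u v, Z u -> Z' v -> R u v -> (B u <-> B' v)) ->
  exists2 th : {linear subquot Z B -> subquot Z' B'}, bijective th &
    forall (u : subspace Z) (v : subspace Z'), R (val u) (val v) ->
    th (subquot_class B u) = subquot_class B' v.
Proof.
move=> lR tot srj ker.
pose rho (p : subquot Z B) (q : subquot Z' B') :=
  exists u v, [/\ R (val u) (val v), p = subquot_class B u & q = subquot_class B' v].
have [|p|q|p q|th bth thP] := @lin_rel_iso _ _ _ rho.
- move=> a _ _ _ _ [u [v [r -> ->]]] [u' [v' [r' -> ->]]].
  exists (a *: u + u'), (a *: v + v'); split; last 2 first.
  + by rewrite subquot_class_linear.
  + by rewrite subquot_class_linear.
  by rewrite /=; apply: lR.
- elim/subquot_ind: p => u; have [v Zv r] := tot _ (subspaceP u).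
  by exists (subquot_class B' (subel Zv)), u, (subel Zv).
- elim/subquot_ind: q => v; have [u Zu r] := srj _ (subspaceP v).
  by exists (subquot_class B (subel Zu)), (subel Zu), v.
- move=> [u [v [r -> ->]]]; rewrite !subquot_class_eq0.
  by apply: ker => //; apply: subspaceP.
exists th => // u v r; apply/thP; by exists u, v.
Qed.

Lemma subquot_kiso (k : pzRingType) (U V : lmodType k) (R : U -> V -> Prop)
    (Z B : submod U) (Z' B' : submod V) :
  (forall a u u' v v', R u v -> R u' v' -> R (a *: u + u') (a *: v + v')) ->
  (forall u, Z u -> exists2 v, Z' v & R u v) ->
  (forall v, Z' v -> exists2 u, Z u & R u v) ->
  (forall u v, Z u -> Z' v -> R u v -> (B u <-> B' v)) ->
  kiso (subquot Z B) (subquot Z' B').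
Proof.
by move=> lR t s z; have [th bth _] := subquot_iso lR t s z; exists th.
Qed.

Section Field.
Variable k : fieldType.

Lemma submod_complement (V : lmodType k) (Z : submod V) :
  exists A : submod V, (forall x, A x -> Z x -> x = 0) /\
    forall v, exists z b, [/\ Z z, A b & v = z + b].
Proof.
(* [P] does not ask for 0, so that the union of the empty chain satisfies it; that a maximal set
   contains 0 is proved afterwards. *)
pose P (B : set V) := (forall a x y, B x -> B y -> B (a *: x + y)) /\
  (forall x, B x -> Z x -> x = 0).
have [|A [[Alin Atriv] Amax]] := @Zorn_bigcup V P.
  move=> F FP tot; split=> [a x y [X FX Xx] [Y FY Yy]|x [X FX Xx]]; last first.
    by case: (FP _ FX) => _; apply.
  have [XY|YX] := tot _ _ FX FY.
    by exists Y => //; case: (FP _ FY) => + _; apply=> //; apply: XY.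
  by exists X => //; case: (FP _ FX) => + _; apply=> //; apply: YX.
have A0 : A 0.
  apply: contrapT => nA; apply: (Amax (fun x => A x \/ x = 0)).
    split=> [x|/(_ 0) A0]; first by left.
    by apply: nA; apply: A0; right.
  split=> [a x y [Ax|->] [Ay|->]|x [/Atriv//|//]].
  - by left; apply: Alin.
  - case: nA; rewrite -[0](addNr x) -[- x]scaleN1r; exact: Alin.
  - by left; rewrite scaler0 add0r.
  - by right; rewrite scaler0 add0r.
pose A' := Submod A0 Alin.
exists A'; split=> // v; apply: contrapT => nv.
pose B := fun x : V => exists c b, A b /\ x = c *: v + b.
apply: (Amax B).
  split=> [x Ax|/(_ v) Bv]; first by exists 0, x; rewrite scale0r add0r.
  have Av : A v by apply: Bv; exists 1, 0; rewrite scale1r addr0.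
  apply: nv; exists 0, v; split=> //; [exact: submod0 | by rewrite add0r].
split.
  move=> a _ _ [c [b [Ab ->]]] [c' [b' [Ab' ->]]].
  exists (a * c + c'), (a *: b + b'); split; first exact: (submodP (s := A')).
  by rewrite scalerDr scalerA scalerDl addrACA.
move=> _ [c [b [Ab ->]]]; have [->|c0] := eqVneq c 0.
  by rewrite scale0r add0r; apply: Atriv.
move=> Zx; case: nv; exists (c^-1 *: (c *: v + b)), (- c^-1 *: b); split.
- exact: submod_scale.
- exact: (submod_scale (Z := A')).
by rewrite scalerDr scalerA mulVf // scale1r scaleNr addrK.
Qed.

Lemma submod_retraction (V : lmodType k) (Z : submod V) :
  exists r : {linear V -> V}, (forall v, Z (r v)) /\ (forall v, Z v -> r v = v).
Proof.
have [A [triv dec]] := submod_complement Z.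
have /choice[r rP] : forall v, exists z, Z z /\ A (v - z).
  move=> v; have [z [b [Zz Ab ->]]] := dec v; exists z.
  by rewrite addrC addKr.
have uniq v z : Z z -> A (v - z) -> r v = z.
  move=> Zz Az; have [Zr Ar] := rP v.
  apply/eqP; rewrite -subr_eq0; apply/eqP/triv; last exact: submod_sub.
  have -> : r v - z = (v - z) - (v - r v).
    by rewrite opprB [RHS]addrC addrA subrK.
  exact: submod_sub.
have lr : linear r.
  move=> a x y; have [Zx Ax] := rP x; have [Zy Ay] := rP y.
  apply: uniq; first exact: submodP.
  rewrite opprD addrACA -scalerBr; exact: submodP.
exists (lin_pack lr); split=> v /=; first by case: (rP v).
by move=> Zv; apply: uniq => //; rewrite subrr; apply: submod0.
Qed.

(** A choice [p] of preimages is linear modulo the kernel of [d]; subtracting its projection to the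
    kernel makes it linear. *)
Lemma linear_quasi_inverse (U V : lmodType k) (d : U -> V) : linear d ->
  exists2 c : V -> U, linear c & forall x, d (c (d x)) = d x.
Proof.
move=> ld; have [r [rK rid]] := submod_retraction (kernel (lin_pack ld)).
have [q [qI qid]] := submod_retraction (Defs.image (lin_pack ld)).
have dr x : d (r x) = 0 by apply: (rK x).
have /choice[p pP] : forall v, exists u, d u = q v by move=> v; apply: qI.
have lc : linear (fun v => p v - r (p v)).
  move=> a x y.
  have e : p (a *: x + y) - (a *: p x + p y) =
      r (p (a *: x + y) - (a *: p x + p y)).
    by symmetry; apply: rid; rewrite /= (linB ld) ld !pP linearP subrr.
  rewrite scalerBr addrACA -opprD -linearP.
  set b := a *: p x + p y in e *; set w := p _ in e *.
  rewrite -[w](subrK b) (linearD r (w - b)) -e; set z := w - b.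
  by rewrite [z + b]addrC opprD addrA addrK.
exists (fun v => p v - r (p v)) => // x; rewrite (linB ld) dr subr0 pP qid //.
by exists x.
Qed.

(** Exactness of Hom_k(-, N) over a field. One [c] serves all [N] and [x], so applying it inside a
    cochain keeps linearity in the other arguments. *)
Lemma linear_factor (U V : lmodType k) (d : U -> V) : linear d ->
  exists2 c : V -> U, linear c & forall (N : lmodType k) (x : U -> N), linear x ->
    (forall u, d u = 0 -> x u = 0) -> forall u, x (c (d u)) = x u.
Proof.
move=> ld; have [c lc dcd] := linear_quasi_inverse ld; exists c => // N x lx x0 u.
apply/eqP; rewrite -subr_eq0 -(linB lx); apply/eqP; apply: x0.
by rewrite (linB ld) dcd subrr.
Qed.

End Field.
End LinearAlgebra.

(** * The spectral sequence of a filtered complex *)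

Section FilteredComplex.
Variables (k : fieldType) (V : lmodType k) (D : {linear V -> V}).

(* [C n.+1] is the space of elements of degree [n], and [C 0] is zero. *)
Variables C F : nat -> submod V.
Hypothesis CD : forall n x, C n x -> C n.+1 (D x).
Hypothesis CDD : forall n x, C n x -> D (D x) = 0.
Hypothesis F0 : forall x, F 0%N x.
Hypothesis FS : forall p x, F p.+1 x -> F p x.
Hypothesis FD : forall p x, F p x -> F p (D x).
Hypothesis FC : forall n x, C n.+1 x -> F n.+1 x -> x = 0.

Lemma filt_le p p' x : (p' <= p)%N -> F p x -> F p' x.
Proof.
move=> /subnKC <-; elim: (p - p')%N => [|m IHm]; first by rewrite addn0.
by rewrite addnS => /FS.
Qed.

Fact pageZ0 r p q :
  [/\ C (p + q).+1 (0 : V), F p (0 : V) & F (p + r)%N (D 0)].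
Proof. by split; rewrite ?linear0; exact: submod0. Qed.

Fact pageZP r p q a x y :
  [/\ C (p + q).+1 x, F p x & F (p + r)%N (D x)] ->
  [/\ C (p + q).+1 y, F p y & F (p + r)%N (D y)] ->
  [/\ C (p + q).+1 (a *: x + y), F p (a *: x + y)
    & F (p + r)%N (D (a *: x + y))].
Proof. by move=> [? ? ?] [? ? ?]; split; rewrite ?linearP; exact: submodP. Qed.

Definition pageZ r p q : submod V := Submod (pageZ0 r p q) (@pageZP r p q).

(** The usual denominator $D Z_{r-1}^{p-r+1} + Z_{r-1}^{p+1}$, up to elements outside [pageZ], which
    [subquot] discards. Where [p.+1 - r] is truncated to 0, the filtration step is the whole space,
    as it should be. *)
Definition pageB_set r p q (x : V) := exists y,
  [/\ C (p + q)%N y, F (p.+1 - r)%N y & F p.+1 (x - D y)].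

Fact pageB0 r p q : pageB_set r p q 0.
Proof. by exists 0; split; rewrite ?linear0 ?addr0; exact: submod0. Qed.

Fact pageBP r p q a x y :
  pageB_set r p q x -> pageB_set r p q y -> pageB_set r p q (a *: x + y).
Proof.
move=> [x' [? ? ?]] [y' [? ? ?]]; exists (a *: x' + y').
split; try exact: submodP.
by rewrite linearP opprD addrACA -scalerBr; apply: submodP.
Qed.

Definition pageB r p q : submod V := Submod (pageB0 r p q) (@pageBP r p q).

Definition fpage r p q : lmodType k := subquot (pageZ r p q) (pageB r p q).

Definition bidegree r p q p' q' := (p' == p + r)%N && (q' + r == q.+1)%N.

Lemma bidegree_add r p q p' q' :
  bidegree r p q p' q' -> (p' + q' = (p + q).+1)%N.
Proof.
by case/andP=> /eqP-> /eqP e; rewrite -addnA [(r + _)%N]addnC e addnS.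
Qed.

Lemma pageZ_D r p q p' q' x :
  bidegree r p q p' q' -> pageZ r p q x -> pageZ r p' q' (D x).
Proof.
move=> bd [Cx Fx Dx]; split.
- by rewrite (bidegree_add bd); apply: CD.
- by case/andP: bd => /eqP->.
by rewrite (CDD Cx); apply: submod0.
Qed.

Lemma pageB_D r p q p' q' x :
  bidegree r p q p' q' -> pageZ r p q x -> pageB r p q x ->
  pageB r p' q' (D x).
Proof.
move=> bd [Cx Fx Dx] [y [Cy Fy xy]]; exists (x - D y); split.
- by rewrite (bidegree_add bd); apply: submod_sub => //; apply: CD.
- by case/andP: bd => /eqP-> _; rewrite -addSn addnK.
by rewrite linearB (CDD Cy) subr0 subrr; apply: submod0.
Qed.

(** A spectral sequence has a differential between any two bidegrees here. Only pairs of bidegree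
    $(r, 1-r)$ get the map induced by [D]; the others get zero, which makes truncated indices
    harmless. *)
Lemma fdiff_exists r p q p' q' :
  exists d : {linear fpage r p q -> fpage r p' q'},
  (bidegree r p q p' q' -> forall (z : subspace (pageZ r p q)) (z' : subspace (pageZ r p' q')), val z' = D (val z) ->
    d (subquot_class (pageB r p q) z) = subquot_class (pageB r p' q') z') /\
  (~~ bidegree r p q p' q' -> forall x, d x = 0).
Proof.
have [bd|nbd] := boolP (bidegree r p q p' q'); last first.
  by exists (GRing.null_fun _).
pose g := submap (fun x => pageZ_D (x := x) bd).
have /choice[rp rpK] : forall c : fpage r p q, exists z, subquot_class _ z = c.
  by elim/subquot_ind=> z; exists z.
pose h c : fpage r p' q' := subquot_class (pageB r p' q') (g (rp c)).
have hE z : h (subquot_class (pageB r p q) z) = subquot_class (pageB r p' q') (g z).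
  apply/subquot_classP; rewrite -(raddfB val) -linearB.
  set u := _ - z; have Bu : pageB r p q (val u).
    by rewrite raddfB; apply/subquot_classP/rpK.
  exact: pageB_D bd (subspaceP u) Bu.
have lh : linear h.
  move=> a; elim/subquot_ind=> x; elim/subquot_ind=> y.
  by rewrite -subquot_class_linear !hE linearP subquot_class_linear.
exists (lin_pack lh); split=> // _ z z' e.
by rewrite /= hE; congr subquot_class; apply: val_inj; rewrite e.
Qed.

Definition fdiff r p q p' q' := projT1 (cid (fdiff_exists r p q p' q')).

Lemma fdiffE r p q p' q' (z : subspace (pageZ r p q)) (z' : subspace (pageZ r p' q')) :
  bidegree r p q p' q' -> val z' = D (val z) ->
  fdiff r p q p' q' (subquot_class (pageB r p q) z) =
  subquot_class (pageB r p' q') z'.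
Proof. by rewrite /fdiff; case: cid => d [dE d0] /= bd; apply: dE. Qed.

Lemma fdiff0 r p q p' q' x : ~~ bidegree r p q p' q' -> fdiff r p q p' q' x = 0.
Proof. by rewrite /fdiff; case: cid => d [dE d0] /= bd; apply: d0. Qed.

Lemma fdiff_diff r p q p' q' p'' q'' x :
  fdiff r p' q' p'' q'' (fdiff r p q p' q' x) = 0.
Proof.
have [bd|/fdiff0->] := boolP (bidegree r p q p' q'); last by rewrite linear0.
have [bd'|/fdiff0-> //] := boolP (bidegree r p' q' p'' q'').
elim/subquot_ind: x => x.
pose y := subel (pageZ_D bd (subspaceP x)).
pose z := subel (pageZ_D bd' (subspaceP y)).
rewrite (fdiffE (z' := y)) // (fdiffE (z' := z)) //.
apply/subquot_class_eq0 => /=; case: (subspaceP x) => Cx _ _.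
by rewrite (CDD Cx); apply: pageB0.
Qed.

(** A representative on page $r+1$ is one on page $r$. Conversely $d_r[z] = 0$ gives $y$ in
    $F^{p+1}$ with $Dz - Dy$ in $F^{p+r+1}$, so $z - y$ represents $[z]$ on page $r+1$. *)
Lemma fpage_next r p q : (2 <= r)%N ->
  kiso (fpage r.+1 p q)
    (subquot (kernel (fdiff r p q (p + r)%N (q.+1 - r)%N))
             (Defs.image (fdiff r (p - r)%N (q + r)%N.-1 p q))).
Proof.
move=> r2; have r0 : (0 < r)%N by apply: leq_trans r2.
pose R (x : V) (c : fpage r p q) :=
  exists2 z : subspace (pageZ r p q), val z = x & subquot_class (pageB r p q) z = c.
have dbd : bidegree r p q (p + r)%N (q.+1 - r)%N = (r <= q.+1)%N.
  rewrite /bidegree eqxx /=; apply/eqP/idP => [<-|]; first exact: leq_addl.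
  exact: subnK.
have sbd : bidegree r (p - r)%N (q + r).-1 p q = (r <= p)%N.
  rewrite /bidegree prednK ?addn_gt0 ?r0 ?orbT // eqxx andbT.
  by apply/eqP/idP => [->|/subnK]; [exact: leq_addl | move->].
have ZS x : pageZ r.+1 p q x -> pageZ r p q x.
  by case=> ? ? Dx; split=> //; apply: FS; rewrite -addnS.
apply: (subquot_kiso (R := R)) => [|x Zx|c|x c Zx].
- move=> a _ _ _ _ [z <- <-] [z' <- <-]; exists (a *: z + z') => //.
  by rewrite subquot_class_linear.
- pose z := subel (ZS _ Zx); exists (subquot_class _ z); last by exists z.
  rewrite /=; have [bd|/fdiff0-> //] := boolP (bidegree r p q (p + r)%N (q.+1 - r)%N).
  rewrite (fdiffE (z' := subel (pageZ_D bd (subspaceP z)))) //.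
  apply/subquot_class_eq0; exists 0.
  have [_ _ Dx] := Zx; rewrite linear0 subr0 -addnS.
  by split=> //; exact: submod0.
- elim/subquot_ind: c => z dz; have [Cz Fz Dz] := subspaceP z.
  (* When $q + 1 < r$ the differential is zero by truncation and says nothing, but [D z] has degree
     $p + q + 1$ and lies in $F^{p+r}$, hence vanishes. *)
  have [bd|nbd] := boolP (bidegree r p q (p + r)%N (q.+1 - r)%N); last first.
    exists (val z); last by exists z.
    split=> //; rewrite (FC (CD Cz)); first exact: submod0.
    move: nbd; rewrite dbd -ltnNge => qr; apply: filt_le Dz.
    by rewrite -2!addnS leq_add2l.
  move: dz; rewrite /= (fdiffE (z' := subel (pageZ_D bd (subspaceP z)))) //.
  have e1 : ((p + r).+1 - r = p.+1)%N by rewrite -addSn addnK.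
  case/subquot_class_eq0=> y /=; rewrite (bidegree_add bd) e1.
  case=> Cy Fy Dzy.
  have Zu : pageZ r.+1 p q (val z - y).
    split; [exact: submod_sub | by apply: submod_sub => //; apply: FS|].
    by rewrite addnS linearB.
  exists (val z - y) => //; exists (subel (ZS _ Zu)) => //.
  apply/subquot_classP; rewrite /= addrAC subrr sub0r.
  exists 0; rewrite linear0 subr0; split; try exact: submod0.
  exact: submod_opp.
(* For $p < r$ no differential arrives at $(p, q)$, and both denominators use the filtration step
   0. *)
move=> _ [z zx <-]; rewrite -zx in Zx *; have [rp|pr] := leqP r p; last first.
  have e0 : (p.+1 - r = 0)%N by apply/eqP; rewrite subn_eq0.
  have e1 : (p.+1 - r.+1 = 0)%N by apply/eqP; rewrite subSS subn_eq0 ltnW.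
  have -> : pageB r.+1 p q (val z) <-> pageB r p q (val z).
    by split=> -[y]; rewrite ?e0 ?e1 => yP; exists y; rewrite ?e0 ?e1.
  rewrite -subquot_class_eq0; split=> [->|[u <-]].
    by exists 0; rewrite linear0.
  by rewrite fdiff0 // sbd -ltnNge.
have e : ((p - r + (q + r).-1).+1 = p + q)%N.
  rewrite -addnS prednK ?addn_gt0 ?r0 ?orbT // [(q + r)%N]addnC addnA.
  by rewrite subnK.
split=> [[y [Cy Fy xy]]|[c']].
  have Zy : pageZ r (p - r)%N (q + r).-1 y.
    split; [by rewrite e | by rewrite subSS in Fy|].
    rewrite subnK //; have -> : D y = val z - (val z - D y).
      by rewrite opprB addrC subrK.
    by apply: submod_sub; [case: Zx | apply: FS].
  exists (subquot_class _ (subel Zy)); rewrite -sbd in rp.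
  rewrite (fdiffE (z' := subel (pageZ_D rp Zy))) //.
  apply/subquot_classP => /=; exists 0; rewrite linear0 subr0.
  split; try exact: submod0.
  by rewrite -opprB; apply: submod_opp.
elim/subquot_ind: c' => y; have [Cy Fy Dy] := subspaceP y.
have bd := rp; rewrite -sbd in bd.
rewrite (fdiffE (z' := subel (pageZ_D bd (subspaceP y)))) //.
move/esym/subquot_classP => [y' [Cy' Fy' xy]]; exists (val y + y'); split.
- by apply: submod_add => //; rewrite -e.
- rewrite subSS; apply: submod_add => //; apply: filt_le Fy'.
  exact/leq_sub2r.
by rewrite linearD opprD addrA.
Qed.

Definition filtered_ss : spectralSequence k :=
  @SpectralSequence k fpage fdiff
    (fun r p q p' q' x _ nbd => fdiff0 x nbd)
    (fun r p q p' q' p'' q'' x _ => fdiff_diff p' q' p'' q'' x)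
    fpage_next.

Section Convergence.
Variables (T : nat -> lmodType k) (cl : forall n, V -> T n).
Hypothesis cl_lin : forall n a x y, C n.+1 x -> D x = 0 -> C n.+1 y -> D y = 0 ->
  cl n (a *: x + y) = a *: cl n x + cl n y.
Hypothesis cl_surj : forall n t, exists x, [/\ C n.+1 x, D x = 0 & cl n x = t].
Hypothesis cl_ker : forall n x, C n.+1 x -> D x = 0 ->
  cl n x = 0 <-> exists2 y, C n y & x = D y.

Definition limF_set n p (t : T n) :=
  exists x, [/\ C n.+1 x, D x = 0, F p x & cl n x = t].

Fact cl0 n : cl n 0 = 0.
Proof.
by apply/cl_ker; rewrite ?linear0 //; [exact: submod0 | exists 0; rewrite ?linear0 //; apply: submod0].
Qed.

Fact limF0 n p : @limF_set n p 0.
Proof. by exists 0; rewrite linear0 cl0; split=> //; exact: submod0. Qed.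

Fact limFP n p a s t : @limF_set n p s -> limF_set p t -> limF_set p (a *: s + t).
Proof.
move=> [x [Cx Dx Fx <-]] [y [Cy Dy Fy <-]]; exists (a *: x + y).
by rewrite cl_lin // linearP Dx Dy scaler0 addr0; split=> //; apply: submodP.
Qed.

Definition limF n p : submod (T n) := Submod (@limF0 n p) (@limFP n p).

(** With $p < r$ and $q + 1 < r$, the element [D x] of $F^{p+r}$ is zero by degree and the [y] of
    the denominator is unrestricted, so page $r$ is already the graded piece. *)
Lemma filtered_converges : converges filtered_ss T.
Proof.
exists limF; split.
- by move=> n t; have [x [Cx Dx <-]] := cl_surj t; exists x.
- by move=> n _ [x [Cx Dx Fx <-]]; rewrite (FC Cx Fx) cl0.
- by move=> n p _ [x [Cx Dx Fx <-]]; exists x; split=> //; apply: FS.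
move=> p q r pr qr.
have Zr x : pageZ r p q x <-> [/\ C (p + q).+1 x, F p x & D x = 0].
  split=> -[Cx Fx Dx]; split=> //; last by rewrite Dx; apply: submod0.
  apply: FC (CD Cx) _; apply: filt_le Dx.
  by rewrite -2!addnS leq_add2l.
have e0 : (p.+1 - r = 0)%N by apply/eqP; rewrite subn_eq0.
pose R x (t : T (p + q)%N) := [/\ C (p + q).+1 x, D x = 0 & cl _ x = t].
apply: (subquot_kiso (R := R)) =>
  [|x Zx|t [x [Cx Dx Fx clx]]|x t Zx tF [Cx Dx clx]].
- move=> a x y s t [Cx Dx <-] [Cy Dy <-]; split; first exact: submodP.
    by rewrite linearP Dx Dy scaler0 addr0.
  by rewrite cl_lin.
- have [Cx Fx Dx] := (Zr x).1 Zx; exists (cl _ x) => //; by exists x.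
- by exists x => //; apply/Zr.
split=> [[y [Cy _ xy]]|[x' [Cx' Dx' Fx' e]]].
  have CDy := CD Cy; have DDy := CDD Cy.
  exists (x - D y); split=> //; first exact: submod_sub.
    by rewrite linearB Dx DDy subr0.
  rewrite addrC -scaleN1r cl_lin // clx.
  have /cl_ker-> // : exists2 y', C (p + q)%N y' & D y = D y' by exists y.
  by rewrite scaler0 add0r.
have Cd : C (p + q).+1 (x - x') by apply: submod_sub.
have Dd : D (x - x') = 0 by rewrite linearB Dx Dx' subr0.
have : cl (p + q)%N (x - x') = 0.
  by rewrite addrC -scaleN1r cl_lin // clx e scaleN1r addNr.
case/cl_ker=> // y Cy xy; exists y; split=> //; first by rewrite e0.
by rewrite -xy opprB addrC subrK.
Qed.

End Convergence.

Fact cyc0 n : C n.+1 0 /\ D 0 = 0.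
Proof. by rewrite linear0; split=> //; apply: submod0. Qed.

Fact cycP n a x y : C n.+1 x /\ D x = 0 -> C n.+1 y /\ D y = 0 ->
  C n.+1 (a *: x + y) /\ D (a *: x + y) = 0.
Proof.
move=> [Cx Dx] [Cy Dy]; rewrite linearP Dx Dy scaler0 addr0.
by split=> //; apply: submodP.
Qed.

Definition cyc n : submod V := Submod (@cyc0 n) (@cycP n).

Fact bdr0 n : exists2 y, C n y & 0 = D y.
Proof. by exists 0; rewrite ?linear0 //; apply: submod0. Qed.

Fact bdrP n a x x' : (exists2 y, C n y & x = D y) ->
  (exists2 y, C n y & x' = D y) -> exists2 y, C n y & a *: x + x' = D y.
Proof.
by move=> [y Cy ->] [y' Cy' ->]; exists (a *: y + y'); rewrite ?linearP //; apply: submodP.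
Qed.

Definition bdr n : submod V := Submod (@bdr0 n) (@bdrP n).

Lemma filtered_converges_kiso (T : nat -> lmodType k) :
  (forall n, kiso (subquot (cyc n) (bdr n)) (T n)) -> converges filtered_ss T.
Proof.
move=> /(_ _)/cid-/all_sig[th bth].
(* [filtered_converges] wants a function on all of [V]; 0 is its default value off the cycles. *)
pose cl n (x : V) : T n := if pselect (cyc n x) is left cx
  then th n (subquot_class (bdr n) (subel cx)) else 0.
have clE n x (cx : cyc n x) : cl n x = th n (subquot_class (bdr n) (subel cx)).
  by rewrite /cl; case: pselect => // cx'; rewrite (Prop_irrelevance cx cx').
apply: (filtered_converges (cl := cl)).
- move=> n a x y Cx Dx Cy Dy.
  have cx : cyc n x by []. have cy : cyc n y by [].
  have cz : cyc n (a *: x + y) by apply: submodP.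
  rewrite !clE -linearP -subquot_class_linear; congr (th n _).
  by congr subquot_class; apply: val_inj.
- move=> n t; have [g gK gK'] := bth n; have := gK' t.
  elim/subquot_ind: (g t) => x <-; have cx := subspaceP x.
  exists (val x); case: (cx) => Cx Dx; split=> //; rewrite clE.
  by congr (th n _); congr subquot_class; apply: val_inj.
move=> n x Cx Dx; have cx : cyc n x by [].
rewrite clE -[X in _ <-> X](subquot_class_eq0 (bdr n) (subel cx)).
split=> [e|->]; last exact: linear0.
by apply: (bij_inj (bth n)); rewrite e linear0.
Qed.
End FilteredComplex.

(** * First quadrant double complexes *)

Section DoubleProduct.
Variables (k : pzRingType) (K : nat -> nat -> lmodType k).

(** All bidegrees at once: a total degree is a support condition on one fixed type, so no casts
    along equalities of degrees occur. *)
Definition biprod : Type := forall s t, K s t.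

HB.instance Definition _ := gen_eqMixin biprod.
HB.instance Definition _ := gen_choiceMixin biprod.

Lemma biprodP (x y : biprod) : (forall s t, x s t = y s t) -> x = y.
Proof.
by move=> e; do 2![apply: functional_extensionality_dep => ?].
Qed.

Definition biadd (x y : biprod) : biprod := fun s t => x s t + y s t.
Definition biopp (x : biprod) : biprod := fun s t => - x s t.
Definition bizero : biprod := fun s t => 0.
Definition biscale a (x : biprod) : biprod := fun s t => a *: x s t.

Fact biaddA : associative biadd.
Proof. by move=> x y z; apply: biprodP => s t; apply: addrA. Qed.
Fact biaddC : commutative biadd.
Proof. by move=> x y; apply: biprodP => s t; apply: addrC. Qed.
Fact biadd0 : left_id bizero biadd.
Proof. by move=> x; apply: biprodP => s t; apply: add0r. Qed.
Fact biaddN : left_inverse bizero biopp biadd.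
Proof. by move=> x; apply: biprodP => s t; apply: addNr. Qed.
HB.instance Definition _ := GRing.isZmodule.Build biprod biaddA biaddC biadd0 biaddN.

Fact biscaleA a b x : biscale a (biscale b x) = biscale (a * b) x.
Proof. by apply: biprodP => s t; apply: scalerA. Qed.
Fact biscale1 : left_id 1 biscale.
Proof. by move=> x; apply: biprodP => s t; apply: scale1r. Qed.
Fact biscaleDr : right_distributive biscale +%R.
Proof. by move=> a x y; apply: biprodP => s t; apply: scalerDr. Qed.
Fact biscaleDl x : {morph biscale^~ x : a b / a + b}.
Proof. by move=> a b; apply: biprodP => s t; apply: scalerDl. Qed.
HB.instance Definition _ := GRing.Zmodule_isLmodule.Build k biprod
  biscaleA biscale1 biscaleDr biscaleDl.

Lemma biprodE a (x y : biprod) s t : (a *: x + y) s t = a *: x s t + y s t.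
Proof. by []. Qed.

Lemma biprodB (x y : biprod) s t : (x - y) s t = x s t - y s t.
Proof. by []. Qed.

Lemma biprod_single s0 t0 (u : K s0 t0) : exists x : biprod,
  x s0 t0 = u /\ forall s t, (s != s0) || (t != t0) -> x s t = 0.
Proof.
exists (@dfwith nat (fun s => forall t, K s t) (fun s t => 0) s0
  (@dfwith nat (K s0) (fun t => 0) t0 u)).
split=> [|s t]; first by rewrite dfwith_in dfwith_in.
have [->|s_neq _] := eqVneq s s0; last by rewrite dfwith_out // eq_sym.
by rewrite dfwith_in => /= t_neq; rewrite dfwith_out // eq_sym.
Qed.

End DoubleProduct.

(** The entries proper are the subspaces [bi_sub]. The ambient spaces contain all functions, where
    $d^2 = 0$ may fail because a function need not send 0 to 0. *)
Record bicomplex (k : pzRingType) := Bicomplex {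
  bi_mod :> nat -> nat -> lmodType k;
  bi_sub : forall s t, submod (bi_mod s t);
  bi_d1 : forall s t, {linear bi_mod s t -> bi_mod s.+1 t};
  bi_d2 : forall s t, {linear bi_mod s t -> bi_mod s t.+1};
  bi_d1_sub : forall s t x, bi_sub s t x -> bi_sub s.+1 t (bi_d1 s t x);
  bi_d2_sub : forall s t x, bi_sub s t x -> bi_sub s t.+1 (bi_d2 s t x);
  bi_d11 : forall s t x, bi_sub s t x -> bi_d1 s.+1 t (bi_d1 s t x) = 0;
  bi_d22 : forall s t x, bi_sub s t x -> bi_d2 s t.+1 (bi_d2 s t x) = 0;
  bi_d12 : forall s t x, bi_sub s t x ->
    bi_d1 s t.+1 (bi_d2 s t x) + bi_d2 s.+1 t (bi_d1 s t x) = 0 }.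

Arguments bi_sub {k} b {s t}.
Arguments bi_d1 {k} b {s t}.
Arguments bi_d2 {k} b {s t}.

Section Bicomplex.
Variables (k : pzRingType) (X : bicomplex k).
Local Notation d1 := (bi_d1 X).
Local Notation d2 := (bi_d2 X).
Implicit Type x y : biprod X.

Definition tot_fun (x : biprod X) : biprod X := fun s t =>
  match s return X s t with 0%N => 0 | s'.+1 => d1 (x s' t) end +
  match t return X s t with 0%N => 0 | t'.+1 => d2 (x s t') end.

Fact tot_fun_linear : linear tot_fun.
Proof.
move=> a x y; apply: biprodP => s t; rewrite biprodE /tot_fun.
case: s t => [|s] [|t]; rewrite ?biprodE ?linearP ?addr0 ?add0r ?scaler0 ?addr0 //.
by rewrite scalerDr addrACA.
Qed.

Definition tot : {linear biprod X -> biprod X} := lin_pack tot_fun_linear.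

Lemma tot00 x : tot x 0%N 0%N = 0. Proof. exact: addr0. Qed.
Lemma tot0S x t : tot x 0%N t.+1 = d2 (x 0%N t). Proof. exact: add0r. Qed.
Lemma totS0 x s : tot x s.+1 0%N = d1 (x s 0%N). Proof. exact: addr0. Qed.
Lemma totSS x s t : tot x s.+1 t.+1 = d1 (x s t.+1) + d2 (x s.+1 t).
Proof. by []. Qed.
Definition totE := (tot00, tot0S, totS0, totSS).

Definition tdeg_set n x :=
  (forall s t, bi_sub X (x s t)) /\ forall s t, (s + t).+1 != n -> x s t = 0.

Fact tdeg0 n : tdeg_set n 0.
Proof. by split=> // s t; apply: submod0. Qed.

Fact tdegP n a x y : tdeg_set n x -> tdeg_set n y -> tdeg_set n (a *: x + y).
Proof.
move=> [Gx x0] [Gy y0]; split=> [s t|s t st]; first exact: submodP.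
change (a *: x s t + y s t = 0).
by rewrite x0 // y0 // scaler0 addr0.
Qed.

(* Degree [n.-1], so that [tdeg 0] is zero. *)
Definition tdeg n : submod (biprod X) := Submod (tdeg0 n) (@tdegP n).

Lemma tdeg0_eq x : tdeg 0 x -> x = 0.
Proof. by move=> [_ x0]; apply: biprodP => s t; rewrite x0. Qed.

Lemma tot_tdeg n x : tdeg n x -> tdeg n.+1 (tot x).
Proof.
move=> [Gx x0]; split=> [[|s] [|t]|[|s] [|t] st]; rewrite totE.
- exact: submod0.
- exact: bi_d2_sub.
- exact: bi_d1_sub.
- by apply: submod_add; [apply: bi_d1_sub|apply: bi_d2_sub].
- by [].
- by rewrite x0 ?linear0.
- by rewrite x0 ?linear0 // -eqSS.
move: st; rewrite eqSS => st; rewrite x0 // linear0 add0r x0 ?linear0 //.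
by rewrite -addnS.
Qed.

Lemma tot_tot n x : tdeg n x -> tot (tot x) = 0.
Proof.
move=> [Gx x0]; apply: biprodP => -[|[|s]] [|[|t]]; rewrite ?totE ?linear0 //=.
- by rewrite bi_d22.
- by rewrite bi_d12.
- by rewrite linearD bi_d22 // addr0 bi_d12.
- by rewrite bi_d11.
- by rewrite linearD bi_d11 // add0r bi_d12.
by rewrite !linearD bi_d11 // bi_d22 // add0r addr0 bi_d12.
Qed.

Definition tfilt_set p x := forall s t, (s < p)%N -> x s t = 0.

Fact tfilt0 p : tfilt_set p 0. Proof. by []. Qed.

Fact tfiltP p a x y : tfilt_set p x -> tfilt_set p y -> tfilt_set p (a *: x + y).
Proof.
move=> x0 y0 s t sp; change (a *: x s t + y s t = 0).
by rewrite x0 // y0 // scaler0 addr0.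
Qed.

Definition tfilt p : submod (biprod X) := Submod (@tfilt0 p) (@tfiltP p).

Lemma tfiltS p x : tfilt p.+1 x -> tfilt p x.
Proof. by move=> x0 s t sp; apply: x0; apply: ltnW. Qed.

Lemma tfilt_deg n x : tdeg n.+1 x -> tfilt n.+1 x -> x = 0.
Proof.
move=> [_ x0] Fx; apply: biprodP => s t; have [/Fx->//|ns] := ltnP s n.+1.
by apply: x0; rewrite eqSS gtn_eqF // (leq_trans ns) ?leq_addr.
Qed.

(** Exactness away from the column $s = 0$, whose kernel is described by an [edge]. *)
Definition exact1 := forall s t (x : X s.+1 t), bi_sub X x -> d1 x = 0 ->
  exists2 y : X s t, bi_sub X y & d1 y = x.

(** Staircase argument: the component of [x] with largest $s$ is a [d1]-cycle, hence some [d1 y],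
    and [x - tot y] reaches less far. Only the part of [tot x] with positive $s$ is assumed zero,
    which is the generality that [edge_ker] uses. *)
Lemma tot_reduce n x : exact1 -> tdeg n.+1 x -> (forall s t, tot x s.+1 t = 0) ->
  exists2 y, tdeg n y & forall s t, (x - tot y) s.+1 t = 0.
Proof.
move=> ex Cx Dx.
(* By degree the components with $s > n$ vanish, which starts the induction. *)
suff H m : (forall s t, (m < s)%N -> x s t = 0) -> exists2 y, tdeg n y &
    forall s t, (x - tot y) s.+1 t = 0.
  by apply: (H n) => s t sn; apply: (Cx.2); rewrite eqSS gtn_eqF // ltn_addr.
elim: m x Cx Dx => [|m IHm] x Cx Dx x0.
  exists 0; first exact: submod0.
  by move=> s t; rewrite linear0 subr0 x0.
(* The correction is supported on the single cell of column $m$ with $s + t + 1 = n$; stating it for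
   all cells lets one choice define an element of the product. *)
have H s t : exists z : X s t,
    [/\ bi_sub X z, s = m -> (s + t).+1 = n -> d1 z = x s.+1 t &
      (s != m) || ((s + t).+1 != n) -> z = 0].
  have [sm|sm] := eqVneq s m; last first.
    by exists 0; split=> // [|/eqP]; [apply: submod0 | rewrite (negPf sm)].
  have [stn|stn] /= := eqVneq (s + t).+1 n; last first.
    by exists 0; split=> // [|_ /eqP]; [apply: submod0 | rewrite (negPf stn)].
  have [||z Gz dz] := ex s t (x s.+1 t); first exact: (Cx.1).
    have := Dx s.+1 t; rewrite {}sm.
    by case: t {stn} => [|t]; rewrite totE // [x m.+2 t]x0 // linear0 addr0.
  by exists z; split.
pose y : biprod X := fun s t => projT1 (cid (H s t)).
have yP s t : [/\ bi_sub X (y s t), s = m -> (s + t).+1 = n -> d1 (y s t) = x s.+1 t &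
      (s != m) || ((s + t).+1 != n) -> y s t = 0].
  by rewrite /y; case: cid.
have Cy : tdeg n y.
  split=> s t; first by case: (yP s t).
  by move=> st; case: (yP s t) => _ _ ->//; rewrite st orbT.
have [|||z Cz xz] := IHm (x - tot y).
- by apply: submod_sub => //; apply: tot_tdeg.
- by move=> s t; rewrite linearB (tot_tot Cy) subr0.
- move=> s t ms; rewrite biprodB; case: s ms => // s; rewrite ltnS leq_eqVlt.
  have y0 s' t' : (m < s')%N -> y s' t' = 0.
    by move=> ms; case: (yP s' t') => _ _ -> //; rewrite gtn_eqF.
  case/orP=> [/eqP e|ms].
    have -> : tot y s.+1 t = d1 (y s t).
      by case: t => [|t]; rewrite totE // [y s.+1 t]y0 ?linear0 ?addr0 // e.
    have [_ yE y0'] := yP s t; have [stn|stn] := eqVneq (s + t).+1 n.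
      by rewrite yE // subrr.
    by rewrite y0' ?stn ?orbT // linear0 subr0 (Cx.2) // eqSS addSn.
  rewrite x0 // sub0r; apply/eqP; rewrite oppr_eq0; apply/eqP.
  by case: t => [|t]; rewrite totE !y0 ?linear0 ?addr0 // ltnW.
exists (y + z) => [|s t]; first exact: submod_add.
by rewrite (linearD tot) opprD addrA.
Qed.

(* A complex [edge_mod] augmenting the [d1]-direction: [edge_inj] identifies it
   with the kernel of [d1] on the column [s = 0]. *)
Record edge := Edge {
  edge_mod :> nat -> lmodType k;
  edge_sub : forall t, submod (edge_mod t);
  edge_d : forall t, {linear edge_mod t -> edge_mod t.+1};
  edge_inj : forall t, {linear edge_mod t -> X 0%N t};
  edge_d_sub : forall t b, edge_sub t b -> edge_sub t.+1 (edge_d t b);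
  edge_inj_sub : forall t b, edge_sub t b -> bi_sub X (edge_inj t b);
  edge_inj_d1 : forall t b, edge_sub t b -> d1 (edge_inj t b) = 0;
  edge_inj_ker : forall t (x : X 0%N t), bi_sub X x -> d1 x = 0 ->
    exists2 b, edge_sub t b & edge_inj t b = x;
  edge_inj0 : forall t b, edge_sub t b -> edge_inj t b = 0 -> b = 0;
  edge_inj_d2 : forall t b, edge_sub t b ->
    d2 (edge_inj t b) = edge_inj t.+1 (edge_d t b) }.

Arguments edge_sub e {t}.

Variable B : edge.

Definition ecoc n (b : B n) := edge_sub B b /\ edge_d B n b = 0.

Definition ecob n : B n -> Prop :=
  match n with
  | 0 => fun b => b = 0
  | n'.+1 => fun b => exists2 b', edge_sub B b' & b = edge_d B n' b'
  end.

(** [x] is cohomologous, in the total complex, to [edge_inj b] placed in the column $s = 0$. *)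
Definition erel n (b : B n) x := exists y,
  [/\ tdeg n y, forall s t, (x - tot y) s.+1 t = 0 &
      (x - tot y) 0%N n = edge_inj B n b].

Lemma erel_linear n a (b b' : B n) x x' :
  erel b x -> erel b' x' -> erel (a *: b + b') (a *: x + x').
Proof.
move=> [y [Cy y1 y2]] [y' [Cy' y1' y2']]; exists (a *: y + y').
have e : a *: x + x' - tot (a *: y + y') = a *: (x - tot y) + (x' - tot y').
  by rewrite linearP opprD addrACA -scalerBr.
rewrite e; split; [exact: submodP | move=> s t|].
  change (a *: (x - tot y) s.+1 t + (x' - tot y') s.+1 t = 0).
  by rewrite y1 y1' scaler0 addr0.
change (a *: (x - tot y) 0%N n + (x' - tot y') 0%N n = edge_inj B n (a *: b + b')).
by rewrite y2 y2' linearP.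
Qed.

Lemma edge_single n (b : B n) : edge_sub B b -> exists x,
  [/\ tdeg n.+1 x, x 0%N n = edge_inj B n b,
      forall s t, (s != 0%N) || (t != n) -> x s t = 0,
      forall s t, tot x s.+1 t = 0 & tot x 0%N n.+1 = edge_inj B n.+1 (edge_d B n b)].
Proof.
move=> Gb; have [x [xE x0]] := biprod_single (edge_inj B n b).
exists x; split=> //.
- split=> [s t|s t st].
    case: (eqVneq s 0%N) => [->|s0]; last by rewrite x0 ?s0 //; apply: submod0.
    case: (eqVneq t n) => [->|tn]; last by rewrite x0 ?tn ?orbT //; apply: submod0.
    by rewrite xE; apply: edge_inj_sub.
  by apply: x0; case: s st => //=; rewrite eqSS add0n.
- move=> s t; have -> : tot x s.+1 t = d1 (x s t).
    by case: t => [|t]; rewrite totE // [x s.+1 t]x0 // linear0 addr0.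
  case: (eqVneq s 0%N) => [->|s0]; last by rewrite x0 ?s0 // linear0.
  case: (eqVneq t n) => [->|tn]; last by rewrite x0 ?tn ?orbT // linear0.
  by rewrite xE edge_inj_d1.
by rewrite totE xE edge_inj_d2.
Qed.

Lemma row_eq0 n x : tdeg n.+1 x -> (forall s t, x s.+1 t = 0) -> x 0%N n = 0 -> x = 0.
Proof.
move=> Cx xS x0; apply: biprodP => -[|s] t //; have [->//|tn] := eqVneq t n.
by apply: (Cx.2); rewrite eqSS.
Qed.

Lemma row_tot_d1 x t : (forall s t, x s.+1 t = 0) -> (forall s t, tot x s.+1 t = 0) ->
  d1 (x 0%N t) = 0.
Proof.
move=> xS Dx; have := Dx 0%N t.
by case: t => [|t]; rewrite totE // xS linear0 addr0.
Qed.

Lemma edge_tot n (b : B n) : ecoc b ->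
  exists2 x, tdeg n.+1 x /\ tot x = 0 & erel b x.
Proof.
move=> [Gb db]; have [x [Cx xE x0 x1 x2]] := edge_single Gb; exists x.
  split=> //; apply: (row_eq0 (tot_tdeg Cx)) => //.
  by rewrite x2 db linear0.
exists 0; rewrite linear0 subr0; split=> //; first exact: submod0.
by move=> s t; rewrite x0.
Qed.

Hypothesis ex : exact1.

Lemma edge_surj n x : tdeg n.+1 x -> tot x = 0 -> exists2 b : B n, ecoc b & erel b x.
Proof.
move=> Cx Dx; have [|y Cy yS] := tot_reduce ex Cx; first by rewrite Dx.
have Cxy : tdeg n.+1 (x - tot y) by apply: submod_sub => //; apply: tot_tdeg.
have Dxy : tot (x - tot y) = 0 by rewrite linearB Dx (tot_tot Cy) subr0.
have [||b Gb bE] := @edge_inj_ker B n ((x - tot y) 0%N n).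
- exact: (Cxy.1).
- by apply: row_tot_d1 => // s t; rewrite Dxy.
exists b; last by exists y.
split=> //; apply: edge_inj0; first exact: edge_d_sub.
by rewrite -edge_inj_d2 // bE -tot0S Dxy.
Qed.

(** If [x = tot y], then [y - y0] has total differential [edge_inj b] in column 0. Reducing it to
    that column by [tot_reduce] leaves a [d1]-cycle, that is, an edge element with differential
    [b]. *)
Lemma edge_ker n (b : B n) x : ecoc b -> tdeg n.+1 x -> erel b x ->
  ecob b <-> exists2 y, tdeg n y & x = tot y.
Proof.
move=> [Gb db] Cx [y0 [Cy0 xS xE]].
have Cx' : tdeg n.+1 (x - tot y0) by apply: submod_sub => //; apply: tot_tdeg.
split=> [|[y Cy xy]].
  case: n b Gb db Cx Cy0 xE Cx' => [|n] b Gb db Cx Cy0 xE Cx' bE.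
    have {}bE : b = 0 := bE; exists y0 => //; apply/eqP; rewrite -subr_eq0; apply/eqP.
    by apply: (row_eq0 Cx') => //; rewrite xE bE linear0.
  case: bE => b' Gb' bE; have [z [Cz zE z0 z1 z2]] := edge_single Gb'.
  exists (z + y0); first exact: submod_add.
  rewrite linearD; apply/eqP; rewrite -subr_eq -subr_eq0; apply/eqP.
  apply: (row_eq0 (n := n.+1)).
  - by apply: submod_sub => //; apply: tot_tdeg.
  - by move=> s t; rewrite biprodB xS z1 subrr.
  by rewrite biprodB xE z2 bE subrr.
have xw : x - tot y0 = tot (y - y0) by rewrite xy linearB.
have Cw : tdeg n (y - y0) by apply: submod_sub.
case: n b Gb db Cx Cy0 xE Cx' Cy Cw => [|n] b Gb db Cx Cy0 xE Cx' Cy Cw.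
  apply: edge_inj0 => //; rewrite -xE xw.
  by rewrite (tdeg0_eq Cw) linear0.
have [|v Cv vS] := tot_reduce ex Cw; first by move=> s t; rewrite -xw.
have Dw : tot (y - y0 - tot v) = x - tot y0.
  by rewrite linearB (tot_tot Cv) subr0 xw.
have Cw' : tdeg n.+1 (y - y0 - tot v) by apply: submod_sub => //; apply: tot_tdeg.
have [||b' Gb' bE] := @edge_inj_ker B n ((y - y0 - tot v) 0%N n).
- exact: (Cw'.1).
- by apply: row_tot_d1 => // s t; rewrite Dw.
exists b' => //; apply/eqP; rewrite -subr_eq0; apply/eqP; apply: edge_inj0.
  by apply: submod_sub => //; apply: edge_d_sub.
by rewrite linearB -edge_inj_d2 // bE -xE -tot0S Dw subrr.
Qed.

End Bicomplex.

(** * Comparison of the two edges of a double complex *)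

Section Transpose.
Variables (k : pzRingType) (X : bicomplex k).

Lemma bi_d21 s t x : bi_sub X x ->
  bi_d2 X (bi_d1 X x) + bi_d1 X (bi_d2 X x) = 0 :> X s.+1 t.+1.
Proof. by move=> Gx; rewrite addrC bi_d12. Qed.

Definition btr : bicomplex k := @Bicomplex k (fun s t => X t s)
  (fun s t => @bi_sub k X t s) (fun s t => @bi_d2 k X t s)
  (fun s t => @bi_d1 k X t s)
  (fun s t => @bi_d2_sub k X t s) (fun s t => @bi_d1_sub k X t s)
  (fun s t => @bi_d22 k X t s) (fun s t => @bi_d11 k X t s)
  (fun s t => @bi_d21 t s).

Definition tr (x : biprod X) : biprod btr := fun s t => x t s.
Definition trV (x : biprod btr) : biprod X := fun s t => x t s.

Lemma tot_tr x : tot btr (tr x) = tr (tot X x).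
Proof. by apply: biprodP => s t; apply: addrC. Qed.

Lemma tdeg_tr n x : tdeg btr n (tr x) <-> tdeg X n x.
Proof.
by split=> -[G0 x0]; split=> [s t|s t st]; [exact: (G0 t s)|apply: (x0 t s); rewrite addnC
  |exact: (G0 t s)|apply: (x0 t s); rewrite addnC].
Qed.

Variables (B1 : edge X) (B2 : edge btr).
Hypotheses (ex1 : exact1 X) (ex2 : exact1 btr).

(** The relation behind the balancing of derived functors: one total cocycle represents both
    classes. *)
Definition balance n (b2 : B2 n) (b1 : B1 n) := exists x,
  [/\ tdeg X n.+1 x, tot X x = 0, erel b2 (tr x) & erel b1 x].

Lemma balance_linear n a (b2 b2' : B2 n) (b1 b1' : B1 n) :
  balance b2 b1 -> balance b2' b1' ->
  balance (a *: b2 + b2') (a *: b1 + b1').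
Proof.
move=> [x [Cx Dx e2 e1]] [x' [Cx' Dx' e2' e1']]; exists (a *: x + x'); split.
- exact: submodP.
- by rewrite linearP Dx Dx' scaler0 addr0.
- exact: (erel_linear (X := btr)).
exact: erel_linear.
Qed.

Lemma balance_left n (b2 : B2 n) : ecoc b2 -> exists2 b1 : B1 n, ecoc b1 & balance b2 b1.
Proof.
move=> c; have [x' [Cx Dx] r] := edge_tot c; pose x := trV x'.
have {}Cx : tdeg X n.+1 x by apply/tdeg_tr.
have {}Dx : tr (tot X x) = 0 by rewrite -tot_tr.
have {}Dx : tot X x = 0 := congr1 trV Dx.
have [b1 c1 r1] := edge_surj B1 ex1 Cx Dx.
by exists b1 => //; exists x.
Qed.

Lemma balance_right n (b1 : B1 n) : ecoc b1 -> exists2 b2 : B2 n, ecoc b2 & balance b2 b1.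
Proof.
move=> c; have [x [Cx Dx] r] := edge_tot c.
have Cx' : tdeg btr n.+1 (tr x) by apply/tdeg_tr.
have Dx' : tot btr (tr x) = 0 by rewrite tot_tr Dx.
have [b2 c2 r2] := edge_surj B2 ex2 Cx' Dx'.
by exists b2 => //; exists x.
Qed.

Lemma balance_ker n (b2 : B2 n) (b1 : B1 n) : ecoc b2 -> ecoc b1 -> balance b2 b1 ->
  (ecob b2 <-> ecob b1).
Proof.
move=> c2 c1 [x [Cx Dx r2 r1]].
have Cx' : tdeg btr n.+1 (tr x) by apply/tdeg_tr.
rewrite (edge_ker ex1 c1 Cx r1) (edge_ker ex2 c2 Cx' r2).
split=> -[y Cy e].
  exists (trV y); first exact/tdeg_tr.
  have e' : tr x = tr (tot X (trV y)) by rewrite e -tot_tr.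
  exact: (congr1 trV e').
exists (tr y); first exact/tdeg_tr.
by rewrite tot_tr -e.
Qed.

(** The edge [B1] embeds in [X 0 n], so it is zero in degree $n$, and balancing carries this to
    [B2]. The vanishing of Hochschild cohomology and of Ext over [H] both rest on it, with a
    resolution of length less than $n$ along the second index. *)
Lemma edge_vanish n (b2 : B2 n) :
  (forall x : X 0%N n, bi_sub X x -> x = 0) -> ecoc b2 -> ecob b2.
Proof.
move=> X0 c2; have [b1 c1 r] := balance_left c2.
apply/(balance_ker c2 c1 r); have -> : b1 = 0; last first.
  by case: n b2 X0 c2 b1 c1 r => [|n] //= *; exists 0; rewrite ?linear0 //; apply: submod0.
by apply: edge_inj0; [case: c1 | apply/X0/edge_inj_sub; case: c1].
Qed.

End Transpose.

Lemma scalars_linear (k : pzRingType) (R : algType k) (U V : lmodType R)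
  (f : U -> V) : linear f -> linear (f : scalars U -> scalars V).
Proof. by move=> lf a x y; apply: (lf a%:A). Qed.

(** [g] is corestricted to its image, so that the definition of projectivity applies to a map that
    need not be surjective. *)
Lemma projective_lift (R : pzRingType) (P U V : lmodType R) (g : {linear U -> V})
    (f : P -> V) : projective P -> linear f -> (forall x, exists u, g u = f x) ->
  exists2 h : P -> U, linear h & forall x, g (h x) = f x.
Proof.
move=> pP lf fY; pose Y := Defs.image g.
have gY x : Y (g x) by exists x.
have lg' : linear (fun x => subel (gY x)).
  by move=> a x y; apply: val_inj; apply: linearP.
pose sf x := @subel _ _ Y (f x) (fY x).
have lf' : linear sf.
  by move=> a x y; apply: val_inj; apply: lf.
have [|h hE] := pP _ _ (lin_pack lg') (lin_pack lf').
  case=> v /= vP; have /asboolP[u uv] := vP; exists u.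
  by apply: val_inj.
exists h; first exact: linearP.
by move=> x; apply: (congr1 val (hE x)).
Qed.

(** * Maps from a projective resolution into a complex of modules *)

Section HomBicomplex.
Variables (k : fieldType) (R : algType k) (T : lmodType R).
Variables (P : projResolution T) (X : nat -> lmodType R).
Variable dX : forall s, {linear X s -> X s.+1}.
Hypothesis dXX : forall s x, dX s.+1 (dX s x) = 0.

Definition hom_mod r s : lmodType k := P r -> scalars (X s).

Fact hom_sub0 r s : linear ((0 : hom_mod r s) : P r -> X s).
Proof. exact: linear_zero_fct. Qed.

Fact hom_subP r s a (x y : hom_mod r s) :
  linear (x : P r -> X s) -> linear (y : P r -> X s) ->
  linear (a *: x + y : P r -> X s).
Proof. exact: ext_linear_subproof. Qed.

Definition hom_sub r s : submod (hom_mod r s) :=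
  @Submod k (hom_mod r s) (fun x => linear (x : P r -> X s))
    (@hom_sub0 r s) (@hom_subP r s).

Definition hom_pre r s (x : hom_mod r s) : hom_mod r.+1 s :=
  fun u => x (pres_d P r u).

Definition hom_post r s (x : hom_mod r s) : hom_mod r s.+1 :=
  fun u => dX s (x u).

Fact hom_pre_linear r s : linear (@hom_pre r s).
Proof. by []. Qed.

Fact hom_post_linear r s : linear (@hom_post r s).
Proof.
move=> a x y; apply/funext => u.
exact: (scalars_linear (linearP (dX s))).
Qed.

Definition hom_d2 r s (x : hom_mod r s) : hom_mod r s.+1 :=
  ((-1) ^+ r : k) *: hom_post x.

Fact hom_d2_linear r s : linear (@hom_d2 r s).
Proof.
move=> a x y; rewrite /hom_d2 hom_post_linear scalerDr; congr (_ + _).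
exact: scale_comm.
Qed.

Fact hom_d1_sub r s (x : hom_mod r s) : hom_sub r s x -> hom_sub r.+1 s (hom_pre x).
Proof. by move=> lx a u v; rewrite /hom_pre linearP lx. Qed.

Fact hom_d2_sub r s (x : hom_mod r s) : hom_sub r s x -> hom_sub r s.+1 (hom_d2 x).
Proof.
by move=> lx; apply: submod_scale => a u v; rewrite /hom_post lx linearP.
Qed.

Lemma pres_dd n x : pres_d P n (pres_d P n.+1 x) = 0.
Proof. by apply/pres_exact; exists x. Qed.

Fact hom_d11 r s (x : hom_mod r s) : hom_sub r s x -> hom_pre (hom_pre x) = 0.
Proof. by move=> lx; apply/funext => u; rewrite /hom_pre pres_dd (lin0 lx). Qed.

Fact hom_d22 r s (x : hom_mod r s) : hom_sub r s x -> hom_d2 (hom_d2 x) = 0.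
Proof.
move=> lx; rewrite /hom_d2 (linZ (@hom_post_linear r s.+1)).
have -> : hom_post (hom_post x) = 0 by apply/funext => u; apply: dXX.
by rewrite !scaler0.
Qed.

Fact hom_d12 r s (x : hom_mod r s) : hom_sub r s x ->
  hom_pre (hom_d2 x) + hom_d2 (hom_pre x) = 0.
Proof.
move=> lx; rewrite /hom_d2 (linZ (@hom_pre_linear r s.+1)).
by rewrite exprS mulN1r scaleNr subrr.
Qed.

Definition hom_bicomplex : bicomplex k := @Bicomplex k hom_mod hom_sub
  (fun r s => lin_pack (@hom_pre_linear r s))
  (fun r s => lin_pack (@hom_d2_linear r s))
  hom_d1_sub hom_d2_sub hom_d11 hom_d22 hom_d12.

Local Notation K := hom_bicomplex.

(** An [R]-submodule, so that the cohomology is an [R]-module; in degree 0 it is zero, being the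
    kernel of the identity. *)
Definition cobd s : submod (X s) :=
  match s with
  | 0%N => kernel (idfun : {linear X 0%N -> X 0%N})
  | s'.+1 => Defs.image (dX s')
  end.

Definition cohom s : lmodType R := subquot (kernel (dX s)) (cobd s).

Lemma hom_d2_cobd r s (x : K r s) u : cobd s.+1 (bi_d2 K x u).
Proof. by apply: submod_scale; exists (x u). Qed.

(** Modulo coboundaries of [X] only precomposition with the differential of [P] survives, and this
    is the differential of Hom_R(P, H^s(X)). *)
Lemma tot_cobd (x : biprod K) r s u :
  cobd s ((tot K x r.+1 s : hom_mod _ _) u - (x r s : hom_mod _ _) (pres_d P r u)).
Proof.
have e (a b : X s) : a + b - a = b by rewrite addrAC subrr add0r.
case: s e => [|s] e; rewrite totE.
  by rewrite (_ : _ - _ = 0) ?subrr //; apply: submod0.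
rewrite (_ : _ - _ = bi_d2 K (x r.+1 s) u); first exact: hom_d2_cobd.
exact: e.
Qed.

Lemma tot_cobd0 (x : biprod K) s u : cobd s ((tot K x 0%N s : hom_mod _ _) u).
Proof. by case: s => [|s]; rewrite totE; [apply: submod0 | apply: hom_d2_cobd]. Qed.

Lemma single_deg s0 t0 (u : K s0 t0) : bi_sub K u -> exists x : biprod K,
  [/\ tdeg K (s0 + t0).+1 x, tfilt K s0 x, x s0 t0 = u &
     forall s t, (s != s0) || (t != t0) -> x s t = 0].
Proof.
move=> Gu; have [x [xE x0]] := biprod_single u; exists x; split=> //.
  split=> [s t|s t].
    have [->|ss] := eqVneq s s0; last by rewrite x0 ?ss //; apply: submod0.
    have [->|tt] := eqVneq t t0; first by rewrite xE.
    by rewrite x0 ?tt ?orbT //; apply: submod0.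
  rewrite eqSS => st; apply: x0; apply: contraR st.
  by rewrite negb_or !negbK => /andP[/eqP-> /eqP->].
by move=> s t ss; apply: x0; rewrite ltn_eqF.
Qed.

Lemma tfilt_tot p x : tfilt K p x -> tfilt K p (tot K x).
Proof.
move=> Fx [|s] [|t] sp; rewrite totE //.
- by rewrite Fx // linear0.
- by rewrite Fx ?linear0 // ltnW.
by rewrite !Fx ?linear0 ?addr0 // ltnW.
Qed.

Lemma tot_row (x : biprod K) r s : tfilt K r x -> tot K x r s.+1 = bi_d2 K (x r s).
Proof.
case: r => [|r] Fx; rewrite totE // [x r _]Fx //.
by rewrite linear0 add0r.
Qed.

(** As [P r] is projective, a map into the coboundaries lifts to $X_{s-1}$. The factor $(-1)^r$
    cancels the sign in [hom_d2]. *)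
Lemma cobd_tot r s (x : K r s) : bi_sub K x -> (forall u, cobd s (x u)) ->
  exists y : biprod K, [/\ tdeg K (r + s)%N y, tfilt K r y & tot K y r s = x].
Proof.
case: s x => [|s] x lx xB.
  exists 0; split; try exact: submod0.
  by rewrite linear0; apply/funext => u; symmetry; apply: (xB u).
have [h lh hE] := projective_lift (@pres_proj _ _ P r) lx xB.
pose h' : K r s := h; have Gh : bi_sub K ((-1) ^+ r *: h') by apply: submod_scale.
have [y [Cy Fy yE y0]] := single_deg Gh.
exists y; rewrite addnS; split=> //.
rewrite tot_row // yE.
have -> : bi_d2 K ((-1) ^+ r *: h') = (-1) ^+ r *: hom_d2 h' :=
  linZ (@hom_d2_linear r s) _ _.
by rewrite scalerA -expr2 sqrr_sign scale1r; apply/funext => u; apply: hE.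
Qed.

Definition hom_ss : spectralSequence k :=
  filtered_ss (@tot_tdeg k K) (@tot_tot k K) (@tfiltS k K) (@tfilt_deg k K).

(** By degree and filtration, the part of [tot x] below filtration $p + 2$ can be non-zero only at
    $(p, q+1)$ and $(p+1, q)$. *)
Lemma pageZ2P p q (x : biprod K) : tdeg K (p + q).+1 x -> tfilt K p x ->
  tot K x p q.+1 = 0 -> tot K x p.+1 q = 0 ->
  pageZ (tot K) (tdeg K) (tfilt K) 2 p q x.
Proof.
move=> Cx Fx x1 x2; split=> // s t; rewrite addn2 ltnS leq_eqVlt.
have [_ D0] := tot_tdeg Cx.
case/orP=> [/eqP->|].
  have [->//|tq] := eqVneq t q; apply: D0.
  by rewrite addSn !eqSS eqn_add2l.
rewrite ltnS leq_eqVlt => /orP[/eqP->|sp]; last exact: (tfilt_tot Fx).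
have [->//|tq] := eqVneq t q.+1; apply: D0.
by rewrite eqSS -addnS eqn_add2l.
Qed.

Lemma hom_d2_eq0 r s (x : hom_mod r s) u : hom_d2 x = 0 -> dX s (x u) = 0.
Proof.
move/(congr1 (fun y => (-1) ^+ r *: y)); rewrite /hom_d2 scalerA -expr2.
by rewrite sqrr_sign scale1r scaler0 => e; apply: (congr1 (fun y => y u) e).
Qed.

Lemma pageZ2_d p q (x : biprod K) : pageZ (tot K) (tdeg K) (tfilt K) 2 p q x ->
  (forall u, dX q ((x p q : hom_mod _ _) u) = 0) /\
  (forall u, cobd q ((x p q : hom_mod _ _) (pres_d P p u))).
Proof.
move=> [Cx Fx Dx]; rewrite addn2 in Dx; split=> u.
  apply: hom_d2_eq0; change (bi_d2 K (x p q) = 0).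
  by rewrite -tot_row // Dx.
have := tot_cobd x q u; rewrite Dx // sub0r => /submod_opp.
by rewrite opprK.
Qed.

(** The counterpart of [pageZ2P] for denominators: [p.-1] is the filtration step that page 2 allows
    for [y], and for $p = 0$ there is no earlier cell to control. *)
Lemma pageB2P p q (x y : biprod K) : tdeg K (p + q).+1 x -> tfilt K p x ->
  tdeg K (p + q)%N y -> tfilt K p.-1 y -> tot K y p q = x p q ->
  (if p is p'.+1 then tot K y p' q.+1 = 0 else True) ->
  pageB (tot K) (tdeg K) (tfilt K) 2 p q x.
Proof.
move=> Cx Fx Cy Fy yx y0; exists y; split=> //; first by rewrite subSS subn1.
have CDy := tot_tdeg Cy; move=> s t; rewrite ltnS leq_eqVlt biprodB.
case/orP=> [/eqP->|sp].
  have [->|tq] := eqVneq t q; first by rewrite yx subrr.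
  by rewrite Cx.2 ?CDy.2 ?subrr // eqSS eqn_add2l.
rewrite Fx //; suff -> : tot K y s t = 0 by rewrite subrr.
case: p Cx Fx Cy Fy yx CDy y0 sp => // p Cx Fx Cy Fy yx CDy y0.
rewrite ltnS leq_eqVlt => /orP[/eqP->|sp]; last exact: (tfilt_tot Fy).
have [->//|tq] := eqVneq t q.+1.
by apply: CDy.2; rewrite eqSS addSn -addnS eqn_add2l.
Qed.

Lemma tot_col (x : biprod K) r s : (forall s' t, (t < s)%N -> x s' t = 0) ->
  tot K x r.+1 s = bi_d1 K (x r s).
Proof.
case: s => [|s] x0; rewrite totE // [x _ s]x0 //.
by rewrite linear0 addr0.
Qed.

Lemma hom_page2 p q : kiso (page hom_ss 2 p q) (Ext (cohom q) P p).
Proof.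
pose R2 (x : biprod K) (g : P p -> scalars (cohom q)) := forall u,
  exists2 z : subspace (kernel (dX q)), val z = (x p q : hom_mod _ _) u &
    subquot_class (cobd q) z = g u.
have lcls := @subquot_class_linear _ _ (kernel (dX q)) (cobd q).
(* Maps into the cohomology lift to maps into cocycles, [P r] being projective. *)
have lift r (g : P r -> scalars (cohom q)) : linear (g : P r -> cohom q) ->
    exists y : hom_mod r q, [/\ hom_sub r q y, hom_d2 y = 0 &
      forall u, exists2 z : subspace (kernel (dX q)), val z = y u &
        subquot_class (cobd q) z = g u].
  move=> lg; have [|h lh hE] := projective_lift (g := lin_pack lcls) (@pres_proj _ _ P r) lg.
    by move=> u; elim/subquot_ind: (g u) => z; exists z.
  exists (fun u => val (h u)); split.
  - by move=> a u v; rewrite lh.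
  - rewrite /hom_d2 (_ : hom_post _ = 0) ?scaler0 //.
    by apply/funext => u; apply: (subspaceP (h u)).
  by move=> u; exists (h u) => //; apply: hE.
apply: (subquot_kiso (R := R2)) => [|x Zx|g [lg dg]|x g Zx [lg dg] xg].
- move=> a x x' g g' xg xg' u; have [z zx zg] := xg u; have [z' zx' zg'] := xg' u.
  exists ((a%:A : R) *: z + z'); first by rewrite /= zx zx'.
  by rewrite lcls zg zg'.
- have [x1 x2] := pageZ2_d Zx; have Gx : hom_sub p q (x p q).
    by case: Zx => -[Gx _] _ _; apply: Gx.
  pose z u : subspace (kernel (dX q)) := @subel _ _ (kernel (dX q)) _ (x1 u).
  exists (fun u => subquot_class (cobd q) (z u)).
    split=> [a u v|u]; last by apply/subquot_class_eq0/x2.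
    by rewrite -lcls; congr subquot_class; apply: val_inj; apply: Gx.
  by move=> u; exists (z u).
- have [y [Gy dy yg]] := lift p g lg.
  have [x1 [Cx1 Fx1 x1y x10]] := single_deg (Gy : bi_sub K (y : K p q)).
  (* [hom_pre y] has values in coboundaries because [g] vanishes on the image of [pres_d], so an
     element of filtration $p + 1$ cancels it. *)
  have [||x2 [Cx2 Fx2 x2y]] := @cobd_tot p.+1 q (hom_pre y).
  + exact: hom_d1_sub.
  + move=> u; have [z zy zg] := yg (pres_d P p u); rewrite /hom_pre -zy.
    by apply/subquot_class_eq0; rewrite zg dg.
  have Fx2' : tfilt K p x2 by apply: tfiltS.
  have x2pq : x2 p q = 0 by apply: Fx2.
  exists (x1 - x2); last by move=> u; rewrite biprodB x1y x2pq subr0; apply: yg.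
  apply: pageZ2P.
  + exact: submod_sub.
  + exact: submod_sub.
  + by rewrite linearB biprodB (tfilt_tot Fx2) // subr0 tot_row // x1y.
  rewrite linearB biprodB x2y tot_col ?x1y ?subrr // => s t tq.
  by apply: x10; rewrite (ltn_eqF tq) orbT.
rewrite /R2 {R2} in xg *; have [Cx Fx Dx] := Zx; split.
  case=> y [Cy Fy xy].
  have xyp : x p q = tot K y p q by apply/eqP; rewrite -subr_eq0; apply/eqP/xy.
  case: p x g Zx lg dg xg Cx Fx Dx Cy Fy xy xyp => [|p] x g Zx lg dg xg Cx Fx Dx Cy Fy xy xyp.
    apply/funext => u; have [z zx <-] := xg u.
    by apply/subquot_class_eq0; rewrite zx xyp; apply: tot_cobd0.
  have Fy' : tfilt K p y by rewrite !subSS subn0 in Fy.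
  have y1 u : dX q ((y p q : hom_mod _ _) u) = 0.
    apply: hom_d2_eq0; change (bi_d2 K (y p q) = 0); rewrite -tot_row //.
    by have := xy p q.+1 (ltnW (ltnSn _)); rewrite biprodB Fx // sub0r => /eqP;
       rewrite oppr_eq0 => /eqP.
  pose z u : subspace (kernel (dX q)) := @subel _ _ (kernel (dX q)) _ (y1 u).
  exists (fun u => subquot_class (cobd q) (z u)).
    move=> a u v; rewrite -lcls; congr subquot_class; apply: val_inj.
    by apply: (Cy.1 p q).
  apply/funext => u; have [z' zx <-] := xg u.
  by apply/subquot_classP; rewrite zx xyp; apply: tot_cobd.
case: p x g Zx lg dg xg Cx Fx Dx => [|p] x g Zx lg dg xg Cx Fx Dx.
  move=> g0; have [||y [Cy Fy yx]] := @cobd_tot 0 q (x 0%N q).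
  - exact: (Cx.1).
  - move=> u; have [z <- zg] := xg u.
    by apply/subquot_class_eq0; rewrite zg g0.
  exact: (pageB2P (y := y)).
case=> g' lg' gg'; have [y1 [Gy1 dy1 yg1]] := lift p g' lg'.
have [Y1 [CY1 FY1 Y1y Y10]] := single_deg (Gy1 : bi_sub K (y1 : K p q)).
(* [Y1] accounts for [g' \o pres_d P p], and [y2] for the remaining map into coboundaries. *)
have [||y2 [Cy2 Fy2 y2y]] := @cobd_tot p.+1 q (x p.+1 q - hom_pre y1).
- by apply: submod_sub; [apply: (Cx.1) | apply: hom_d1_sub].
- move=> u; have [z zx zg] := xg u; have [z' zx' zg'] := yg1 (pres_d P p u).
  have -> : (x p.+1 q - hom_pre y1 : hom_mod _ _) u = val z - val z' by rewrite zx zx'.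
  by apply/subquot_classP; rewrite zg zg' gg'.
apply: (pageB2P (y := Y1 + y2)) => //.
- exact: submod_add.
- by apply: submod_add => //; apply: tfiltS.
- rewrite linearD -[RHS](subrK (hom_pre y1)) addrC -y2y; congr (_ + _).
  by rewrite tot_col ?Y1y // => s t tq; apply: Y10; rewrite (ltn_eqF tq) orbT.
rewrite linearD; change (tot K Y1 p q.+1 + tot K y2 p q.+1 = 0).
by rewrite tot_row // Y1y (tfilt_tot Fy2) // addr0.
Qed.

End HomBicomplex.

(** * Sweedler calculus *)

Section Sweedler.
Variables (k : fieldType) (H : hopfAlgebra k).
Local Notation ε := (counit H).
Local Notation S := (antipode H).

Definition swe (W : lmodType k) (h : H) (F : H -> H -> W) : W :=
  \sum_(x <- sw (comul H) h) F x.1 x.2.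

Local Notation "'\sw_' ( a , b <- h ) F" := (swe h (fun a b => F))
  (at level 41, a name, b name, F at level 41).

Definition trilin (U V T W : lmodType k) (F : U -> V -> T -> W) :=
  [/\ forall b c, linear (fun a => F a b c), forall a c, linear (fun b => F a b c)
    & forall a b, linear (F a b)].

Lemma swe_ext (W : lmodType k) h (F G : H -> H -> W) :
  (forall a b, F a b = G a b) -> swe h F = swe h G.
Proof. by move=> e; apply: eq_bigr. Qed.

Lemma swe_comp (W W' : lmodType k) (g : W -> W') h F :
  linear g -> g (swe h F) = \sw_(a, b <- h) g (F a b).
Proof. by move=> lg; apply: lin_sum. Qed.

Lemma swe_linear (U W : lmodType k) (g : U -> H) (F : H -> H -> W) :
  linear g -> bilin F -> linear (fun u => swe (g u) F).
Proof. by move=> lg bF a x y; rewrite lg; apply: (sw_linear bF). Qed.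

Lemma swe_linearF (U W : lmodType k) h (F : U -> H -> H -> W) :
  (forall a b, linear (fun u => F u a b)) -> linear (fun u => swe h (F u)).
Proof. by move=> lF; apply: Defs.linear_sum => x. Qed.

Lemma linear_id (U : lmodType k) : linear (fun x : U => x). Proof. by []. Qed.

Lemma linear_comp (U V W : lmodType k) (f : {linear V -> W}) (g : U -> V) :
  linear g -> linear (fun x => f (g x)).
Proof. by move=> lg a x y; rewrite lg linearP. Qed.

Lemma linear_mull (U : lmodType k) (B : algType k) (g : U -> B) c :
  linear g -> linear (fun x => g x * c).
Proof. by move=> lg a x y; rewrite lg mulrDl scalerAl. Qed.

Lemma linear_mulr (U : lmodType k) (B : algType k) (g : U -> B) c :
  linear g -> linear (fun x => c * g x).
Proof. by move=> lg a x y; rewrite lg mulrDr scalerAr. Qed.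

Lemma linear_scaler (U V : lmodType k) (g : U -> V) (c : k) :
  linear g -> linear (fun x => c *: g x).
Proof. by move=> lg a x y; rewrite lg scalerDr scale_comm. Qed.

Lemma linear_scalel (U V : lmodType k) (g : U -> k^o) (v : V) :
  linear g -> linear (fun x => (g x : k) *: v).
Proof. by move=> lg a x y; rewrite lg scalerDl scalerA. Qed.

Lemma linear_tensorl (U V T : lmodType k) (g : U -> V) (t : T) :
  linear g -> linear (fun x => g x ⊗ t).
Proof. by move=> lg a x y; rewrite lg tpureDl. Qed.

Lemma linear_tensorr (U V T : lmodType k) (g : U -> T) (v : V) :
  linear g -> linear (fun x => v ⊗ g x).
Proof. by move=> lg a x y; rewrite lg tpureDr. Qed.

Lemma linear_counit (U : lmodType k) (g : U -> H) :
  linear g -> linear (fun x => ε (g x)).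
Proof. by move=> lg a x y; rewrite lg linearP. Qed.

Lemma linear_comp_fun (U V W : lmodType k) (f : V -> W) (g : U -> V) :
  linear f -> linear g -> linear (fun x => f (g x)).
Proof. by move=> lf lg a x y; rewrite lg lf. Qed.

Lemma linear_bilinl (U V T W : lmodType k) (F : V -> T -> W) (g : U -> V) b :
  bilin F -> linear g -> linear (fun x => F (g x) b).
Proof. by case=> bF _; apply: (linear_comp_fun (bF b)). Qed.

Lemma linear_bilinr (U V T W : lmodType k) (F : V -> T -> W) (g : U -> T) b :
  bilin F -> linear g -> linear (fun x => F b (g x)).
Proof. by case=> _ bF; apply: (linear_comp_fun (bF b)). Qed.

Lemma linear_trilin1 (U V T Y W : lmodType k) (F : V -> T -> Y -> W) (g : U -> V) b c :
  trilin F -> linear g -> linear (fun x => F (g x) b c).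
Proof. by case=> tF _ _; apply: (linear_comp_fun (tF b c)). Qed.

Lemma linear_trilin2 (U V T Y W : lmodType k) (F : V -> T -> Y -> W) (g : U -> T) a c :
  trilin F -> linear g -> linear (fun x => F a (g x) c).
Proof. by case=> _ tF _; apply: (linear_comp_fun (tF a c)). Qed.

Lemma linear_trilin3 (U V T Y W : lmodType k) (F : V -> T -> Y -> W) (g : U -> Y) a b :
  trilin F -> linear g -> linear (fun x => F a b (g x)).
Proof. by case=> _ _ tF; apply: (linear_comp_fun (tF a b)). Qed.

Lemma counitM h l : ε (h * l) = (ε h : k) * ε l :> k.
Proof. exact: rmorphM. Qed.

Lemma counit1 : ε 1 = 1 :> k.
Proof. exact: (rmorph1 ε). Qed.

Lemma counit_scalar (a : k) : ε (a *: 1) = a :> k.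
Proof.
transitivity (a * (ε 1 : k)); last by rewrite counit1 mulr1.
exact: (linZ (linear_counit (@linear_id H)) a 1).
Qed.

Lemma tlift_swe (W : lmodType k) (F : H -> H -> W) h :
  bilin F -> tlift F (comul H h) = swe h F.
Proof. by []. Qed.

Lemma swe_mul (W : lmodType k) h l (F : H -> H -> W) : bilin F ->
  swe (h * l) F = \sw_(a, b <- h) \sw_(c, d <- l) F (a * c) (b * d).
Proof.
move=> bF; rewrite -tlift_swe // comulM.
rewrite (lin_sum (tlift_linear bF)); apply: eq_bigr => x _.
rewrite (lin_sum (tlift_linear bF)); apply: eq_bigr => y _.
by rewrite tlift_pure.
Qed.

Lemma swe_1 (W : lmodType k) (F : H -> H -> W) : bilin F -> swe 1 F = F 1 1.
Proof. by move=> bF; rewrite -tlift_swe // comul1 tlift_pure. Qed.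

(** [F] is turned into a linear map on $H \otimes (H \otimes H)$, where [comulA] can be applied. *)
Lemma swe_assoc (W : lmodType k) h (F : H -> H -> H -> W) : trilin F ->
  \sw_(a, b <- h) \sw_(c, d <- a) F c d b =
  \sw_(a, b <- h) \sw_(c, d <- b) F a c d.
Proof.
move=> [F1 F2 F3].
have bF a : bilin (F a) by split.
pose G a (t : tensor H H) := tlift (F a) t.
have bG : bilin G.
  split=> [t|a]; last exact: tlift_linear.
  by apply: Defs.linear_sum => x.
have := congr1 (tlift G) (comulA h).
rewrite !(lin_sum (tlift_linear bG)) => e; rewrite /swe.
transitivity (\sum_(x <- sw (comul H) h)
   tlift G (\sum_(y <- sw (comul H) x.1) y.1 ⊗ (y.2 ⊗ x.2))).
  apply: eq_bigr => x _; rewrite (lin_sum (tlift_linear bG)).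
  by apply: eq_bigr => y _; rewrite tlift_pure // /G tlift_pure.
rewrite {}e; apply: eq_bigr => x _.
by rewrite tlift_pure.
Qed.

Lemma swe_counitl (W : lmodType k) h (g : H -> W) : linear g ->
  \sw_(a, b <- h) (ε a : k) *: g b = g h.
Proof.
move=> lg; rewrite -[in RHS](counitl h) (lin_sum lg).
by apply: eq_bigr => x _; rewrite (linZ lg).
Qed.

Lemma swe_counitr (W : lmodType k) h (g : H -> W) : linear g ->
  \sw_(a, b <- h) (ε b : k) *: g a = g h.
Proof.
move=> lg; rewrite -[in RHS](counitr h) (lin_sum lg).
by apply: eq_bigr => x _; rewrite (linZ lg).
Qed.

Lemma swe_antipodel (W : lmodType k) h (g : H -> W) : linear g ->
  \sw_(a, b <- h) g (S a * b) = (ε h : k) *: g 1.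
Proof. by move=> lg; rewrite -(linZ lg) -antipodel (lin_sum lg). Qed.

Lemma swe_antipoder (W : lmodType k) h (g : H -> W) : linear g ->
  \sw_(a, b <- h) g (a * S b) = (ε h : k) *: g 1.
Proof. by move=> lg; rewrite -(linZ lg) -antipoder (lin_sum lg). Qed.

Lemma swe_exchange (W : lmodType k) h l (F : H -> H -> H -> H -> W) :
  \sw_(a, b <- h) \sw_(c, d <- l) F a b c d =
  \sw_(c, d <- l) \sw_(a, b <- h) F a b c d.
Proof. exact: exchange_big. Qed.

End Sweedler.

Arguments swe_ext {k H W h F G}.
Arguments swe_comp {k H W W' g}.
Arguments swe_mul {k H W} h l {F}.
Arguments swe_1 {k H W F}.
Arguments swe_assoc {k H W h F}.
Arguments swe_counitl {k H W} h {g}.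
Arguments swe_counitr {k H W} h {g}.
Arguments swe_antipodel {k H W} h {g}.
Arguments swe_antipoder {k H W} h {g}.

Notation "'\sw_' ( a , b <- h ) F" := (swe h (fun a b => F))
  (at level 41, a name, b name, F at level 41) : ring_scope.

Ltac eta_linear :=
  cbv beta;
  lazymatch goal with
  | |- linear (fun x => @?f x) => idtac
  | |- linear ?f => change (linear (fun x => f x))
  | |- _ => idtac
  end.

(** A Sweedler sum depends on the list chosen for $\Delta(h)$ unless its summand is multilinear, so
    most rewriting steps below leave a linearity goal. These are discharged by recursion on the
    summand. *)
Ltac lin :=
  eta_linear;
  lazymatch goal with
  | |- linear (fun x => x) => exact: linear_id
  | |- linear _ => first [ assumption | 
      match goal with
      | bF : bilin ?F |- linear (fun x => ?F (@?g x) ?b) => apply: (@linear_bilinl _ _ _ _ _ F g b bF); lin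
      | bF : bilin ?F |- linear (fun x => ?F ?b (@?g x)) => apply: (@linear_bilinr _ _ _ _ _ F g b bF); lin
      | tF : trilin ?F |- linear (fun x => ?F (@?g x) ?b ?c) => apply: (@linear_trilin1 _ _ _ _ _ _ F g b c tF); lin
      | tF : trilin ?F |- linear (fun x => ?F ?a (@?g x) ?c) => apply: (@linear_trilin2 _ _ _ _ _ _ F g a c tF); lin
      | tF : trilin ?F |- linear (fun x => ?F ?a ?b (@?g x)) => apply: (@linear_trilin3 _ _ _ _ _ _ F g a b tF); lin
      | lf : linear ?f |- linear (fun x => ?f (@?g x)) => apply: (@linear_comp_fun _ _ _ _ f g lf); lin
      | |- linear (fun x => swe (@?g x) ?F) => apply: (@swe_linear _ _ _ _ g F); lin
      | |- linear (fun x => swe ?h (@?F x)) => apply: (@swe_linearF _ _ _ _ h F) => ? ?; lin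
      | |- linear (fun x => @?g x * ?c) => apply: (@linear_mull _ _ _ g c); lin
      | |- linear (fun x => ?c * @?g x) => apply: (@linear_mulr _ _ _ g c); lin
      | |- linear (fun x => ?c *: @?g x) => apply: (@linear_scaler _ _ _ g c); lin
      | |- linear (fun x => @?g x *: ?v) => apply: (@linear_scalel _ _ _ g v); lin
      | |- linear (fun x => @?g x ⊗ ?v) => apply: (@linear_tensorl _ _ _ _ g v); lin
      | |- linear (fun x => ?v ⊗ @?g x) => apply: (@linear_tensorr _ _ _ _ g v); lin
      | |- linear (fun x => GRing.Linear.sort _ (@?g x)) => apply: (@linear_comp _ _ _ _ _ g); lin
      | |- _ => exact: linearP
      | |- _ => apply: linear_counit; lin
      end ]
  | |- bilin _ => split=> ?; lin
  | |- trilin _ => split=> ? ?; lin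
  end.

(** * Antipode and convolution inverses *)

Section Antipode.
Variables (k : fieldType) (H : hopfAlgebra k).
Local Notation ε := (counit H).
Local Notation S := (antipode H).

Lemma antipode1 : S 1 = 1.
Proof.
have := swe_antipodel (1 : H) (@linear_id k H); rewrite swe_1; last lin.
by rewrite mulr1 counit1 scale1r.
Qed.

Lemma counit_antipode h : ε (S h) = ε h.
Proof.
have l : linear (fun x : H => ε x : k^o) by lin.
have := swe_antipodel h l.
rewrite (swe_ext (G := fun a b => (ε b : k) *: (ε (S a) : k^o))); last first.
  by move=> a b; rewrite counitM mulrC.
rewrite swe_counitr; last lin.
by move=> ->; rewrite counit1; apply: mulr1.
Qed.

End Antipode.

Section Convolution.
Variables (k : fieldType) (H : hopfAlgebra k).
Local Notation ε := (counit H).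
Local Notation S := (antipode H).

(** Covers the antipode axioms and, with [M] built from [cinv] and $1 \# h$, the convolution inverse
    in the crossed product. *)
Lemma swe_cancell (B W : lmodType k) (M : H -> H -> B) u (F : B -> H -> W) h :
  bilin M -> bilin F -> (forall h, swe h M = (ε h : k) *: u) ->
  \sw_(a, r <- h) \sw_(b, c <- r) F (M a b) c = F u h.
Proof.
move=> bM bF MC; rewrite -(swe_assoc (F := fun a b c => F (M a b) c)); last lin.
rewrite -(swe_counitl h (g := F u)); last lin.
apply: swe_ext => a b; rewrite -(swe_comp (g := fun x => F x b)); last lin.
rewrite MC; case: bF => bF _; exact: (linZ (bF b)).
Qed.

Arguments swe_cancell {B W M u F} h.

Lemma swe_cancelr (B W : lmodType k) (M : H -> H -> B) u (F : H -> B -> W) h :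
  bilin M -> bilin F -> (forall h, swe h M = (ε h : k) *: u) ->
  \sw_(a, r <- h) \sw_(b, c <- r) F a (M b c) = F h u.
Proof.
move=> bM bF MC; rewrite -(swe_counitr h (g := F^~ u)); last lin.
apply: swe_ext => a b; rewrite -(swe_comp (g := F a)); last lin.
rewrite MC; case: bF => _ bF; exact: (linZ (bF a)).
Qed.

Arguments swe_cancelr {B W M u F} h.

(** In the convolution algebra of bilinear maps on [H], a left inverse [u] and a right inverse [w]
    of [v] both equal the triple product [T] of [u], [v] and [w]. *)
Lemma conv_uniq (B : algType k) (u v w : H -> H -> B) :
  bilin u -> bilin v -> bilin w ->
  (forall h l, \sw_(a, b <- h) \sw_(c, d <- l) u a c * v b d = (ε h * ε l : k)%:A) ->
  (forall h l, \sw_(a, b <- h) \sw_(c, d <- l) v a c * w b d = (ε h * ε l : k)%:A) ->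
  forall h l, u h l = w h l.
Proof.
move=> bu bv bw uv vw h l.
pose T := \sw_(h1, h' <- h) \sw_(h2, h3 <- h') \sw_(l1, l' <- l)
  \sw_(l2, l3 <- l') u h1 l1 * v h2 l2 * w h3 l3.
transitivity T; rewrite /T.
  symmetry; transitivity (\sw_(h1, h' <- h) \sw_(l1, l' <- l)
      u h1 l1 * (ε h' * ε l' : k)%:A).
    apply: swe_ext => h1 h'; rewrite swe_exchange; apply: swe_ext => l1 l'.
    rewrite -vw (swe_comp (g := fun x => u h1 l1 * x)); last lin.
    apply: swe_ext => h2 h3; rewrite (swe_comp (g := fun x => u h1 l1 * x)); last lin.
    by apply: swe_ext => l2 l3; rewrite mulrA.
  rewrite -[in RHS](swe_counitr h (g := u^~ l)); last lin.
  apply: swe_ext => h1 h'.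
  rewrite -(swe_counitr l (g := u h1)); last lin.
  rewrite (swe_comp (g := fun x => (ε h' : k) *: x)); last lin.
  by apply: swe_ext => l1 l'; rewrite -scalerAr mulr1 scalerA.
transitivity (\sw_(x, h3 <- h) \sw_(y, l3 <- l) (ε x * ε y : k)%:A * w h3 l3).
  rewrite -(swe_assoc (F := fun h1 h2 h3 => \sw_(l1, l' <- l)
    \sw_(l2, l3 <- l') u h1 l1 * v h2 l2 * w h3 l3)); last lin.
  apply: swe_ext => x h3.
  transitivity (\sw_(h1, h2 <- x) \sw_(y, l3 <- l) \sw_(l1, l2 <- y)
     u h1 l1 * v h2 l2 * w h3 l3).
    apply: swe_ext => h1 h2.
    by rewrite (swe_assoc (F := fun l1 l2 l3 => u h1 l1 * v h2 l2 * w h3 l3)) //; lin.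
  rewrite swe_exchange; apply: swe_ext => y l3.
  rewrite -uv (swe_comp (g := fun z => z * w h3 l3)); last lin.
  apply: swe_ext => h1 h2.
  by rewrite (swe_comp (g := fun z => z * w h3 l3)) //; lin.
rewrite -[in RHS](swe_counitl h (g := w^~ l)); last lin.
apply: swe_ext => x h3; rewrite -(swe_counitl l (g := w h3)); last lin.
rewrite (swe_comp (g := fun z => (ε x : k) *: z)); last lin.
by apply: swe_ext => y l3; rewrite -scalerAl mul1r scalerA.
Qed.

(** The two sides are a left and a right convolution inverse of the multiplication of [H]. *)
Lemma antipodeM h l : S (h * l) = S l * S h.
Proof.
apply: (@conv_uniq H (fun h l => S (h * l)) (fun h l => h * l)
  (fun h l => S l * S h)); [lin|lin|lin|move=> {}h {}l|move=> {}h {}l].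
  rewrite -(swe_mul h l (F := fun x y => S x * y)); last lin.
  by rewrite (swe_antipodel (h * l) (g := fun x => x)) // counitM.
transitivity (\sw_(a, b <- h) (ε l : k) *: (a * S b)).
  apply: swe_ext => a b.
  transitivity (\sw_(c, d <- l) a * (c * S d) * S b).
    by apply: swe_ext => c d; rewrite !mulrA.
  by rewrite (swe_antipoder l (g := fun x => a * x * S b)) ?mulr1 //; lin.
rewrite -(swe_comp (g := fun x => (ε l : k) *: x)); last lin.
by rewrite (swe_antipoder h (g := fun x => x)) // scalerA mulrC.
Qed.

(** Anticomultiplicativity of the antipode. The middle term is [F] on $\Delta(S h_1)(h_2 S h_5
    \otimes h_3 S h_4)$: contracting $h_3 S h_4$ and then $h_2 S h_5$ gives the left side,
    contracting $\Delta(S h_1)(h_2 \otimes h_3)$ gives the right side. *)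
Lemma swe_antipode (W : lmodType k) (F : H -> H -> W) h : bilin F ->
  swe (S h) F = \sw_(a, b <- h) F (S b) (S a).
Proof.
move=> bF.
pose G x a b := \sw_(c, d <- S x) F (c * a) (d * b).
have tG : trilin G by rewrite /G; lin.
have G1 x a b : \sw_(h1, h' <- x) \sw_(h2, h3 <- h') G h1 (h2 * a) (h3 * b) =
    (ε x : k) *: F a b.
  rewrite -[in RHS](mul1r a) -[in RHS](mul1r b).
  pose g y := \sw_(c, d <- y) F (c * a) (d * b).
  have lg : linear g by rewrite /g; lin.
  have -> : F (1 * a) (1 * b) = g 1.
    by rewrite /g (swe_1 (F := fun c d => F (c * a) (d * b))) //; lin.
  rewrite -(swe_antipodel x lg); apply: swe_ext => h1 h'.
  rewrite /g swe_mul; last lin.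
  rewrite /G swe_exchange; apply: swe_ext => c d; apply: swe_ext => h2 h3.
  by rewrite !mulrA.
pose K h1 h2 h3 r := \sw_(h4, h5 <- r) G h1 (h2 * S h5) (h3 * S h4).
transitivity (\sw_(h1, r <- h) \sw_(h2, r' <- r) \sw_(h3, r'' <- r') K h1 h2 h3 r'').
  transitivity (G h 1 1).
    by rewrite /G; apply: swe_ext => c d; rewrite !mulr1.
  rewrite -[LHS](swe_counitr h (g := fun h => G h 1 1)); last lin.
  apply: swe_ext => h1 r; transitivity (\sw_(h2, r' <- r) G h1 (h2 * S r') 1).
    by rewrite (swe_antipoder r (g := fun x => G h1 x 1)) //; lin.
  apply: swe_ext => h2 r'; rewrite /K.
  by rewrite (swe_cancell (M := fun a b => a * S b) (u := 1)
    (F := fun x c => G h1 (h2 * S c) x)); [|lin|lin|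
    move=> x; rewrite (swe_antipoder x (g := fun x => x))].
transitivity (\sw_(x, r <- h) (ε x : k) *: \sw_(a, b <- r) F (S b) (S a)); last first.
  by rewrite (swe_counitl h (g := fun r => \sw_(a, b <- r) F (S b) (S a))) //; lin.
transitivity (\sw_(x, r <- h) \sw_(h1, y <- x) \sw_(h2, h3 <- y) K h1 h2 h3 r).
  have lK h1 h2 h3 : linear (K h1 h2 h3) by rewrite /K; lin.
  have tK r : trilin (fun h1 h2 h3 => K h1 h2 h3 r) by rewrite /K; lin.
  rewrite (swe_assoc (F := fun h1 y r => \sw_(h2, h3 <- y) K h1 h2 h3 r)); last first.
    by rewrite /K; lin.
  apply: swe_ext => h1 r; symmetry.
  by rewrite (swe_assoc (F := fun a b c => K h1 a b c)) // /K; lin.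
apply: swe_ext => x r.
rewrite (swe_comp (g := fun z => (ε x : k) *: z)); last lin.
transitivity (\sw_(a, b <- r) \sw_(h1, y <- x) \sw_(h2, h3 <- y)
  G h1 (h2 * S b) (h3 * S a)).
  by rewrite [RHS]swe_exchange; apply: swe_ext => h1 y; rewrite [RHS]swe_exchange.
by apply: swe_ext => a b; rewrite G1.
Qed.

Definition quadlin (U V T Y W : lmodType k) (F : U -> V -> T -> Y -> W) :=
  [/\ forall b c d, linear (fun a => F a b c d),
      forall a c d, linear (fun b => F a b c d),
      forall a b d, linear (fun c => F a b c d) & forall a b c, linear (F a b c)].

Lemma swe_assoc4 (W : lmodType k) (F : H -> H -> H -> H -> W) h : quadlin F ->
  \sw_(a, r <- h) \sw_(b, s <- r) \sw_(c, d <- s) F a b c d =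
  \sw_(x, d <- h) \sw_(a, y <- x) \sw_(b, c <- y) F a b c d.
Proof.
move=> [F1 F2 F3 F4].
have lF a b c : linear (fun d => F a b c d) by apply: F4.
rewrite (swe_assoc (F := fun a y d => \sw_(b, c <- y) F a b c d)); last first.
  split=> *; try by do ?apply: swe_linearF => *.
  by apply: swe_linear => //; split.
apply: swe_ext => a r; symmetry.
by rewrite (swe_assoc (F := F a)).
Qed.

End Convolution.

Arguments swe_cancell {k H B W M u F} h.
Arguments swe_cancelr {k H B W M u F} h.
Arguments swe_antipode {k H W F} h.
Arguments swe_assoc4 {k H W F} h.

(** * Crossed products *)

Section CrossedIdentities.
Variables (k : fieldType) (A : algType k) (H : hopfAlgebra k).
Variables (w : weakAction A H) (f finv : {linear tensor H H -> A}).
Variables (wf : is_crossed_product w f) (fV : conv_inverse f finv).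
Local Notation E := (crossed wf).
Local Notation "a ## h" := (cpure wf a h) (at level 38).
Local Notation ε := (counit H).
Local Notation S := (antipode H).
Local Notation c := (cinv wf finv).

Let bw : bilin (wact w) := wact_bilin w.
Let bc : bilin (cpure wf) := tpure_bilin A H.

Lemma crossed_ext (W : lmodType k) (g g' : E -> W) : linear g -> linear g' ->
  (forall a h, g (a ## h) = g' (a ## h)) -> g =1 g'.
Proof.
move=> lg lg' e x; have -> : x = \sum_(p <- trepr (x : tensor A H)) p.1 ## p.2.
  exact: trepr_sum.
by rewrite !lin_sum //; apply: eq_bigr => p _.
Qed.

(** The map $A \otimes \epsilon$. Applied to the unit laws of [E] it yields the normalization of
    [f], since [is_crossed_product] consists of ring axioms and not of cocycle identities. *)
Definition eps2 : E -> A := tlift (fun a h => (ε h : k) *: a).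

Lemma eps2_linear : linear eps2.
Proof. by apply: tlift_linear; lin. Qed.

Lemma eps2E a h : eps2 (a ## h) = (ε h : k) *: a.
Proof. by apply: tlift_pure; lin. Qed.

Lemma cpureM_swe a h b l : (a ## h) * (b ## l) =
  \sw_(h1, r <- h) \sw_(h2, h3 <- r) \sw_(l1, l2 <- l)
    (a * w h1 b * f (h2 ⊗ l1)) ## (h3 * l2).
Proof. exact: cpureM. Qed.

Lemma cocycle1l l : f (1 ⊗ l) = (ε l : k)%:A.
Proof.
have := congr1 eps2 (mul1r (1 ## l)).
rewrite eps2E (cpureM_swe 1 1 1 l) => <-.
rewrite swe_1; last by lin.
rewrite swe_1; last by lin.
rewrite (swe_comp _ _ eps2_linear).
have lf : linear (fun l => f (1 ⊗ l)) by lin.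
rewrite -[LHS](swe_counitr l lf); apply: swe_ext => l1 l2.
by rewrite eps2E (wact1l w) !mul1r.
Qed.

Lemma cocycle1r h : f (h ⊗ 1) = (ε h : k)%:A.
Proof.
have := congr1 eps2 (mulr1 (1 ## h)).
rewrite eps2E (cpureM_swe 1 h 1 1) => <-.
have lf : linear (fun h => f (h ⊗ 1)) by lin.
rewrite (swe_comp _ _ eps2_linear) -[LHS](swe_counitl h lf).
apply: swe_ext => h1 r.
rewrite (swe_comp _ _ eps2_linear) -(swe_counitr r lf).
rewrite (swe_comp (g := fun x => (ε h1 : k) *: x)); last by lin.
apply: swe_ext => h2 h3; rewrite swe_1; last by lin.
by rewrite eps2E wact1 mul1r mulr_algl mulr1 scale_comm.
Qed.

Lemma cpure1 : 1 ## 1 = 1. Proof. by []. Qed.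

Lemma cpure_mulA a b h : (a ## 1) * (b ## h) = (a * b) ## h.
Proof.
rewrite cpureM_swe swe_1; last by lin.
rewrite swe_1; last by lin.
rewrite -(swe_counitl h (g := fun h => (a * b) ## h)); last by lin.
apply: swe_ext => h1 h2; rewrite cocycle1l (wact1l w) mul1r mulr_algr.
by case: bc => bc1 _; rewrite (linZ (bc1 h2)).
Qed.

Lemma cpure_decomp a h : a ## h = (a ## 1) * (1 ## h).
Proof. by rewrite cpure_mulA mulr1. Qed.

Lemma cpure_mulH h a : (1 ## h) * (a ## 1) = \sw_(h1, h2 <- h) w h1 a ## h2.
Proof.
rewrite cpureM_swe; apply: swe_ext => h1 r.
rewrite -(swe_counitl r (g := fun r => w h1 a ## r)); last by lin.
apply: swe_ext => h2 h3; rewrite swe_1; last by lin.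
rewrite cocycle1r mul1r mulr1 mulr_algr.
by case: bc => bc1 _; rewrite (linZ (bc1 h3)).
Qed.

Lemma cpure_mulHH h l : (1 ## h) * (1 ## l) =
  \sw_(h1, h2 <- h) \sw_(l1, l2 <- l) f (h1 ⊗ l1) ## (h2 * l2).
Proof.
rewrite cpureM_swe -(swe_counitl h (g := fun h => \sw_(h1, h2 <- h)
  \sw_(l1, l2 <- l) f (h1 ⊗ l1) ## (h2 * l2))); last by lin.
apply: swe_ext => h1 r.
rewrite (swe_comp (g := fun x => (ε h1 : k) *: x)); last by lin.
apply: swe_ext => h2 h3.
rewrite (swe_comp (g := fun x => (ε h1 : k) *: x)); last by lin.
apply: swe_ext => l1 l2; rewrite wact1 mul1r mulr_algl.
by case: bc => bc1 _; rewrite (linZ (bc1 _)).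
Qed.

Lemma cpure_mulAH a h l : (a ## h) * (1 ## l) =
  \sw_(h1, h2 <- h) \sw_(l1, l2 <- l) (a * f (h1 ⊗ l1)) ## (h2 * l2).
Proof.
rewrite cpure_decomp -mulrA cpure_mulHH (swe_comp (g := fun x => (a ## 1) * x)); last by lin.
apply: swe_ext => h1 h2; rewrite (swe_comp (g := fun x => (a ## 1) * x)); last by lin.
by apply: swe_ext => l1 l2; rewrite cpure_mulA.
Qed.

Definition ginv h := \sw_(h1, h2 <- h) finv (S h1 ⊗ h2).

Lemma ginv_linear : linear ginv. Proof. by rewrite /ginv; lin. Qed.
Let lgi := ginv_linear.

Lemma cinv_swe h : c h = \sw_(h1, h2 <- h) ginv h2 ## S h1.
Proof.
transitivity (\sw_(h1, r <- h) \sw_(h2, h3 <- r) finv (S h2 ⊗ h3) ## S h1) => //.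
by apply: swe_ext => h1 r; rewrite (swe_comp (g := fun x => x ## S h1)) //; lin.
Qed.

Lemma cinv_linear : linear c.
Proof.
have l : linear (fun h => \sw_(h1, h2 <- h) ginv h2 ## S h1) by lin.
by move=> a x y; rewrite !cinv_swe l.
Qed.
Let lc := cinv_linear.

(** The identity $f^{-1} * f = \epsilon \otimes \epsilon$ at $(S p, q)$, with $\Delta(S p)$
    expanded. *)
Lemma ginv_conv t :
  \sw_(x, s <- t) \sw_(m, y <- s) ginv m * f (S x ⊗ y) = (ε t : k)%:A.
Proof.
transitivity (\sw_(p, q <- t) (ε p * ε q : k)%:A : A); last first.
  rewrite -[RHS](swe_counitl t (g := fun t => (ε t : k)%:A)); last by lin.
  by apply: swe_ext => p q; rewrite scalerA.
transitivity (\sw_(p, q <- t) \sw_(x, m <- p) \sw_(n, y <- q)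
    finv (S m ⊗ n) * f (S x ⊗ y)).
  rewrite (swe_assoc (F := fun x m q => \sw_(n, y <- q)
    finv (S m ⊗ n) * f (S x ⊗ y))); last by lin.
  apply: swe_ext => x s.
  rewrite -(swe_assoc (F := fun m n y => finv (S m ⊗ n) * f (S x ⊗ y))); last by lin.
  apply: swe_ext => m y.
  by rewrite (swe_comp (g := fun z => z * f (S x ⊗ y))) //; lin.
apply: swe_ext => p q; rewrite -(counit_antipode p) -(fV (S p) q).2.
rewrite [RHS](swe_antipode p (F := fun s1 s2 => \sw_(n, y <- q)
   finv (s1 ⊗ n) * f (s2 ⊗ y))) //; lin.
Qed.

(** Expanding $\Delta(S h_1)$ in the product brings $f^{-1}$ and $f$ together as in [ginv_conv], and
    what is left is $1 \# S(h_1) h_2$. *)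
Lemma cinv_mull h : \sw_(a, b <- h) c a * (1 ## b) = (ε h : k)%:A.
Proof.
pose N x m y z := (ginv m * f (S x ⊗ y)) ## z.
transitivity (\sw_(x, t <- h) \sw_(y, q <- t) \sw_(u, s <- y) \sw_(m, v <- s)
   N u m v (S x * q)).
  transitivity (\sw_(a1, r <- h) \sw_(x, u <- a1) \sw_(m, b <- r) \sw_(v, q <- b)
     N u m v (S x * q)).
    transitivity (\sw_(a1, r <- h) \sw_(m, b <- r) (ginv m ## S a1) * (1 ## b)).
      rewrite -(swe_assoc (F := fun a1 m b => (ginv m ## S a1) * (1 ## b))); last by lin.
      apply: swe_ext => a b; rewrite cinv_swe (swe_comp (g := fun x => x * (1 ## b))) //.
      by lin.
    apply: swe_ext => a1 r; rewrite [RHS]swe_exchange; apply: swe_ext => m b.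
    by rewrite cpure_mulAH swe_antipode //; lin.
  rewrite (swe_assoc (F := fun x u r => \sw_(m, b <- r) \sw_(v, q <- b)
     N u m v (S x * q))); last by rewrite /N; lin.
  apply: swe_ext => x t.
  by rewrite (swe_assoc4 (F := fun u m v q => N u m v (S x * q))) //; rewrite /N; split=> *; lin.
transitivity (\sw_(x, t <- h) 1 ## (S x * t)).
  apply: swe_ext => x t; rewrite -[RHS](swe_counitl t (g := fun t => 1 ## (S x * t))); last by lin.
  apply: swe_ext => y q; have [bc1 _] := bc; rewrite -(linZ (bc1 _)) -ginv_conv.
  rewrite (swe_comp (g := fun z => z ## (S x * q))) //.
  by apply: swe_ext => u s; rewrite (swe_comp (g := fun z => z ## (S x * q))).
by rewrite (swe_antipodel h (g := fun z => 1 ## z)) //; lin.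
Qed.

(** Direct computation only shows the sum to be $u(h) \# 1$. The left inverse then gives $\sum
    (u(h_1) \# 1)(1 \# h_2) = 1 \# h$, and applying $A \otimes \epsilon$ yields $u(h) =
    \epsilon(h)$, without expanding the cocycle identity. *)
Lemma cinv_mulr h : \sw_(a, b <- h) (1 ## a) * c b = (ε h : k)%:A.
Proof.
pose u h := \sw_(a, r <- h) \sw_(x, r' <- r) \sw_(t, b <- r') w a (ginv b) * f (x ⊗ S t).
have lu : linear u by rewrite /u; lin.
pose N a x z t b := (w a (ginv b) * f (x ⊗ S t)) ## z.
have eA h' : \sw_(a, b <- h') (1 ## a) * c b = u h' ## 1.
  transitivity (\sw_(a, r <- h') \sw_(a2, b <- r) \sw_(x, y <- a2) \sw_(b1, b2 <- b)
    \sw_(z, t <- b1) N a x (y * S z) t b2).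
    transitivity (\sw_(a', b <- h') \sw_(a, a2 <- a') \sw_(b1, b2 <- b)
       (w a (ginv b2) ## a2) * (1 ## S b1)).
      apply: swe_ext => a b; rewrite cinv_swe [RHS]swe_exchange.
      rewrite (swe_comp (g := fun z => (1 ## a) * z)); last by lin.
      apply: swe_ext => b1 b2; rewrite [ginv b2 ## _]cpure_decomp mulrA cpure_mulH.
      by rewrite (swe_comp (g := fun z => z * (1 ## S b1))) //; lin.
    rewrite (swe_assoc (F := fun a a2 b => \sw_(b1, b2 <- b)
       (w a (ginv b2) ## a2) * (1 ## S b1))); last by lin.
    apply: swe_ext => a r; apply: swe_ext => a2 b; rewrite [RHS]swe_exchange.
    apply: swe_ext => b1 b2; rewrite cpure_mulAH; apply: swe_ext => x y.
    by rewrite swe_antipode //; lin.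
  rewrite /u (swe_comp (g := fun z => z ## 1)); last by lin.
  apply: swe_ext => a r.
  rewrite (swe_assoc (F := fun x y b => \sw_(b1, b2 <- b)
    \sw_(z, t <- b1) N a x (y * S z) t b2)); last by rewrite /N; lin.
  rewrite (swe_comp (g := fun z => z ## 1)); last by lin.
  apply: swe_ext => x r'.
  rewrite (swe_comp (g := fun z => z ## 1)); last by lin.
  transitivity (\sw_(y, b <- r') \sw_(z, s <- b) \sw_(t, b2 <- s) N a x (y * S z) t b2).
    apply: swe_ext => y b.
    by rewrite (swe_assoc (F := fun z t b2 => N a x (y * S z) t b2)) //; rewrite /N; lin.
  rewrite (swe_cancell r' (M := fun y z => y * S z) (u := 1)
    (F := fun p s => \sw_(t, b2 <- s) N a x p t b2)) //; rewrite /N; try by lin.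
  by move=> y; rewrite (swe_antipoder y (g := fun z => z)).
rewrite eA; suff -> : u h = (ε h : k)%:A.
  by have [bc1 _] := bc; rewrite (linZ (bc1 1)).
have := congr1 eps2 (_ : \sw_(a, b <- h) (u a ## 1) * (1 ## b) = 1 ## h).
rewrite eps2E => <-; first rewrite (swe_comp _ _ eps2_linear).
  rewrite -[LHS](swe_counitr h lu); apply: swe_ext => a b.
  by rewrite -cpure_decomp eps2E.
transitivity (\sw_(a, r <- h) \sw_(b, d <- r) (1 ## a) * (c b * (1 ## d))).
  rewrite -(swe_assoc (F := fun a b d => (1 ## a) * (c b * (1 ## d)))); last by lin.
  apply: swe_ext => a d; rewrite -eA (swe_comp (g := fun z => z * (1 ## d))); last by lin.
  by apply: swe_ext => x y; rewrite mulrA.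
rewrite (swe_cancelr h (M := fun b d => c b * (1 ## d)) (u := 1)
  (F := fun a z => (1 ## a) * z)) ?mulr1 //; try by lin.
by move=> x; apply: cinv_mull.
Qed.

Lemma cinv1 : c 1 = 1.
Proof.
have := cinv_mull 1; rewrite swe_1; last by lin.
by rewrite mulr1 counit1 scale1r.
Qed.

(** The commutation rule [cpure_mulH], multiplied by [cinv] on both sides. *)
Lemma cinv_act h x : \sw_(a, b <- h) c a * (w b x ## 1) = (x ## 1) * c h.
Proof.
pose K a b m n := c a * (w b x ## 1) * ((1 ## m) * c n).
transitivity (\sw_(a, r <- h) \sw_(b, s <- r) \sw_(m, n <- s) K a b m n).
  apply: swe_ext => a r; rewrite /K.
  rewrite (swe_cancelr r (M := fun m n => (1 ## m) * c n) (u := 1)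
    (F := fun b z => c a * (w b x ## 1) * z)) ?mulr1 //; try by lin.
  by move=> y; apply: cinv_mulr.
transitivity (\sw_(a, r <- h) \sw_(y, n <- r) c a * (1 ## y) * ((x ## 1) * c n)).
  apply: swe_ext => a r.
  rewrite -(swe_assoc (F := fun b m n => K a b m n)); last by rewrite /K; lin.
  apply: swe_ext => y n.
  rewrite -mulrA [(1 ## y) * _]mulrA cpure_mulH.
  rewrite (swe_comp (g := fun z => c a * (z * c n))); last by lin.
  by apply: swe_ext => b m; rewrite /K [w b x ## m]cpure_decomp !mulrA.
rewrite (swe_cancell h (M := fun a y => c a * (1 ## y)) (u := 1)
    (F := fun z n => z * ((x ## 1) * c n))) ?mul1r //; try by lin.
by move=> y; apply: cinv_mull.
Qed.

(** Both sides are convolution inverse to $(h, l) \mapsto 1 \# hl$. So [cinv] is antimultiplicative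
    up to a value of [f], an element of [A] that [A]-linear maps absorb. *)
Lemma cinvM h l :
  \sw_(h1, h2 <- h) \sw_(l1, l2 <- l) c l1 * c h1 * (f (h2 ⊗ l2) ## 1) = c (h * l).
Proof.
apply: (@conv_uniq k H E (fun h l => \sw_(h1, h2 <- h) \sw_(l1, l2 <- l)
  c l1 * c h1 * (f (h2 ⊗ l2) ## 1)) (fun h l => 1 ## (h * l)) (fun h l => c (h * l)));
  [by lin|by lin|by lin|move=> {}h {}l|move=> {}h {}l]; last first.
  transitivity (\sw_(x, y <- h * l) (1 ## x) * c y).
    by rewrite swe_mul //; lin.
  by rewrite cinv_mulr counitM.
transitivity (\sw_(h1, r <- h) \sw_(h2, b <- r) \sw_(l1, s <- l) \sw_(l2, d <- s)
  c l1 * c h1 * (f (h2 ⊗ l2) ## (b * d))).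
  rewrite -(swe_assoc (F := fun h1 h2 b => \sw_(l1, s <- l) \sw_(l2, d <- s)
    c l1 * c h1 * (f (h2 ⊗ l2) ## (b * d)))); last by lin.
  apply: swe_ext => a b.
  transitivity (\sw_(x, d <- l) \sw_(h1, h2 <- a) \sw_(l1, l2 <- x)
    c l1 * c h1 * (f (h2 ⊗ l2) ## (b * d))).
    apply: swe_ext => x d.
    rewrite (swe_comp (g := fun z => z * (1 ## (b * d)))); last by lin.
    apply: swe_ext => h1 h2; rewrite (swe_comp (g := fun z => z * (1 ## (b * d)))); last by lin.
    by apply: swe_ext => l1 l2; rewrite [f _ ## (b * d)]cpure_decomp mulrA.
  rewrite swe_exchange; apply: swe_ext => h1 h2.
  by rewrite (swe_assoc (F := fun l1 l2 d => c l1 * c h1 * (f (h2 ⊗ l2) ## (b * d)))) //; lin.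
transitivity (\sw_(h1, r <- h) \sw_(l1, s <- l) c l1 * ((c h1 * (1 ## r)) * (1 ## s))).
  apply: swe_ext => h1 r; rewrite swe_exchange; apply: swe_ext => l1 s.
  rewrite -[c h1 * _ * _]mulrA cpure_mulHH mulrA.
  rewrite (swe_comp (g := fun z => c l1 * c h1 * z)); last by lin.
  by apply: swe_ext => h2 b; rewrite (swe_comp (g := fun z => c l1 * c h1 * z)) //; lin.
rewrite swe_exchange.
transitivity (\sw_(l1, s <- l) (ε h : k) *: (c l1 * (1 ## s))).
  apply: swe_ext => l1 s.
  rewrite -(swe_comp (g := fun z => c l1 * (z * (1 ## s)))); last by lin.
  by rewrite cinv_mull mulr_algl scalerAr.
rewrite -(swe_comp (g := fun z => (ε h : k) *: z)); last by lin.
by rewrite cinv_mull scalerA.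
Qed.

Definition coact (W : lmodType k) (G : E -> H -> W) (e : E) : W :=
  tlift (fun a h => \sw_(h1, h2 <- h) G (a ## h1) h2) e.

Lemma coact_linear (W : lmodType k) (G : E -> H -> W) : bilin G -> linear (coact G).
Proof. by move=> bG; apply: tlift_linear; lin. Qed.

Lemma coactE (W : lmodType k) (G : E -> H -> W) a h : bilin G ->
  coact G (a ## h) = \sw_(h1, h2 <- h) G (a ## h1) h2.
Proof. by move=> bG; apply: tlift_pure; lin. Qed.

Lemma coact1 (W : lmodType k) (G : E -> H -> W) : bilin G -> coact G 1 = G 1 1.
Proof. by move=> bG; rewrite -cpure1 coactE // swe_1 //; lin. Qed.

(** [E] is a right [H]-comodule algebra under $a \# h \mapsto (a \# h_1) \otimes h_2$. Testing on an
    arbitrary bilinear [G] avoids the algebra $E \otimes H$. *)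
Lemma coactM (W : lmodType k) (G : E -> H -> W) (e e' : E) : bilin G ->
  coact G (e * e') = coact (fun x m => coact (fun y n => G (x * y) (m * n)) e') e.
Proof.
move=> bG.
have bG1 x m : bilin (fun y n => G (x * y) (m * n)) by lin.
have bG2 : forall e', bilin (fun x m => coact (fun y n => G (x * y) (m * n)) e').
  move=> d; split=> ?; rewrite /coact; apply: Defs.linear_sum => p; lin.
have lG := coact_linear bG.
move: e'; apply: crossed_ext.
- by move=> a x y; rewrite mulrDr -scalerAr lG.
- apply: (@Defs.linear_sum _ _ _ _ (trepr (e : tensor A H)) (fun p e' =>
    \sw_(h1, h2 <- p.2) coact (fun y n => G ((p.1 ## h1) * y) (h2 * n)) e')) => p.
  by apply: swe_linearF => a b; apply: coact_linear.
move=> b l; move: e; apply: crossed_ext.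
- by move=> a x y; rewrite mulrDl -scalerAl lG.
- exact: coact_linear.
move=> a h; rewrite coactE // cpureM_swe.
pose T h1 h2 h3 h4 l1 l2 l3 := G ((a * w h1 b * f (h2 ⊗ l1)) ## (h3 * l2)) (h4 * l3).
transitivity (\sw_(h1, r <- h) \sw_(h2, s <- r) \sw_(h3, h4 <- s)
  \sw_(l1, t <- l) \sw_(l2, l3 <- t) T h1 h2 h3 h4 l1 l2 l3).
  rewrite (swe_comp _ _ lG); apply: swe_ext => h1 r.
  rewrite (swe_comp _ _ lG); apply: swe_ext => h2 s.
  rewrite (swe_comp _ _ lG) [RHS]swe_exchange; apply: swe_ext => l1 t.
  by rewrite coactE // swe_mul //; lin.
rewrite (swe_assoc4 (F := fun h1 h2 h3 h4 => \sw_(l1, t <- l) \sw_(l2, l3 <- t)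
  T h1 h2 h3 h4 l1 l2 l3)); last by rewrite /T; split=> *; lin.
apply: swe_ext => x h4; rewrite coactE //.
transitivity (\sw_(y, l3 <- l) \sw_(h1, z <- x) \sw_(h2, h3 <- z) \sw_(l1, l2 <- y)
  T h1 h2 h3 h4 l1 l2 l3); last first.
  apply: swe_ext => y l3; rewrite cpureM_swe.
  have lg : linear (fun z => G z (h4 * l3)) by case: bG.
  rewrite (swe_comp _ _ lg); apply: swe_ext => h1 z; rewrite (swe_comp _ _ lg).
  by apply: swe_ext => h2 h3; rewrite (swe_comp _ _ lg).
rewrite [RHS]swe_exchange; apply: swe_ext => h1 z; rewrite [RHS]swe_exchange.
apply: swe_ext => h2 h3.
by rewrite (swe_assoc (F := fun l1 l2 l3 => T h1 h2 h3 h4 l1 l2 l3)) //; rewrite /T; lin.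
Qed.

End CrossedIdentities.

(** * Hopf module structures on spaces of linear maps *)

Definition ract (k : pzRingType) (R : algType k) (M : lmodType R) (r : R)
  (m : scalars M) : scalars M := r *: (m : M).

Lemma ract_bilin (k : fieldType) (R : algType k) (M : lmodType R) :
  bilin (@ract k R M).
Proof.
split=> [m|r] a x y; rewrite /ract.
  by rewrite scalerDl -[a *: x]mulr_algl -scalerA.
by rewrite scalerDr; congr (_ + _); apply: scalars_scaleC.
Qed.

Lemma ractM (k : pzRingType) (R : algType k) (M : lmodType R) r s (m : scalars M) :
  ract r (ract s m) = ract (r * s) m.
Proof. by rewrite /ract scalerA. Qed.

Lemma lin_ract (k : pzRingType) (R : algType k) (U V : lmodType R) (g : U -> V) r
  (m : scalars U) : linear g -> g (ract r m) = ract r (g m : scalars V).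
Proof. by move=> lg; apply: (linZ lg). Qed.

Section HomA.
Variables (k : fieldType) (A : algType k) (H : hopfAlgebra k).
Variables (w : weakAction A H) (f finv : {linear tensor H H -> A}).
Variables (wf : is_crossed_product w f) (fV : conv_inverse f finv).
Local Notation E := (crossed wf).
Local Notation "a ## h" := (cpure wf a h) (at level 38).
Local Notation c := (cinv wf finv).
Let bw : bilin (wact w) := wact_bilin w.
Let bc : bilin (cpure wf) := tpure_bilin A H.
Let lc : linear c := @cinv_linear k A H w f finv wf.

Variables Q N : lmodType E.
Let bQ := @ract_bilin k E Q.
Let bN := @ract_bilin k E N.

Definition homA_set (g : scalars Q -> scalars N) :=
  linear g /\ forall a q, g (ract (a ## 1) q) = ract (a ## 1) (g q).

Fact homA0 : homA_set 0.
Proof.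
split=> [a x y|a q]; first by rewrite scaler0 addr0.
by change (0 = (a ## 1) *: (0 : N)); rewrite scaler0.
Qed.

Fact homAP a g g' : homA_set g -> homA_set g' -> homA_set (a *: g + g').
Proof.
move=> [lg Ag] [lg' Ag']; split; first exact: linear_fct.
move=> b q; rewrite !fctE Ag Ag'; symmetry.
by case: bN => _ /(_ (b ## 1)) ->.
Qed.

Definition homA_sub : submod (scalars Q -> scalars N) := Submod homA0 homAP.

(* This depends on [fV] because the module structure below does. *)
Definition homA : Type := let _ := fV in subspace homA_sub.

HB.instance Definition _ := GRing.Zmodule.copy homA (subspace homA_sub).

Definition homA_val (g : homA) : scalars Q -> scalars N := val (g : subspace homA_sub).

Lemma homA_inj : injective homA_val.
Proof. exact: val_inj. Qed.

Lemma homA_valP (g : homA) : homA_set (homA_val g).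
Proof. exact: (@subspaceP _ _ homA_sub g). Qed.

Definition homA_act_fun (h : H) (g : scalars Q -> scalars N) : scalars Q -> scalars N :=
  fun q => \sw_(h1, h2 <- h) ract (c h1) (g (ract (1 ## h2) q)).

Fact homA_act_subproof h (g : scalars Q -> scalars N) :
  homA_set g -> homA_set (homA_act_fun h g).
Proof.
move=> [lg Ag]; rewrite /homA_act_fun; split; first lin.
move=> x q; have rx : linear (ract (M := N) (x ## 1)) by lin.
rewrite (swe_comp _ _ rx).
transitivity (\sw_(h1, r <- h) \sw_(h2, h3 <- r)
   ract (c h1 * (w h2 x ## 1)) (g (ract (1 ## h3) q))).
  apply: swe_ext => h1 r; rewrite ractM cpure_mulH.
  rewrite (swe_comp (g := fun z => ract (c h1) (g (ract z q)))); last lin.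
  apply: swe_ext => h2 h3.
  by rewrite [w h2 x ## _]cpure_decomp -!ractM Ag.
rewrite -(swe_assoc (F := fun h1 h2 h3 => ract (c h1 * (w h2 x ## 1))
  (g (ract (1 ## h3) q)))); last lin.
apply: swe_ext => h1 h2; rewrite ractM -(cinv_act wf fV).
by rewrite (swe_comp (g := fun z => ract z (g (ract (1 ## h2) q)))) //; lin.
Qed.

Definition homA_act (h : (H : algType k)^c) (g : homA) : homA :=
  @subel _ _ homA_sub _ (homA_act_subproof h (homA_valP g)).

(** The factor $f(b_2, a_2)$ from the product of $1 \# b$ and $1 \# a$ passes through [g] by
    [A]-linearity, and [cinvM] then assembles $c(ba)$. The product [a * b] of [H^c] is $ba$ in
    [H]. *)
Fact homA_actA a b g : homA_act a (homA_act b g) = homA_act (a * b) g.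
Proof.
apply: homA_inj; apply/funext => q.
have [lg Ag] := homA_valP g; set G := homA_val g in lg Ag.
change (\sw_(a1, s <- (a : H)) ract (c a1) (\sw_(b1, r <- (b : H))
    ract (c b1) (G (ract (1 ## r) (ract (1 ## s) q)))) =
  \sw_(h1, h2 <- (b : H) * (a : H)) ract (c h1) (G (ract (1 ## h2) q))).
rewrite swe_mul; last lin.
pose T b1 b2 b3 a1 a2 a3 :=
  ract (c a1 * c b1 * (f (b2 ⊗ a2) ## 1)) (G (ract (1 ## (b3 * a3)) q)).
transitivity (\sw_(b1, r <- b) \sw_(b2, b3 <- r) \sw_(a1, s <- a) \sw_(a2, a3 <- s)
   T b1 b2 b3 a1 a2 a3).
  transitivity (\sw_(b1, r <- b) \sw_(a1, s <- a) \sw_(b2, b3 <- r) \sw_(a2, a3 <- s)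
     T b1 b2 b3 a1 a2 a3).
    rewrite [RHS]swe_exchange; apply: swe_ext => a1 s.
    have rx : linear (ract (M := N) (c a1)) by lin.
    rewrite (swe_comp _ _ rx); apply: swe_ext => b1 r.
    rewrite !ractM cpure_mulHH.
    have lz : linear (fun z : E => ract (c a1 * c b1) (G (ract z q))) by lin.
    rewrite (swe_comp _ _ lz); apply: swe_ext => b2 b3.
    rewrite (swe_comp _ _ lz); apply: swe_ext => a2 a3.
    by rewrite /T [f _ ## _]cpure_decomp -!ractM Ag.
  by apply: swe_ext => b1 r; rewrite swe_exchange.
rewrite -(swe_assoc (F := fun b1 b2 b3 => \sw_(a1, s <- a) \sw_(a2, a3 <- s)
   T b1 b2 b3 a1 a2 a3)); last by rewrite /T; lin.
apply: swe_ext => x b3.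
transitivity (\sw_(y, a3 <- a) \sw_(b1, b2 <- x) \sw_(a1, a2 <- y)
   T b1 b2 b3 a1 a2 a3).
  rewrite [RHS]swe_exchange; apply: swe_ext => b1 b2.
  by rewrite (swe_assoc (F := fun a1 a2 a3 => T b1 b2 b3 a1 a2 a3)) // /T; lin.
apply: swe_ext => y a3; rewrite -(cinvM wf fV).
have lz : linear (fun z : E => ract z (G (ract (1 ## (b3 * a3)) q))) by lin.
rewrite (swe_comp _ _ lz); apply: swe_ext => b1 b2.
by rewrite (swe_comp _ _ lz).
Qed.

Fact homA_act1 : left_id 1 homA_act.
Proof.
move=> g; apply: homA_inj; apply/funext => q.
change (homA_act_fun 1 (homA_val g) q = homA_val g q).
have [lg Ag] := homA_valP g; rewrite /homA_act_fun swe_1; last lin.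
by rewrite cinv1 // /ract !scale1r.
Qed.

Fact homA_actDr : right_distributive homA_act +%R.
Proof.
move=> h g g'; apply: homA_inj; apply/funext => q.
change (homA_act_fun h (homA_val g + homA_val g') q =
  homA_act_fun h (homA_val g) q + homA_act_fun h (homA_val g') q).
rewrite /homA_act_fun /swe -big_split; apply: eq_bigr => x _.
by rewrite fctE /ract scalerDr.
Qed.

Fact homA_actDl g : {morph homA_act^~ g : a b / a + b}.
Proof.
move=> a b; apply: homA_inj; apply/funext => q.
change (homA_act_fun (a + b) (homA_val g) q =
  homA_act_fun a (homA_val g) q + homA_act_fun b (homA_val g) q).
have [lg Ag] := homA_valP g.
have l : linear (fun h => homA_act_fun h (homA_val g) q) by rewrite /homA_act_fun; lin.
exact: (linD l).
Qed.

HB.instance Definition _ := GRing.Zmodule_isLmodule.Build (H : algType k)^c homA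
  homA_actA homA_act1 homA_actDr homA_actDl.

Lemma homA_scaleE (h : H) (g : homA) q :
  homA_val ((h : (H : algType k)^c) *: g) q =
  \sw_(h1, h2 <- h) ract (c h1) (homA_val g (ract (1 ## h2) q)).
Proof. by []. Qed.

Lemma homA_kscale (a : k) (g : scalars homA) : homA_val (a *: g) = a *: homA_val g.
Proof.
apply/funext => q; have [lg Ag] := homA_valP g.
have l : linear (fun h => homA_act_fun h (homA_val g) q) by rewrite /homA_act_fun; lin.
have := linZ l a 1; change (homA_act_fun 1 (homA_val g)) with
  (homA_val ((1 : (H : algType k)^c) *: (g : homA))).
by rewrite scale1r.
Qed.

Lemma homA_klinear : linear (homA_val : scalars homA -> scalars Q -> scalars N).
Proof. by move=> a x y; rewrite -homA_kscale. Qed.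

End HomA.

Section LinearMapModules.
Variables (k : fieldType) (R : algType k) (U V : lmodType k).

Fact lin_zero : linear (0 : U -> V).
Proof. by move=> a x y; rewrite scaler0 addr0. Qed.

Definition lin_sub : submod (U -> V) :=
  @Submod k (U -> V) (fun g => linear g) lin_zero (@linear_fct k U V).

(** The laws are asked of linear maps only, since the Sweedler sums in the actions below need
    linearity. Several actions on Hom_k share this module construction. *)
Record lin_action := LinAction {
  la_fun :> R -> (U -> V) -> U -> V;
  la_lin : forall r g, linear g -> linear (la_fun r g);
  laA : forall a b g, linear g -> la_fun a (la_fun b g) = la_fun (a * b) g;
  la1 : forall g, linear g -> la_fun 1 g = g;
  laDl : forall a b g, linear g -> la_fun (a + b) g = la_fun a g + la_fun b g;
  laDr : forall a g g', la_fun a (g + g') = la_fun a g + la_fun a g' }.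

Variable T : lin_action.

Definition linmod : Type := let _ := T in subspace lin_sub.

HB.instance Definition _ := GRing.Zmodule.copy linmod (subspace lin_sub).

Definition linval (g : linmod) : U -> V := val (g : subspace lin_sub).

Lemma linval_inj : injective linval.
Proof. exact: val_inj. Qed.

Lemma linvalP (g : linmod) : linear (linval g).
Proof. exact: (@subspaceP _ _ lin_sub g). Qed.

Definition linel (g : U -> V) (lg : linear g) : linmod := @subel _ _ lin_sub _ lg.

Definition linact (r : R) (g : linmod) : linmod := linel (la_lin T r (linvalP g)).

Fact linactA a b g : linact a (linact b g) = linact (a * b) g.
Proof. by apply: linval_inj; apply: laA; apply: linvalP. Qed.
Fact linact1 : left_id 1 linact.
Proof. by move=> g; apply: linval_inj; apply: la1; apply: linvalP. Qed.
Fact linactDr : right_distributive linact +%R.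
Proof. by move=> r g g'; apply: linval_inj; apply: laDr. Qed.
Fact linactDl g : {morph linact^~ g : a b / a + b}.
Proof. by move=> a b; apply: linval_inj; apply: laDl; apply: linvalP. Qed.

HB.instance Definition _ := GRing.Zmodule_isLmodule.Build R linmod
  linactA linact1 linactDr linactDl.

End LinearMapModules.

Section HomK.
Variables (k : fieldType) (A : algType k) (H : hopfAlgebra k).
Variables (w : weakAction A H) (f : {linear tensor H H -> A}).
Variables (wf : is_crossed_product w f).
Local Notation E := (crossed wf).
Local Notation Hc := ((H : algType k)^c).
Local Notation "a ## h" := (cpure wf a h) (at level 38).

Variables (P : lmodType Hc) (N : lmodType E).
Let bP := @ract_bilin k Hc P.
Let bN := @ract_bilin k E N.

(* The right action [p h]. *)
Definition rmul (h : H) (p : scalars P) : scalars P := ract (h : Hc) p.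

Lemma rmul_bilin : bilin rmul.
Proof. exact: bP. Qed.

Lemma rmulM h l p : rmul h (rmul l p) = rmul (l * h) p.
Proof. exact: ractM. Qed.

(* The map [(e, g) |-> (p |-> e0 g (p e1))] for the coaction [e |-> e0 (x) e1]
   of [H] on [E], given by [a # h |-> (a # h1) (x) h2]. *)
Definition homK_act (e : E) (g : scalars P -> scalars N) : scalars P -> scalars N :=
  fun p => coact (fun x m => ract x (g (rmul m p))) e.

Lemma homK_act_bilin (g : scalars P -> scalars N) p : linear g ->
  bilin (fun (x : E) m => ract x (g (rmul m p))).
Proof. by move=> lg; lin. Qed.

Fact homK_lin e g : linear g -> linear (homK_act e g).
Proof. by move=> lg; apply: Defs.linear_sum => x; lin. Qed.

Fact homKA a b g : linear g -> homK_act a (homK_act b g) = homK_act (a * b) g.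
Proof.
move=> lg; apply/funext => p; rewrite [RHS]coactM; last lin.
apply: eq_bigr => z _; apply: eq_bigr => z' _.
have lr : linear (ract (M := N) (z.1 ## z'.1)) by lin.
rewrite (lin_sum lr); apply: eq_bigr => t _.
rewrite (lin_sum lr); apply: eq_bigr => t' _.
by rewrite ractM rmulM.
Qed.

Fact homK1 g : linear g -> homK_act 1 g = g.
Proof.
move=> lg; apply/funext => p; rewrite /homK_act coact1; last lin.
by rewrite /rmul /ract !scale1r.
Qed.

Fact homKDl a b g : linear g -> homK_act (a + b) g = homK_act a g + homK_act b g.
Proof.
move=> lg; apply/funext => p.
exact: (linD (coact_linear (homK_act_bilin p lg)) a b).
Qed.

Fact homKDr e g g' : homK_act e (g + g') = homK_act e g + homK_act e g'.
Proof.
apply/funext => p; rewrite -[RHS]/(homK_act e g p + homK_act e g' p).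
rewrite /homK_act /coact /tlift -big_split; apply: eq_bigr => x _.
rewrite /swe -big_split; apply: eq_bigr => y _.
by rewrite fctE /ract scalerDr.
Qed.

Definition homK : lmodType E := linmod (LinAction homK_lin homKA homK1 homKDl homKDr).

Lemma homK_scaleE a h (g : homK) p : linval ((a ## h) *: g) p =
  \sw_(h1, h2 <- h) ract (a ## h1) (linval g (rmul h2 p)).
Proof. by apply: coactE; apply: homK_act_bilin; apply: linvalP. Qed.

End HomK.

Section TwoVariables.
Variables (k : fieldType) (A : algType k) (H : hopfAlgebra k).
Variables (w : weakAction A H) (f finv : {linear tensor H H -> A}).
Variables (wf : is_crossed_product w f) (fV : conv_inverse f finv).
Local Notation E := (crossed wf).
Local Notation Hc := ((H : algType k)^c).
Local Notation "a ## h" := (cpure wf a h) (at level 38).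
Local Notation c := (cinv wf finv).
Let bc : bilin (cpure wf) := tpure_bilin A H.
Let lc : linear c := @cinv_linear k A H w f finv wf.

Variables (P : lmodType Hc) (Q N : lmodType E).
Let bQ := @ract_bilin k E Q.
Let bN := @ract_bilin k E N.
Let bR := @rmul_bilin k H P.

Lemma scalars_cpure (V : lmodType E) a (v : scalars V) :
  a *: v = ract ((a%:A : A) ## 1) v.
Proof.
have -> : (a%:A : A) ## 1 = (a%:A : E) by case: bc => bc1 _; apply: (linZ (bc1 1)).
by [].
Qed.

(** Insert $\sum (1 \# h_1) c(h_2) = \epsilon(h)$ in front and recognize the action of [H] on [x p],
    which [x] turns into the action on [p]. *)
Lemma homA_swap (x : P -> homA fV Q N) p q h : linear x ->
  homA_val (x p) (ract (1 ## h) q) =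
  \sw_(h1, h2 <- h) ract (1 ## h1) (homA_val (x (rmul h2 p)) q).
Proof.
move=> lx; have [lg Ag] := homA_valP (x p); set g := homA_val (x p) in lg Ag *.
transitivity (\sw_(h1, r <- h) \sw_(h2, h3 <- r) ract ((1 ## h1) * c h2) (g (ract (1 ## h3) q))).
  rewrite (swe_cancell h (M := fun h1 h2 => (1 ## h1) * c h2) (u := 1)
    (F := fun z h3 => ract z (g (ract (1 ## h3) q)))); try lin.
    by rewrite /ract scale1r.
  by move=> y; apply: cinv_mulr.
apply: swe_ext => h1 r; have -> : x (rmul r p) = (r : Hc) *: x p := linZ lx _ _.
rewrite homA_scaleE.
have lr : linear (ract (M := N) (1 ## h1)) by lin.
rewrite (swe_comp _ _ lr).
by apply: swe_ext => h2 h3; rewrite ractM.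
Qed.

Lemma homA_to_homK (x : P -> homA fV Q N) : linear x ->
  exists2 F : Q -> homK P N, linear F &
    forall p q, linval (F q) p = homA_val (x p) q.
Proof.
move=> lx; have lxk : linear (x : scalars P -> scalars (homA fV Q N)).
  exact: scalars_linear.
have lF q : linear (fun p : scalars P => homA_val (x p) q).
  move=> a p p'; rewrite lxk; exact: (congr1 (fun g => g q) (homA_klinear a (x p) (x p'))).
pose F q : homK P N := linel _ (lF q).
exists F => // e q q'; apply: linval_inj; apply/funext => p.
change (homA_val (x p) (ract e q + q') =
  linval (e *: F q) p + homA_val (x p) q').
have [lg Ag] := homA_valP (x p); rewrite (linD lg); congr (_ + _).
have le q1 : linear (fun e : E => linval (e *: F q1) p).
  exact: (coact_linear (homK_act_bilin p (linvalP (F q1)))).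
apply: (crossed_ext (g := fun e => homA_val (x p) (ract e q))
  (g' := fun e => linval (e *: F q) p)) => //; first lin.
move=> a h; rewrite homK_scaleE cpure_decomp -ractM Ag homA_swap //.
have lr : linear (ract (M := N) (a ## 1)) by lin.
rewrite (swe_comp _ _ lr); apply: swe_ext => h1 h2.
by rewrite ractM -cpure_decomp.
Qed.

(** [E]-linearity of [F], restricted to $A \# 1$, is [A]-linearity in [q]; [H]-linearity in [p]
    follows on inserting $\sum c(h_1)(1 \# h_2) = \epsilon(h)$. *)
Lemma homK_to_homA (F : Q -> homK P N) : linear F ->
  exists2 x : P -> homA fV Q N, linear x &
    forall p q, linval (F q) p = homA_val (x p) q.
Proof.
move=> lF; have lFk : linear (F : scalars Q -> scalars (homK P N)).
  exact: scalars_linear.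
have FE a h q p : linval (F (ract (a ## h) q)) p =
    \sw_(h1, h2 <- h) ract (a ## h1) (linval (F q) (rmul h2 p)).
  by rewrite -homK_scaleE -(linZ lF).
have hA p : homA_set (fun q => linval (F q) p).
  have Aq a q : linval (F (ract (a ## 1) q)) p = ract (a ## 1) (linval (F q) p).
    rewrite FE; have lg := linvalP (F q).
    by rewrite swe_1; [rewrite /rmul {2}/ract scale1r | lin].
  split=> // a q q'; rewrite scalars_cpure (linD lF).
  change (linval (F (ract ((a%:A : A) ## 1) q)) p + linval (F q') p =
    a *: linval (F q) p + linval (F q') p).
  by rewrite Aq scalars_cpure.
pose x p : homA fV Q N := @subel _ _ (homA_sub Q N) _ (hA p).
exists x => // h p p'; apply: homA_inj; apply/funext => q.
change (linval (F q) (rmul h p + p') = homA_val (h *: x p) q + linval (F q) p').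
rewrite (linD (linvalP (F q))); congr (_ + _).
rewrite homA_scaleE; have lg := linvalP (F q).
transitivity (\sw_(h1, r <- h) \sw_(h2, h3 <- r)
   ract (c h1 * (1 ## h2)) (linval (F q) (rmul h3 p))).
  rewrite (swe_cancell h (M := fun h1 h2 => c h1 * (1 ## h2)) (u := 1)
    (F := fun z h3 => ract z (linval (F q) (rmul h3 p)))); try lin.
    by rewrite /ract scale1r.
  by move=> y; apply: cinv_mull.
apply: swe_ext => h1 r; rewrite -[homA_val _ _]/(linval (F (ract (1 ## r) q)) p).
have lr : linear (ract (M := N) (c h1)) by lin.
rewrite FE (swe_comp _ _ lr); apply: swe_ext => h2 h3.
by rewrite ractM.
Qed.

End TwoVariables.

(** For edges whose linearity conditions are already part of the type. *)
Definition submod_full (k : pzRingType) (V : lmodType k) : submod V :=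
  @Submod k V (fun=> True) I (fun _ _ _ _ _ => I).

(** * The spectral sequence with coefficients in the cohomology of Hom_A(Q, N) *)

Section CrossedSpectralSequence.
Variables (k : fieldType) (A : algType k) (H : hopfAlgebra k).
Variables (w : weakAction A H) (f finv : {linear tensor H H -> A}).
Variables (wf : is_crossed_product w f) (fV : conv_inverse f finv).
Local Notation E := (crossed wf).
Local Notation Hc := ((H : algType k)^c).
Local Notation "a ## h" := (cpure wf a h) (at level 38).
Local Notation c := (cinv wf finv).
Local Notation ε := (counit H).
Let bc : bilin (cpure wf) := tpure_bilin A H.

Variables (M N : lmodType E) (P : projResolution (trivial_module H)) (Q : projResolution M).
Let bN := @ract_bilin k E N.

Definition homAQ s : lmodType Hc := homA fV (Q s) N.

Fact homAQ_d_subproof s (g : scalars (Q s) -> scalars N) :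
  homA_set g -> homA_set (g \o pres_d Q s).
Proof.
move=> [lg Ag]; have ld := scalars_linear (linearP (pres_d Q s)).
split=> [a x y|a q] /=; first by rewrite ld lg.
by rewrite -Ag (lin_ract _ _ (linearP (pres_d Q s))).
Qed.

Definition homAQ_d_fun s (g : homAQ s) : homAQ s.+1 :=
  @subel _ _ (homA_sub (Q s.+1) N) _ (homAQ_d_subproof (homA_valP g)).

Lemma homAQ_d_linear s : linear (@homAQ_d_fun s).
Proof.
move=> h x y; apply: homA_inj; apply/funext => q.
change (homA_val (h *: x) (pres_d Q s q) + homA_val y (pres_d Q s q) =
  homA_val (h *: homAQ_d_fun x) q + homA_val y (pres_d Q s q)).
congr (_ + _); rewrite !homA_scaleE; apply: swe_ext => h1 h2.
change (ract (c h1) (homA_val x (ract (1 ## h2) (pres_d Q s q))) =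
  ract (c h1) (homA_val x (pres_d Q s (ract (1 ## h2) q)))).
by rewrite (lin_ract _ _ (linearP (pres_d Q s))).
Qed.

Definition homAQ_d s : {linear homAQ s -> homAQ s.+1} := lin_pack (@homAQ_d_linear s).

Lemma homAQ_dd s x : homAQ_d s.+1 (homAQ_d s x) = 0.
Proof.
apply: homA_inj; apply/funext => q.
change (homA_val x (pres_d Q s (pres_d Q s.+1 q)) = 0).
by rewrite pres_dd (lin0 (homA_valP x).1).
Qed.

Local Notation K := (hom_bicomplex P homAQ_dd).

Definition homAQ_cohom s : lmodType Hc := cohom homAQ_d s.

Lemma hom_homA_exact1 : exact1 K.
Proof.
move=> r s x lx dx; have [F lF FE] := homA_to_homK lx.
have ldk n := scalars_linear (linearP (pres_d P n)).
pose pre (g : homK (P r) N) : homK (P r.+1) N :=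
  linel _ (linear_comp_fun (linvalP g) (ldk r)).
have lpre : linear pre.
  move=> e g g'; apply: linval_inj; apply/funext => p.
  change (linval (e *: g) (pres_d P r p) + linval g' (pres_d P r p) =
    linval (e *: pre g) p + linval g' (pres_d P r p)); congr (_ + _).
  apply: eq_bigr => z _; apply: eq_bigr => z' _; congr ract.
  change (linval g (rmul z'.2 (pres_d P r p)) = linval g (pres_d P r (rmul z'.2 p))).
  by rewrite /rmul (lin_ract _ _ (linearP (pres_d P r))).
(* [c'] is merely [k]-linear. It shows that each [F q] lies in the image of [pre]; projectivity of
   [Q s] then supplies an [E]-linear lift. *)
have [c' lc' cE] := linear_factor (ldk r).
have [|G lG GE] := projective_lift (g := lin_pack lpre) (@pres_proj _ _ Q s) lF.
  move=> q; have lg := linvalP (F q).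
  exists (linel _ (linear_comp_fun lg lc')); apply: linval_inj; apply/funext => p.
  apply: cE => // p' /pres_exact[p'' <-]; rewrite FE.
  have e0 : x (pres_d P r.+1 p'') = 0 by apply: (congr1 (fun g => g p'') dx).
  by rewrite e0.
have [y ly yE] := homK_to_homA fV lG.
exists y => //; apply/funext => p; apply: homA_inj; apply/funext => q.
transitivity (homA_val (y (pres_d P r p)) q) => //.
rewrite -yE -FE -GE //.
Qed.

Definition linE_sub t : submod (Q t -> scalars N) :=
  @Submod k (Q t -> scalars N) (fun g => linear (g : Q t -> N))
    (@linear_zero_fct k E N (Q t)) (@ext_linear_subproof k E N (Q t)).

Fact linE_pre_linear t :
  linear (fun g : Q t -> scalars N => (g \o pres_d Q t : Q t.+1 -> scalars N)).
Proof. by []. Qed.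

Fact linE_pre_sub t (g : Q t -> scalars N) :
  linE_sub t g -> linE_sub t.+1 (g \o pres_d Q t).
Proof. by move=> lg a x y /=; rewrite linearP lg. Qed.

Definition linE_d t : {linear subspace (linE_sub t) -> subspace (linE_sub t.+1)} :=
  submap (g := lin_pack (@linE_pre_linear t)) (@linE_pre_sub t).

Definition augk (p : P 0%N) : k := pres_aug P p.

Lemma augk_linear (h : Hc) p p' : augk (h *: p + p') = (ε h : k) * augk p + augk p'.
Proof. exact: linearP. Qed.

Lemma augk_d p : augk (pres_d P 0 p) = 0.
Proof.
have : pres_aug P (pres_d P 0 p) = 0 by apply/pres_exact0; exists p.
by [].
Qed.

Lemma augk_ker p : augk p = 0 -> exists p', pres_d P 0 p' = p.
Proof. by move=> e; have : pres_aug P p = 0 := e; move/pres_exact0. Qed.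

Lemma augk_one : exists p, augk p = 1.
Proof. exact: (pres_surj P (1 : k)). Qed.

Fact linE_homA t (g : Q t -> scalars N) a : linE_sub t g ->
  homA_set (a *: (g : scalars (Q t) -> scalars N)).
Proof.
move=> lg; rewrite -[_ *: _]addr0; apply: homAP; last exact: homA0.
split=> [|b q]; first exact: scalars_linear.
exact: (lin_ract _ _ lg).
Qed.

(** [E]-linear maps are the invariants Hom_H(k, Hom_A(Q_t, N)); the augmentation of [P] turns them
    into maps on [P 0]. *)
Definition linE_inj_fun t (g : subspace (linE_sub t)) : K 0%N t := fun p =>
  @subel _ _ (homA_sub (Q t) N) _ (linE_homA (augk p) (subspaceP g)) : homAQ t.

Fact linE_inj_linear t : linear (@linE_inj_fun t).
Proof.
move=> a g g'; apply/funext => p; apply: homA_inj.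
transitivity (augk p *: (a *: val g + val g')) => //.
rewrite -[RHS]/(homA_val (a *: (linE_inj_fun g p : scalars (homAQ t)) +
  (linE_inj_fun g' p : scalars (homAQ t)))) homA_klinear.
by rewrite scalerDr scale_comm.
Qed.

Definition linE_inj t : {linear subspace (linE_sub t) -> K 0%N t} :=
  lin_pack (@linE_inj_linear t).

Lemma linE_injE t (g : subspace (linE_sub t)) p q :
  homA_val ((linE_inj t g : P 0%N -> homAQ t) p) q = augk p *: val g q.
Proof. by []. Qed.

Fact linE_inj_sub t (g : subspace (linE_sub t)) : bi_sub K (linE_inj t g).
Proof.
move=> h p p'; apply: homA_inj; apply/funext => q.
change (augk (h *: p + p') *: val g q =
  homA_val ((h : Hc) *: (linE_inj t g : P 0%N -> homAQ t) p) q + augk p' *: val g q).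
rewrite augk_linear scalerDl; congr (_ + _).
rewrite homA_scaleE -[LHS]/(((ε h : k) * augk p) *: val g q).
transitivity (\sw_(h1, h2 <- (h : H)) ract (c h1 * (1 ## h2)) (augk p *: val g q)).
  rewrite -(swe_comp (g := fun z : E => ract z (augk p *: val g q))); last lin.
  by rewrite cinv_mull // -scalerA; case: bN => bN1 _; rewrite (linZ (bN1 _)) /ract scale1r.
apply: swe_ext => h1 h2; rewrite -ractM; congr ract.
rewrite linE_injE (lin_ract _ _ (subspaceP g)).
by case: bN => _ bN2; rewrite (linZ (bN2 _)).
Qed.

Fact linE_inj_d1 t (g : subspace (linE_sub t)) : bi_d1 K (linE_inj t g) = 0.
Proof.
apply/funext => p; apply: homA_inj; apply/funext => q.
by rewrite (linE_injE g (pres_d P 0 p)) augk_d scale0r.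
Qed.

(** A map killed by [d1] factors through the augmentation, so it is [augk p] times its value [g] at
    [p0]. As $p_0 h$ has augmentation $\epsilon(h)$, [homA_swap] at [p0] reads $g((1 \# h) q) = (1
    \# h) g(q)$, hence [g] is [E]-linear. *)
Fact linE_inj_ker t (x : K 0%N t) : bi_sub K x -> bi_d1 K x = 0 ->
  exists2 g, submod_full (subspace (linE_sub t)) g & linE_inj t g = x.
Proof.
move=> lx dx; have [p0 p01] := augk_one.
have xE p : x p = (augk p : k) *: (x p0 : scalars (homAQ t)).
  have lxk : linear (x : scalars (P 0%N) -> scalars (homAQ t)).
    exact: scalars_linear.
  apply/eqP; rewrite -subr_eq0 -(linZ lxk) -(linB lxk); apply/eqP.
  have e0 : augk (p - (augk p *: (p0 : scalars (P 0%N)) : P 0%N)) = 0.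
    have la : linear (augk : scalars (P 0%N) -> k^o).
      move=> a u v; rewrite (augk_linear a%:A u v); congr (_ + _).
      exact: (congr1 (fun z => z * augk u) (counit_scalar H a)).
    by rewrite (linB la) (linZ la) p01 [_ *: _]mulr1 subrr.
  have [p' <-] := augk_ker e0.
  exact: (congr1 (fun g => g p') dx).
have lg : linE_sub t (homA_val (x p0 : homA fV (Q t) N)).
  have [lg Ag] := homA_valP (x p0 : homA fV (Q t) N).
  set g := homA_val (x p0 : homA fV (Q t) N) in lg Ag *.
  move=> e q q'; rewrite (linD lg); congr (_ + _).
  have lge : linear (fun e : E => g (ract e q)) by have bQ := @ract_bilin k E (Q t); lin.
  have lre : linear (fun e : E => ract e (g q)) by lin.
  apply: (crossed_ext lge lre) => a h.
  rewrite cpure_decomp -!ractM Ag; congr ract.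
  apply: etrans (homA_swap (x := x : P 0%N -> homA fV (Q t) N) p0 q h lx) _.
  rewrite -[RHS](swe_counitr h (g := fun h => ract (1 ## h) (g q))); last lin.
  apply: swe_ext => h1 h2; rewrite xE.
  have -> : augk (rmul h2 p0) = ε h2.
    have a0 : augk 0 = 0 by apply: linear0.
    by have := augk_linear (h2 : Hc) p0 0; rewrite addr0 a0 addr0 p01 mulr1.
  rewrite homA_kscale; case: bN => _ bN2; exact: (linZ (bN2 _)).
exists (@subel _ _ (linE_sub t) _ lg) => //.
apply/funext => p; apply: homA_inj; apply/funext => q.
transitivity (augk p *: homA_val (x p0 : homA fV (Q t) N) q) => //.
have -> : x p = augk p *: (x p0 : scalars (homAQ t)) := xE p.
by rewrite homA_kscale.
Qed.

Fact linE_inj0 t (g : subspace (linE_sub t)) : linE_inj t g = 0 -> g = 0.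
Proof.
move=> e; apply: val_inj; apply/funext => q; have [p0 p01] := augk_one.
have : homA_val ((linE_inj t g : P 0%N -> homAQ t) p0) q = 0 by rewrite e.
by rewrite linE_injE p01 scale1r.
Qed.

Fact linE_inj_d2 t (g : subspace (linE_sub t)) :
  bi_d2 K (linE_inj t g) = linE_inj t.+1 (linE_d t g).
Proof.
rewrite -[LHS]/(1 *: hom_post homAQ_d (linE_inj t g)) scale1r.
by apply/funext => p; apply: homA_inj; apply/funext => q.
Qed.

Definition linE_edge : edge K := @Edge k K (fun t => subspace (linE_sub t))
  (fun t => submod_full _) linE_d linE_inj (fun _ _ _ => I)
  (fun t g _ => linE_inj_sub g) (fun t g _ => linE_inj_d1 g) linE_inj_ker
  (fun t g _ => @linE_inj0 t g) (fun t g _ => linE_inj_d2 g).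

Lemma tot_Ext n : kiso (subquot (cyc (tot K) (tdeg K) n) (bdr (tot K) (tdeg K) n))
  (Ext N Q n).
Proof.
pose R (x : biprod K) (g : Q n -> scalars N) :=
  exists2 b : linE_edge n, val (b : subspace (linE_sub n)) = g & erel b x.
have cocE (b : linE_edge n) : ecoc b <->
    ext_cocycle (val (b : subspace (linE_sub n)) : Q n -> scalars N).
  split=> [[_ db]|[lb db]]; split=> //.
  - exact: (subspaceP (b : subspace (linE_sub n))).
  - by move=> q; apply: (congr1 (fun g : subspace (linE_sub n.+1) => val g q) db).
  by apply: val_inj; apply/funext => q; apply: db.
have cobE (b : linE_edge n) : ecob b <->
    ext_coboundary (val (b : subspace (linE_sub n)) : Q n -> scalars N).
  case: n b {R cocE} => [|n] b; split=> [].
  - by move=> e; rewrite [b]e.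
  - by move=> e; apply: val_inj.
  - by case=> b' _ ->; exists (val (b' : subspace (linE_sub n))) => //; exact: (subspaceP (b' : subspace (linE_sub n))).
  by case=> g lg e; exists (@subel _ _ (linE_sub n) _ lg) => //; apply: val_inj.
apply: (subquot_kiso (R := R)) => [|x [Cx Dx]|g cg|x g [Cx Dx] cg [b bg r]].
- move=> a x x' g g' [b <- r] [b' <- r']; exists (a *: b + b') => //.
  exact: erel_linear.
- have [b cb r] := edge_surj linE_edge hom_homA_exact1 Cx Dx.
  exists (val (b : subspace (linE_sub n))); last by exists b.
  exact/cocE.
- have [lg dg] := cg; pose b : linE_edge n := @subel _ _ (linE_sub n) _ lg.
  have cb : ecoc b by apply/cocE.
  have [x [Cx Dx] r] := edge_tot cb.
  by exists x => //; exists b.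
have cb : ecoc b by apply/cocE; rewrite bg.
rewrite -bg; apply: (iff_trans (iff_sym (edge_ker hom_homA_exact1 cb Cx r))).
exact: cobE.
Qed.

Lemma crossed_ss : exists ss : spectralSequence k,
  (forall r s, kiso (page ss 2 r s) (Ext (homAQ_cohom s) P r)) /\
  converges ss (Ext N Q).
Proof.
exists (hom_ss P homAQ_dd); split=> [r s|]; first exact: hom_page2.
apply: filtered_converges_kiso; last exact: tot_Ext.
by move=> x s t.
Qed.

End CrossedSpectralSequence.

(** * Hochschild cochains *)

Section AlternatingSum.
Variables (k : pzRingType) (V : lmodType k).

(** The terms with $i < j$ cancel those with $j \le i$: the hypothesis matches $(j, i)$ with $(i, j
    - 1)$, and the sign exponents differ by one. *)
Lemma cosimplicial_sum0 n (F : nat -> nat -> V) :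
  (forall i j, (i < j)%N -> (j < n.+1)%N -> F j i = F i j.-1) ->
  \sum_(j < n.+1) \sum_(i < n) (-1) ^+ (i + j) *: F j i = 0.
Proof.
move=> FE.
pose T1 := \sum_(j < n.+1) \sum_(i < n | (i < j)%N) (-1) ^+ (i + j) *: F j i.
pose T2 := \sum_(j < n.+1) \sum_(i < n | (j <= i)%N) (-1) ^+ (i + j) *: F j i.
transitivity (T1 + T2).
  rewrite -big_split; apply: eq_bigr => j _ /=.
  rewrite (bigID (fun i : 'I_n => (i < j)%N)); congr (_ + _).
  by apply: eq_bigl => i; rewrite -leqNgt.
have -> : T2 = \sum_(j < n) \sum_(i < n | (i <= j)%N) (-1) ^+ (i + j) *: F i j.
  rewrite /T2 big_ord_recr /= [X in _ + X]big1 ?addr0 => [|i]; last first.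
    by rewrite leqNgt ltn_ord.
  under eq_bigr do rewrite big_mkcond.
  rewrite exchange_big /=; apply: eq_bigr => j _; rewrite -big_mkcond /=.
  by apply: eq_bigr => i _; rewrite addnC.
rewrite /T1 big_ord_recl /= [X in X + _ + _]big1 // add0r -big_split.
apply: big1 => j _ /=; rewrite -big_split; apply: big1 => i ij /=.
rewrite /bump leq0n FE // add1n ?ltnS //= addnS exprS mulN1r scaleNr addNr //.
Qed.

End AlternatingSum.

Section Sequences.
Variables (k : fieldType) (A : algType k).
Implicit Type a : nat -> A.

Definition nsub (T : Type) (a : nat -> T) i x j := if j == i then x else a j.
Definition nshift (T : Type) (a : nat -> T) j := a j.+1.
Definition nmerge a i j :=
  if (j < i)%N then a j else if j == i then a i * a i.+1 else a j.+1.

Lemma nmerge_shift a i : nshift (nmerge a i.+1) = nmerge (nshift a) i.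
Proof. by apply/funext => j; rewrite /nshift /nmerge ltnS eqSS. Qed.

Lemma nmerge_merge a i j : (i < j)%N ->
  nmerge (nmerge a j) i = nmerge (nmerge a i) j.-1.
Proof.
move=> ij; apply/funext => m; rewrite /nmerge.
repeat case: ifP => ?; try (exfalso; lia); rewrite ?mulrA //; try (congr (a _); lia).
all: try (congr (_ * _); try congr (_ * _); congr (a _); lia).
Qed.

Lemma nsub_same (T : Type) (a : nat -> T) i x : nsub a i x i = x.
Proof. by rewrite /nsub eqxx. Qed.

Lemma nsub_id (T : Type) (a : nat -> T) i : nsub a i (a i) = a.
Proof. by apply/funext => j; rewrite /nsub; case: eqP => // ->. Qed.

Lemma nmerge_nsub a i j x : nmerge (nsub a i x) j =
  if (i < j)%N then nsub (nmerge a j) i x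
  else if i == j then nsub (nmerge a j) j (x * a j.+1)
  else if i == j.+1 then nsub (nmerge a j) j (a j * x)
  else nsub (nmerge a j) i.-1 x.
Proof.
repeat case: ifP => ?; apply/funext => m; rewrite /nmerge /nsub.
all: repeat case: ifP => ?; try (exfalso; lia); try done; try (congr (a _); lia).
all: try (congr (_ * _); try congr (a _); lia).
Qed.

End Sequences.

(** Restrictions of [E]-modules and [A]-modules proper both give such a structure, so the Hochschild
    complexes below serve for both. *)
Record amod (k : fieldType) (A : algType k) := Amod {
  am_mod :> lmodType k;
  am_act : A -> am_mod -> am_mod;
  am_bilin : bilin am_act;
  am_actM : forall a b u, am_act a (am_act b u) = am_act (a * b) u;
  am_act1 : forall u, am_act 1 u = u }.

Arguments am_act {k A}.

Section Cochains.
Variables (k : fieldType) (A : algType k).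
Implicit Types (U N : amod A) (a b : nat -> A).

Lemma am_scalar U c (u : U) : am_act U c%:A u = c *: u.
Proof. by case: (am_bilin U) => bU _; rewrite (linZ (bU u)) am_act1. Qed.

Lemma am_linr U x : linear (am_act U x).
Proof. by case: (am_bilin U). Qed.

Lemma am_linl U u : linear (fun x => am_act U x u).
Proof. by case: (am_bilin U). Qed.

(** Sequences indexed by [nat] instead of ['I_s] keep the type independent of $s$, so that shifting
    and merging arguments is plain reindexing. *)
Definition nc U N : lmodType k := (nat -> A) -> U -> N.

(* Cochains of degree [s] are functions of a sequence which depend only on its
   first [s] entries. *)
Record multi U N s (x : nc U N) : Prop := Multi {
  multi_lin : forall a, linear (x a);
  multi_sub : forall a i u, (i < s)%N -> linear (fun y => x (nsub a i y) u);
  multi_dep : forall a b, (forall j, (j < s)%N -> a j = b j) -> x a = x b }.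

Definition normal U N s (x : nc U N) := forall a i c, (i < s)%N -> a i = c%:A -> x a = 0.

Definition face U N s i (x : nc U N) : nc U N := fun a u =>
  if i is i'.+1 then if (i' < s)%N then x (nmerge a i') u else x a (am_act U (a s) u)
  else am_act N (a 0%N) (x (nshift a) u).

Lemma face_linear U N s i : linear (@face U N s i).
Proof.
move=> c x y; apply/funext => a; apply/funext => u; rewrite /face.
by case: i => [|i]; [rewrite !fctE; apply: am_linr | rewrite !fctE; case: ifP].
Qed.

Lemma multi_upd U N s (x : nc U N) a i y : multi s x -> (s <= i)%N -> x (nsub a i y) = x a.
Proof.
move=> mx si; apply: (multi_dep mx) => j js; rewrite /nsub; case: eqP => // ji.
by move: js; rewrite ji ltnNge si.
Qed.

Lemma face_face U N s (x : nc U N) i j : multi s x -> (i < j)%N -> (j < s.+3)%N ->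
  face s.+1 j (face s i x) = face s.+1 i (face s j.-1 x).
Proof.
move=> mx ij js; apply/funext => a; apply/funext => u; rewrite /face.
case: j ij js => // j ij js; case: i ij => [|i] ij /=.
  case: j ij js => [|j] ij js /=.
    rewrite {1}/nmerge /= am_actM; congr am_act.
  rewrite !ltnS in js *; case: ifP => jlt; last by [].
  by rewrite nmerge_shift /nmerge.
rewrite !ltnS in ij js; rewrite (_ : (i < s.+1)%N = true); last by lia.
case: (ltnP j s.+1) => jlt.
  rewrite (_ : (i < s)%N = true); last by lia.
  case: j ij js jlt => // j ij js jlt; rewrite /= (_ : (j < s)%N = true); last by lia.
  by rewrite nmerge_merge.
have -> : j = s.+1 by lia.
rewrite /= ltnn; case: (ltnP i s) => ilt.
  by rewrite [in RHS]/nmerge ifN ?ifN //; lia.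
have -> : i = s by lia.
rewrite am_actM; have -> : x (nmerge a s) = x a.
  by apply: (multi_dep mx) => m ms; rewrite /nmerge ms.
by rewrite {1}/nmerge ltnn eqxx.
Qed.

Lemma face_multi U N s i (x : nc U N) : multi s x -> multi s.+1 (face s i x).
Proof.
move=> mx; have lx := multi_lin mx; split.
- move=> a; rewrite /face; case: i => [|i].
    exact: linear_comp_fun (am_linr _) (lx _).
  case: (i < s)%N; first exact: lx.
  exact: linear_comp_fun (lx _) (am_linr _).
- move=> a m u ms; rewrite /face; case: i => [|i].
    case: m ms => [|m] ms; first exact: (am_linl (x (nshift a) u)).
    apply: (@linear_comp_fun _ _ _ _ (am_act N (a 0%N)) (fun y => x (nsub (nshift a) m y) u)).
      exact: am_linr.
    exact: (multi_sub mx).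
  have [il|il] := ltnP i s.
    have [mi|mi] := ltnP m i.
      have -> : (fun y => x (nmerge (nsub a m y) i) u) =
          (fun y => x (nsub (nmerge a i) m y) u).
        by apply/funext => y; rewrite nmerge_nsub mi.
      by apply: (multi_sub mx); lia.
    have [me|me] := eqVneq m i.
      have -> : (fun y => x (nmerge (nsub a m y) i) u) =
          (fun y => x (nsub (nmerge a i) i (y * a i.+1)) u).
        by apply/funext => y; rewrite nmerge_nsub me ltnn eqxx.
      exact: linear_comp_fun (multi_sub mx _ _ il) (linear_mull _ (@linear_id _ _)).
    have [me'|me'] := eqVneq m i.+1.
      have -> : (fun y => x (nmerge (nsub a m y) i) u) =
          (fun y => x (nsub (nmerge a i) i (a i * y)) u).
        have [e1 e2] : (i.+1 < i)%N = false /\ (i.+1 == i) = false by lia.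
        by apply/funext => y; rewrite nmerge_nsub me' e1 e2 eqxx.
      exact: linear_comp_fun (multi_sub mx _ _ il) (linear_mulr _ (@linear_id _ _)).
    have -> : (fun y => x (nmerge (nsub a m y) i) u) =
        (fun y => x (nsub (nmerge a i) m.-1 y) u).
      have e1 : (m < i)%N = false by lia.
      by apply/funext => y; rewrite nmerge_nsub e1 (negPf me) (negPf me').
    by apply: (multi_sub mx); lia.
  have [me|me] := eqVneq m s.
    have -> : (fun y => x (nsub a m y) (am_act U (nsub a m y s) u)) =
        (fun y => x a (am_act U y u)).
      by apply/funext => y; rewrite me nsub_same (multi_upd _ _ mx).
    exact: linear_comp_fun (lx _) (am_linl _).
  have -> : (fun y => x (nsub a m y) (am_act U (nsub a m y s) u)) =
      (fun y => x (nsub a m y) (am_act U (a s) u)).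
    by apply/funext => y; rewrite {2}/nsub eq_sym (negPf me).
  by apply: (multi_sub mx); lia.
move=> a b ab; rewrite /face; case: i => [|i]; apply/funext => u.
  by rewrite ab // (multi_dep mx (b := nshift b)) // => j js; apply: ab.
case: ifP => il; last first.
  by rewrite ab // (multi_dep mx (b := b)) // => j js; apply: ab; lia.
rewrite (multi_dep mx (b := nmerge b i)) // => j js; rewrite /nmerge.
by rewrite !ab //; lia.
Qed.

Definition hoch U N s (x : nc U N) : nc U N := \sum_(i < s.+2) (-1) ^+ i *: face s i x.

Lemma hoch_linear U N s : linear (@hoch U N s).
Proof.
apply: Defs.linear_sum => i; exact: linear_scaler (@face_linear U N s i).
Qed.

Lemma hoch_hoch U N s (x : nc U N) : multi s x -> hoch s.+1 (hoch s x) = 0.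
Proof.
move=> mx; rewrite -[RHS](@cosimplicial_sum0 k (nc U N) s.+2
   (fun j i => face s.+1 j (face s i x))); last first.
  by move=> i j ij js; rewrite face_face.
apply: eq_bigr => j _; rewrite (lin_sum (@face_linear U N s.+1 j)) scaler_sumr.
apply: eq_bigr => i _; rewrite (linZ (@face_linear U N s.+1 j)) scalerA -exprD.
by rewrite addnC.
Qed.

Fact multi0 U N s : multi s (0 : nc U N).
Proof. by split=> // [a|a i u _] c y z; rewrite scaler0 addr0. Qed.

Fact multiP U N s c (x y : nc U N) : multi s x -> multi s y -> multi s (c *: x + y).
Proof.
move=> mx my; split=> [a|a i u js|a b ab].
- exact: linear_fct (multi_lin mx a) (multi_lin my a).
- exact: (linear_fct (g := fun z => x (nsub a i z) u) (h := fun z => y (nsub a i z) u)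
    c (multi_sub mx a u js) (multi_sub my a u js)).
- change (c *: x a + y a = c *: x b + y b).
  by rewrite (multi_dep mx ab) (multi_dep my ab).
Qed.

Definition good_set U N s (x : nc U N) := multi s x /\ normal s x.

Fact good0 U N s : good_set s (0 : nc U N).
Proof. by split; [apply: multi0|]. Qed.

Fact goodP U N s c (x y : nc U N) : good_set s x -> good_set s y -> good_set s (c *: x + y).
Proof.
move=> [mx nx] [my ny]; split; first exact: multiP.
move=> a i d js ai; change (c *: x a + y a = 0).
by rewrite (nx a i d) // (ny a i d) // scaler0 addr0.
Qed.

Definition good U N s : submod (nc U N) := Submod (@good0 U N s) (@goodP U N s).

Lemma good_scalar U N s (x : nc U N) a i c u : multi s x -> (i < s)%N ->
  x (nsub a i (c *: a i)) u = c *: x a u.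
Proof.
by move=> mx js; rewrite (linZ (multi_sub mx a u js)) nsub_id.
Qed.

(** If $a_i$ is a scalar $c$, every face but $i$ and $i + 1$ still has a scalar argument and
    vanishes. These two both give $c$ times the value at [b], the sequence without $a_i$, with
    opposite signs. *)
Lemma hoch_good U N s (x : nc U N) : good U N s x -> good U N s.+1 (hoch s x).
Proof.
move=> [mx nx]; split.
  rewrite /hoch; elim/big_ind: _ => [|y z my mz|i _]; first exact: multi0.
    by rewrite -[y]scale1r; apply: multiP.
  by rewrite -[_ *: _]addr0; apply: multiP; [apply: face_multi | apply: multi0].
move=> a i c js ai; apply/funext => u.
pose b j := if (j < i)%N then a j else a j.+1.
rewrite /hoch fct_sumE fct_sumE.
have i1 : (i < s.+2)%N by lia.
have i2 : (i.+1 < s.+2)%N by lia.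
rewrite (bigD1 (Ordinal i1)) //= (bigD1 (Ordinal i2)) /=; last by rewrite -val_eqE /= gtn_eqF.
rewrite big1 ?addr0; last first.
  move=> [j jlt] /=; rewrite -!val_eqE /= => /andP[ji ji1].
  change ((-1) ^+ j *: face s j x a u = 0).
  suff -> : face s j x a u = 0 by rewrite scaler0.
  have N0 d e : (e < s)%N -> d e = c%:A -> forall v, x d v = 0.
    by move=> es de v; rewrite (nx d e c).
  rewrite /face; case: j jlt ji ji1 => [|j] jlt ji ji1.
    rewrite (N0 _ i.-1) ?(lin0 (am_linr _)) //; first by lia.
    by rewrite /nshift prednK //; lia.
  have [jl|jl] := ltnP j s; last by apply: (N0 _ i) => //; lia.
  have [ij|ij] := ltnP i j; first by apply: (N0 _ i); [lia | rewrite /nmerge ij].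
  apply: (N0 _ i.-1); first by lia.
  rewrite /nmerge ifN ?ifN //; [|lia|lia].
  by rewrite prednK //; lia.
change ((-1) ^+ i *: face s i x a u + (-1) ^+ i.+1 *: face s i.+1 x a u = 0).
have -> : face s i x a u = c *: x b u.
  rewrite /face; case: i js ai @b {i1 i2} => [|i] js ai b.
    by rewrite ai am_scalar.
  rewrite (_ : (i < s)%N = true) // -(good_scalar b _ u mx (_ : (i < s)%N)) //.
  congr (x _ u); apply/funext => j; rewrite /nsub /nmerge /b.
  have [->|ji] := eqVneq j i; first by rewrite ltnn ltnS leqnn ai mulr_algr.
  have [jl|jl] := ltnP j i; first by rewrite ltnS ltnW.
  by rewrite ifN //; lia.
have -> : face s i.+1 x a u = c *: x b u.
  rewrite /face; have [il|il] := ltnP i s.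
    rewrite -(good_scalar b _ u mx il); congr (x _ u); apply/funext => j.
    rewrite /nsub /nmerge /b.
    have [->|ji] := eqVneq j i; first by rewrite ltnn ai mulr_algl.
    by [].
  have e : i = s by lia.
  rewrite e in ai; rewrite ai am_scalar (linZ (multi_lin mx a)); congr (c *: _).
  rewrite (multi_dep mx (b := b)) // => j jl.
  by rewrite /b e jl.
by rewrite exprS mulN1r scaleNr subrr.
Qed.

End Cochains.

(** An [A]-linear splitting of $A \otimes U \to U$, that is, projectivity relative to [k]. Both
    properties are tested on arbitrary maps, so [tensor A U] carries no module structure over
    [A]. *)
Record amod_section (k : fieldType) (A : algType k) (U : amod A) := AmodSection {
  sect :> U -> tensor A U;
  sect_linear : linear sect;
  sect_act : forall (W : lmodType k) (F : A -> U -> W) a u, bilin F ->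
    tlift F (sect (am_act U a u)) = tlift (fun b v => F (a * b) v) (sect u);
  sectK : forall (W : lmodType k) (g : U -> W) u, linear g ->
    tlift (fun b v => g (am_act U b v)) (sect u) = g u }.

(** * The Hochschild double complex over a resolution *)

Section HochschildBicomplex.
Variables (k : fieldType) (A : algType k) (M N : amod A) (U : nat -> amod A).
Variables (dU : forall t, U t.+1 -> U t) (aug : U 0%N -> M).
Hypotheses (dU_lin : forall t, linear (@dU t)) (aug_lin : linear aug).
Hypothesis dU_act : forall t a u, dU (am_act (U t.+1) a u) = am_act (U t) a (dU u).
Hypothesis aug_act : forall a u, aug (am_act (U 0%N) a u) = am_act M a (aug u).
Hypothesis aug_surj : forall m, exists u, aug u = m.
Hypothesis aug_exact : forall u, aug u = 0 <-> exists v, dU v = u.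
Hypothesis dU_exact : forall t (u : U t.+1), dU u = 0 <-> exists v, dU v = u.
Variable sg : forall t, amod_section (U t).

Definition nc_pre t (x : nc (U t) N) : nc (U t.+1) N := fun a u => x a (dU u).

Fact nc_pre_linear t : linear (@nc_pre t).
Proof. by []. Qed.

Fact nc_pre_good s t (x : nc (U t) N) : good _ _ s x -> good _ _ s (nc_pre x).
Proof.
move=> [mx nx]; split; first split.
- move=> a; exact: linear_comp_fun (multi_lin mx a) (@dU_lin t).
- by move=> a i u js; apply: (multi_sub mx).
- by move=> a b ab; apply/funext => u; rewrite /nc_pre (multi_dep mx ab).
move=> a i c js ai; apply/funext => u.
by rewrite /nc_pre (nx a i c).
Qed.

Lemma face_pre s i t (x : nc (U t) N) : face s i (nc_pre x) = nc_pre (face s i x).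
Proof.
apply/funext => a; apply/funext => u; rewrite /face /nc_pre.
by case: i => [|i] //; case: ifP => // _; rewrite dU_act.
Qed.

Lemma hoch_pre s t (x : nc (U t) N) : hoch s (nc_pre x) = nc_pre (hoch s x).
Proof.
rewrite /hoch (lin_sum (@nc_pre_linear t)); apply: eq_bigr => i _.
by rewrite face_pre (linZ (@nc_pre_linear t)).
Qed.

Definition nc_d2 s t (x : nc (U t) N) : nc (U t.+1) N := (-1) ^+ s *: nc_pre x.

Fact nc_d2_linear s t : linear (@nc_d2 s t).
Proof. exact: linear_scaler (@nc_pre_linear t). Qed.

Fact nc_d2_good s t (x : nc (U t) N) : good _ _ s x -> good _ _ s (nc_d2 s x).
Proof. by move=> gx; apply: submod_scale; apply: nc_pre_good. Qed.

Fact nc_d11 s t (x : nc (U t) N) : good _ _ s x -> hoch s.+1 (hoch s x) = 0.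
Proof. by case=> mx _; apply: hoch_hoch. Qed.

Fact nc_d22 s t (x : nc (U t) N) : good _ _ s x -> nc_d2 s (nc_d2 s x) = 0.
Proof.
case=> mx _; rewrite /nc_d2 (linZ (@nc_pre_linear t.+1)).
have -> : nc_pre (nc_pre x) = 0; last by rewrite !scaler0.
apply/funext => a; apply/funext => u; rewrite /nc_pre.
have -> : dU (dU u) = 0 by apply/dU_exact; exists u.
exact: lin0 (multi_lin mx a).
Qed.

Fact nc_d12 s t (x : nc (U t) N) : good _ _ s x ->
  hoch s (nc_d2 s x) + nc_d2 s.+1 (hoch s x) = 0.
Proof.
move=> _; rewrite /nc_d2 (linZ (@hoch_linear k A (U t.+1) N s)) hoch_pre.
by rewrite exprS mulN1r scaleNr subrr.
Qed.

Definition hoch_bicomplex : bicomplex k := @Bicomplex k (fun s t => nc (U t) N)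
  (fun s t => good (U t) N s) (fun s t => lin_pack (@hoch_linear k A (U t) N s))
  (fun s t => lin_pack (@nc_d2_linear s t))
  (fun s t => @hoch_good k A (U t) N s) nc_d2_good nc_d11 nc_d22 nc_d12.

Local Notation X := hoch_bicomplex.

(* The contracting homotopy puts the algebra component of [sg u] in the last slot. *)
Definition hoch_htpy s t (x : nc (U t) N) : nc (U t) N := fun a u =>
  tlift (fun b v => x (nsub a s b) v) (sg t u).

Lemma htpy_bilin s t (x : nc (U t) N) a : multi s.+1 x -> bilin (fun b v => x (nsub a s b) v).
Proof. by move=> mx; split=> [v|b]; [apply: (multi_sub mx) | apply: (multi_lin mx)]. Qed.

Fact htpy_good s t (x : nc (U t) N) : good _ _ s.+1 x -> good _ _ s (hoch_htpy s x).
Proof.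
move=> [mx nx]; split; first split.
- move=> a; apply: linear_comp_fun (sect_linear _).
  by apply: tlift_linear; apply: htpy_bilin.
- move=> a i u js; apply: Defs.linear_sum => p.
  have e y : nsub (nsub a i y) s p.1 = nsub (nsub a s p.1) i y.
    apply/funext => j; rewrite /nsub; case: eqP => [->|//].
    by rewrite gtn_eqF.
  have -> : (fun y => x (nsub (nsub a i y) s p.1) p.2) =
     (fun y => x (nsub (nsub a s p.1) i y) p.2) by apply/funext => y; rewrite e.
  by apply: (multi_sub mx); apply: ltnW.
- move=> a b ab; apply/funext => u; apply: eq_bigr => p _.
  rewrite (multi_dep mx (b := nsub b s p.1)) // => j; rewrite ltnS leq_eqVlt /nsub.
  by case: eqP => //= _; apply: ab.
move=> a i c js ai; apply/funext => u; apply: big1 => p _.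
by rewrite (nx _ i c) //; [apply: ltnW | rewrite /nsub ltn_eqF].
Qed.

(** Put the [A]-component of [sg u] in the last argument of [hoch s.+1 x = 0]. The last face becomes
    [x] by [sectK]; the others are the faces of the homotopy, where the one that merges $a_s$ with
    the new argument is handled by [sect_act]. *)
Lemma htpy_hoch s t (x : nc (U t) N) : good _ _ s.+1 x -> hoch s.+1 x = 0 ->
  hoch s (hoch_htpy s x) = (-1) ^+ s.+1 *: x.
Proof.
move=> [mx nx] dx; apply/funext => a; apply/funext => u.
have ba a' := htpy_bilin a' mx.
pose T i := tlift (fun b v => face s.+1 i x (nsub a s.+1 b) v) (sg t u).
have T0 : \sum_(i < s.+3) (-1) ^+ i *: T i = 0.
  transitivity (\sum_(p <- trepr (sg t u)) hoch s.+1 x (nsub a s.+1 p.1) p.2); last first.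
    by apply: big1 => p _; rewrite dx.
  under eq_bigr do rewrite scaler_sumr.
  rewrite exchange_big; apply: eq_bigr => p _ /=.
  by rewrite /hoch !fct_sumE.
have T1 i : (i < s.+2)%N -> T i = face s i (hoch_htpy s x) a u.
  move=> il; rewrite /T /face; case: i il => [|i] il.
    by rewrite /hoch_htpy /tlift (lin_sum (@am_linr _ _ N (a 0%N))).
  have [is1|is1] := ltnP i s.
    rewrite (_ : (i < s.+1)%N = true); last by lia.
    apply: eq_bigr => p _; rewrite nmerge_nsub.
    have [e1 e2] : (s.+1 < i)%N = false /\ (s.+1 == i) = false by lia.
    have e3 : (s.+1 == i.+1) = false by lia.
    by rewrite e1 e2 e3.
  have -> : i = s by lia.
  rewrite ltnS leqnn /hoch_htpy sect_act //; apply: eq_bigr => p _.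
  rewrite nmerge_nsub ltnNge leqnSn /= gtn_eqF // eqxx.
  rewrite (multi_dep mx (b := nsub a s (a s * p.1))) // => j; rewrite ltnS leq_eqVlt.
  by rewrite /nsub /nmerge; case: eqP => //= _ ->.
have T2 : T s.+2 = x a u.
  rewrite -(sectK (sg t) u (multi_lin mx a)); apply: eq_bigr => p _.
  by rewrite /face ltnn nsub_same (multi_upd _ _ mx).
move: T0; rewrite big_ord_recr /= T2 => /eqP; rewrite addr_eq0 => /eqP e.
rewrite /hoch !fct_sumE; transitivity (- ((-1) ^+ s.+2 *: x a u)).
  rewrite -e; apply: eq_bigr => i _; rewrite T1 //.
by rewrite -scaleNr exprS mulN1r opprK.
Qed.

Lemma hoch_exact1 : exact1 X.
Proof.
move=> s t x gx dx; exists ((-1) ^+ s.+1 *: hoch_htpy s x).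
  by apply: submod_scale; apply: htpy_good.
transitivity ((-1) ^+ s.+1 *: hoch s (hoch_htpy s x)).
  exact: (linZ (@hoch_linear k A (U t) N s)).
by rewrite htpy_hoch // scalerA -expr2 sqrr_sign scale1r.
Qed.

(** Cochains are only [k]-linear in the module argument, so [linear_factor] factors them through
    [dU]. *)
Lemma hoch_exact2 : exact1 (btr X).
Proof.
move=> t s x gx dx; have [mx nx] := gx.
have dx0 a u : x a (dU u) = 0.
  have : (-1) ^+ s *: nc_d2 s x = 0 by rewrite [nc_d2 s x]dx scaler0.
  rewrite /nc_d2 scalerA -expr2 sqrr_sign scale1r => e.
  exact: (congr1 (fun g => g a u) e).
have [c lc cE] := linear_factor (@dU_lin t).
pose y : nc (U t) N := fun a u => x a (c u).
have gy : good _ _ s y.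
  split; first split.
  - move=> a; exact: linear_comp_fun (multi_lin mx a) lc.
  - by move=> a i u js; apply: (multi_sub mx).
  - by move=> a b ab; apply/funext => u; rewrite /y (multi_dep mx ab).
  by move=> a i d js ai; apply/funext => u; rewrite /y (nx a i d).
exists ((-1) ^+ s *: y); first exact: submod_scale.
transitivity ((-1) ^+ s *: nc_d2 s y); first exact: (linZ (@nc_d2_linear s t)).
rewrite /nc_d2 scalerA -expr2 sqrr_sign scale1r.
apply/funext => a; apply/funext => u; apply: cE; first exact: (multi_lin mx a).
by move=> v /dU_exact[v' <-].
Qed.

Definition linA_set t (g : U t -> N) :=
  linear g /\ forall a u, g (am_act (U t) a u) = am_act N a (g u).

Fact linA0 t : linA_set (0 : U t -> N).
Proof.
split=> [c x y|a u]; first by rewrite scaler0 addr0.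
by rewrite (lin0 (@am_linr _ _ N a)).
Qed.

Fact linAP t c (g h : U t -> N) : linA_set g -> linA_set h -> linA_set (c *: g + h).
Proof.
move=> [lg Ag] [lh Ah]; split; first exact: linear_fct.
by move=> a u; rewrite !fctE Ag Ah (@am_linr _ _ N a).
Qed.

Definition linA_sub t : submod (U t -> N) := Submod (@linA0 t) (@linAP t).

Fact linA_d_sub t (g : U t -> N) : linA_sub t g -> linA_sub t.+1 (g \o @dU t).
Proof.
move=> [lg Ag]; split=> [c x y|a u] /=; first by rewrite dU_lin lg.
by rewrite dU_act Ag.
Qed.

Fact linA_pre_linear t : linear (fun g : U t -> N => (g \o @dU t : U t.+1 -> N)).
Proof. by []. Qed.

Definition linA_d t : {linear subspace (linA_sub t) -> subspace (linA_sub t.+1)} :=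
  submap (g := lin_pack (@linA_pre_linear t)) (@linA_d_sub t).

Definition linA_inj_fun t (g : subspace (linA_sub t)) : X 0%N t := fun _ u => val g u.

Fact linA_inj_linear t : linear (@linA_inj_fun t).
Proof. by []. Qed.

Definition linA_inj t : {linear subspace (linA_sub t) -> X 0%N t} :=
  lin_pack (@linA_inj_linear t).

Fact linA_inj_sub t (g : subspace (linA_sub t)) : bi_sub X (linA_inj t g).
Proof. by split=> //; split=> // a; case: (subspaceP g). Qed.

Lemma hoch0 t (x : nc (U t) N) a u :
  hoch 0 x a u = am_act N (a 0%N) (x (nshift a) u) - x a (am_act (U t) (a 0%N) u).
Proof.
rewrite /hoch !fct_sumE !big_ord_recl big_ord0 addr0 /=.
by rewrite [_ ^+ 0 *: _]scale1r [_ *: _]scaleN1r.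
Qed.

Fact linA_inj_d1 t (g : subspace (linA_sub t)) : bi_d1 X (linA_inj t g) = 0.
Proof.
apply/funext => a; apply/funext => u; rewrite [LHS]hoch0.
have [_ Ag] := subspaceP g.
by rewrite /linA_inj /= /linA_inj_fun Ag subrr.
Qed.

Fact linA_inj_ker t (x : X 0%N t) : bi_sub X x -> bi_d1 X x = 0 ->
  exists2 g, submod_full (subspace (linA_sub t)) g & linA_inj t g = x.
Proof.
move=> [mx _] dx.
have xE a b : (x : nc (U t) N) a = (x : nc (U t) N) b by apply: (multi_dep mx).
have gP : linA_sub t ((x : nc (U t) N) (fun=> 0)).
  split; first exact: (multi_lin mx).
  move=> a u; have := congr1 (fun y : nc (U t) N => y (fun=> a) u) dx.
  rewrite [X in X = _]hoch0 => /eqP; rewrite subr_eq0 => /eqP e.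
  by rewrite (xE _ (fun=> a)) -e; congr am_act; rewrite (xE _ (fun=> 0)).
exists (@subel _ _ (linA_sub t) _ gP) => //.
by apply/funext => a; apply/funext => u; rewrite (xE a (fun=> 0)).
Qed.

Fact linA_inj0 t (g : subspace (linA_sub t)) : linA_inj t g = 0 -> g = 0.
Proof.
by move=> e; apply: val_inj; apply: (congr1 (fun x : nc (U t) N => x (fun=> 0)) e).
Qed.

Fact linA_inj_d2 t (g : subspace (linA_sub t)) :
  bi_d2 X (linA_inj t g) = linA_inj t.+1 (linA_d t g).
Proof. exact: (scale1r (nc_pre (linA_inj t g))). Qed.

(** The kernel of the Hochschild differential on the 0-cochains Hom_k(U_t, N) is Hom_A(U_t, N). *)
Definition linA_edge : edge X := @Edge k X (fun t => subspace (linA_sub t))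
  (fun t => submod_full _) linA_d linA_inj (fun _ _ _ => I)
  (fun t g _ => linA_inj_sub g) (fun t g _ => linA_inj_d1 g) linA_inj_ker
  (fun t g _ => @linA_inj0 t g) (fun t g _ => linA_inj_d2 g).

Definition aug_pre (x : nc M N) : nc (U 0%N) N := fun a u => x a (aug u).

Fact aug_pre_linear : linear aug_pre.
Proof. by []. Qed.

Fact aug_pre_good s (x : nc M N) : good M N s x -> good (U 0%N) N s (aug_pre x).
Proof.
move=> [mx nx]; split; first split.
- move=> a; exact: linear_comp_fun (multi_lin mx a) aug_lin.
- by move=> a i u js; apply: (multi_sub mx).
- by move=> a b ab; apply/funext => u; rewrite /aug_pre (multi_dep mx ab).
by move=> a i c js ai; apply/funext => u; rewrite /aug_pre (nx a i c).
Qed.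

Fact aug_pre_d s (x : nc M N) : good M N s x ->
  nc_d2 s (aug_pre x) = 0.
Proof.
move=> [mx _]; rewrite /nc_d2 (_ : nc_pre _ = 0) ?scaler0 //.
apply/funext => a; apply/funext => u; rewrite /nc_pre /aug_pre.
have -> : aug (dU u) = 0 by apply/aug_exact; exists u.
exact: lin0 (multi_lin mx a).
Qed.

Fact aug_pre_hoch s (x : nc M N) : good M N s x ->
  hoch s (aug_pre x) = aug_pre (hoch s x).
Proof.
move=> _; rewrite /hoch (lin_sum aug_pre_linear); apply: eq_bigr => i _.
rewrite (linZ aug_pre_linear); congr (_ *: _).
apply/funext => a; apply/funext => u; rewrite /face /aug_pre.
by case: (i : nat) => [|j] //; case: ifP => // _; rewrite aug_act.
Qed.

Fact aug_pre_ker s (x : nc (U 0%N) N) : good (U 0%N) N s x -> nc_d2 s x = 0 ->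
  exists2 y, good M N s y & aug_pre y = x.
Proof.
move=> [mx nx] dx.
have dx0 a u : x a (dU u) = 0.
  have : (-1) ^+ s *: nc_d2 s x = 0 by rewrite dx scaler0.
  rewrite /nc_d2 scalerA -expr2 sqrr_sign scale1r => e.
  exact: (congr1 (fun g => g a u) e).
have [c lc cE] := linear_factor aug_lin.
exists (fun a m => x a (c m)).
  split; first split.
  - move=> a; exact: linear_comp_fun (multi_lin mx a) lc.
  - by move=> a i u js; apply: (multi_sub mx).
  - by move=> a b ab; apply/funext => u; rewrite (multi_dep mx ab).
  by move=> a i d js ai; apply/funext => u; rewrite (nx a i d).
apply/funext => a; apply/funext => u; apply: cE; first exact: (multi_lin mx a).
by move=> v /aug_exact[v' <-].
Qed.

Fact aug_pre0 s (x : nc M N) : good M N s x -> aug_pre x = 0 -> x = 0.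
Proof.
move=> _ e; apply/funext => a; apply/funext => m; have [u <-] := aug_surj m.
exact: (congr1 (fun y : nc (U 0%N) N => y a u) e).
Qed.

(** In the direction of the resolution the kernel consists of the cochains on [M], because Hom_k(-,
    N) is left exact. *)
Definition hoch_edge : edge (btr X) := @Edge k (btr X) (fun s => nc M N)
  (fun s => good M N s) (fun s => lin_pack (@hoch_linear k A M N s))
  (fun s => lin_pack aug_pre_linear) (fun s => @hoch_good k A M N s)
  aug_pre_good aug_pre_d aug_pre_ker aug_pre0 aug_pre_hoch.

Lemma hoch_vanish n (x : nc M N) : (forall u : U n, u = 0) ->
  good M N n x -> hoch n x = 0 -> ecob (B := hoch_edge) (n := n) x.
Proof.
move=> U0 gx dx; apply: (edge_vanish linA_edge hoch_exact1 hoch_exact2) => //.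
move=> y [my _]; apply/funext => a; apply/funext => u.
by rewrite (U0 u); apply: lin0 (multi_lin my a).
Qed.

End HochschildBicomplex.

(** * Free modules and canonical resolutions *)

Lemma tensor_ext (k : comPzRingType) (U V W : lmodType k) (g g' : tensor U V -> W) :
  linear g -> linear g' -> (forall u v, g (u ⊗ v) = g' (u ⊗ v)) -> g =1 g'.
Proof.
by move=> lg lg' e t; rewrite [t]trepr_sum !lin_sum //; apply: eq_bigr => p _.
Qed.

Section FreeModule.
Variables (k : fieldType) (R : algType k) (V : lmodType k).

Definition free_mod : Type := tensor R V.

HB.instance Definition _ := GRing.Lmodule.copy free_mod (tensor R V).

Definition free_scale (r : R) (t : free_mod) : free_mod := tlift (fun s v => (r * s) ⊗ v) t.

Lemma free_scale_bilin (r : R) : bilin (fun (s : R) (v : V) => (r * s) ⊗ v).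
Proof. lin. Qed.

Lemma free_scale_linear r : linear (free_scale r).
Proof. exact: tlift_linear (free_scale_bilin r). Qed.

Lemma free_scale_pure r s v : free_scale r (s ⊗ v) = (r * s) ⊗ v.
Proof. exact: tlift_pure (free_scale_bilin r). Qed.

Fact free_scaleA a b t : free_scale a (free_scale b t) = free_scale (a * b) t.
Proof.
have la := free_scale_linear a; have lb := free_scale_linear b.
have lab := free_scale_linear (a * b).
move: t; apply: tensor_ext => // [|s v]; first exact: linear_comp_fun.
by rewrite !free_scale_pure mulrA.
Qed.

Fact free_scale1 : left_id 1 free_scale.
Proof.
apply: tensor_ext => [||s v]; [exact: free_scale_linear | by [] |].
by rewrite free_scale_pure mul1r.
Qed.

Fact free_scaleDr : right_distributive free_scale +%R.
Proof. by move=> r; apply: linD; apply: free_scale_linear. Qed.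

Fact free_scaleDl t : {morph free_scale^~ t : a b / a + b}.
Proof.
have l : linear (free_scale^~ t).
  apply: Defs.linear_sum => p; lin.
exact: linD l.
Qed.

End FreeModule.

(** A second copy of the carrier: on [free_mod] the scalars are those of [k], on [free] those of
    [R]. The lemma [free_kscale] reconciles them. *)
Definition free (k : fieldType) (R : algType k) (V : lmodType k) : Type := free_mod R V.

Section Free.
Variables (k : fieldType) (R : algType k).

HB.instance Definition _ (V : lmodType k) := GRing.Zmodule.copy (free R V) (free_mod R V).
HB.instance Definition _ (V : lmodType k) := GRing.Zmodule_isLmodule.Build R (free R V)
  (@free_scaleA k R V) (@free_scale1 k R V) (@free_scaleDr k R V) (@free_scaleDl k R V).

Lemma free_kscale (V : lmodType k) (c : k) (t : tensor R V) :
  (c *: (t : scalars (free R V)) : scalars (free R V)) = (c *: t : tensor R V).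
Proof.
change (free_scale (c%:A : R) t = c *: t).
have l1 := free_scale_linear (V := V) (c%:A : R).
have l2 : linear (fun t : tensor R V => c *: t) by lin.
move: t; apply: tensor_ext => // s v.
rewrite free_scale_pure mulr_algl.
by case: (tpure_bilin R V) => b1 _; rewrite (linZ (b1 v)).
Qed.

Lemma free_linear (V : lmodType k) (M : lmodType R) (g : V -> scalars M) :
  linear g -> linear (tlift (fun r v => ract r (g v)) : free R V -> M).
Proof.
move=> lg r t t'; have bM := @ract_bilin k R M.
have lt : linear (tlift (fun r v => ract r (g v))) by apply: tlift_linear; lin.
rewrite [LHS](linD lt); congr (_ + _).
have l1 := free_scale_linear (V := V) r.
have lr : linear (ract (M := M) r) by lin.
move: t; apply: (@tensor_ext k R V (scalars M)
  (fun t => tlift (fun r v => ract r (g v)) (free_scale r t))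
  (fun t => ract r (tlift (fun r v => ract r (g v)) t))).
- exact: linear_comp_fun.
- exact: linear_comp_fun.
by move=> s v; rewrite free_scale_pure !tlift_pure ?ractM //; lin.
Qed.

Definition free_ev (M : lmodType R) : {linear free R (scalars M) -> M} :=
  lin_pack (free_linear (@linear_id k (scalars M))).

Lemma free_evE (M : lmodType R) r (m : scalars M) : free_ev M (r ⊗ m) = r *: (m : M).
Proof.
have bM := @ract_bilin k R M.
exact: (@tlift_pure k R (scalars M) (scalars M) (fun r v => ract r v) r m ltac:(lin)).
Qed.

Lemma free_ev_surj (M : lmodType R) m : exists t, free_ev M t = m.
Proof. by exists (1 ⊗ (m : scalars M)); rewrite free_evE scale1r. Qed.

(** Over a field the surjection [g] has a [k]-linear section [c]; composing it with [f] on $1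
    \otimes V$ and extending [R]-linearly gives the lift. *)
Lemma free_projective (V : lmodType k) : projective (free R V).
Proof.
move=> U W g f gs.
have lgk := scalars_linear (linearP g); have lfk := scalars_linear (linearP f).
have [c lc gcg] := linear_quasi_inverse lgk.
have gc v : g (c v) = v by have [u <-] := gs v; apply: gcg.
pose f0 (v : V) : scalars W := f (1 ⊗ v).
have lf0 : linear f0.
  move=> a x y; rewrite /f0; case: (tpure_bilin R V) => _ b2; rewrite b2.
  by rewrite -lfk -free_kscale.
have lcf : linear (fun v => c (f0 v)) by exact: linear_comp_fun.
exists (lin_pack (free_linear lcf)) => t.
have bU := @ract_bilin k R U; have bW := @ract_bilin k R W.
have lft : linear (f : tensor R V -> scalars W).
  by move=> a x y; rewrite -lfk -free_kscale.
have lt : linear (tlift (fun r v => ract r (c (f0 v)))) by apply: tlift_linear; lin.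
move: t; apply: (@tensor_ext k R V (scalars W)
  (fun t => g (tlift (fun r v => ract r (c (f0 v))) t)) f) => //.
  exact: linear_comp_fun lgk lt.
move=> r v; rewrite tlift_pure; last by lin.
transitivity (ract r (f0 v)).
  by rewrite (lin_ract _ _ (linearP g)) gc.
have <- : free_scale r (1 ⊗ v) = r ⊗ v by rewrite free_scale_pure mulr1.
by rewrite -(lin_ract r (1 ⊗ v : scalars (free R V)) (linearP f)).
Qed.

End Free.

Section CanonicalResolution.
Variables (k : fieldType) (R : algType k) (M : lmodType R).

(** Each syzygy is covered by the free module on its own underlying space, so a resolution exists
    without choices. *)
Fixpoint syz n : lmodType R :=
  if n is n'.+1 then subspace (kernel (free_ev (syz n'))) else M.

Definition can_mod n : lmodType R := free R (scalars (syz n)).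

Fact can_d_linear n :
  linear (fun x : can_mod n.+1 => val (free_ev (syz n.+1) x : subspace _) : can_mod n).
Proof. by move=> a x y; rewrite linearP. Qed.

Definition can_d n : {linear can_mod n.+1 -> can_mod n} := lin_pack (@can_d_linear n).

Lemma can_dP n (x : can_mod n) :
  free_ev (syz n) x = 0 <-> exists y, can_d n y = x.
Proof.
split=> [e|[y <-]]; last exact: (subspaceP (free_ev (syz n.+1) y)).
have [y yE] := free_ev_surj (@subel _ _ (kernel (free_ev (syz n))) x e : syz n.+1).
by exists y; apply: (congr1 val yE).
Qed.

Fact can_exact n (x : can_mod n.+1) : can_d n x = 0 <-> exists y, can_d n.+1 y = x.
Proof.
rewrite -can_dP; split=> [e|e]; first by apply: val_inj; rewrite [LHS]e.
exact: (congr1 val e).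
Qed.

Definition can_res : projResolution M := ProjResolution
  (fun n => @free_projective k R (scalars (syz n))) (@free_ev_surj k R M) (@can_dP 0)
  can_exact.

End CanonicalResolution.

Section Sections.
Variables (k : fieldType) (A : algType k).

Definition amodA (M : lmodType A) : amod A := @Amod k A (scalars M) (@ract k A M)
  (@ract_bilin k A M) (@ractM k A M) (@scale1r A M).

Lemma free_section (R : algType k) (Q : lmodType R) : projective Q ->
  exists2 tau : Q -> free R (scalars Q), linear tau & forall q, free_ev Q (tau q) = q.
Proof. by move=> pQ; apply: projective_lift => // q; apply: free_ev_surj. Qed.

Lemma free_klinear (R : algType k) (Q : lmodType R) (tau : Q -> free R (scalars Q)) :
  linear tau -> linear (tau : scalars Q -> tensor R (scalars Q)).
Proof. by move=> lt a x y; rewrite -free_kscale; apply: (lt a%:A). Qed.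

Lemma free_ev_klinear (R : algType k) (Q : lmodType R) :
  linear (free_ev Q : tensor R (scalars Q) -> scalars Q).
Proof. by move=> a x y; rewrite -free_kscale; apply: linearP. Qed.

Lemma amodA_section (Q : lmodType A) : projective Q -> amod_section (amodA Q).
Proof.
move=> pQ; have [tau ltau tauK] := cid2 (free_section pQ).
have bQ := @ract_bilin k A Q.
apply: (@AmodSection k A (amodA Q) (tau : scalars Q -> tensor A (scalars Q))).
- exact: free_klinear.
- move=> W F a u bF.
  have -> : tau (am_act (amodA Q) a u) = free_scale a (tau u) by exact: (linZ ltau).
  have lF := tlift_linear bF; have l1 := free_scale_linear (V := scalars Q) a.
  have bF' : bilin (fun b v => F (a * b) v) by lin.
  move: (tau u : tensor A (scalars Q)).
  apply: (tensor_ext (g := fun t => tlift F (free_scale a t))).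
  + exact: linear_comp_fun lF l1.
  + exact: tlift_linear.
  by move=> b v; rewrite free_scale_pure !tlift_pure.
move=> W g u lg; rewrite -[in RHS](tauK u).
have bg : bilin (fun b v => g (ract b v)) by lin.
move: (tau u : tensor A (scalars Q)).
apply: (tensor_ext (g' := fun t => g (free_ev Q t))).
- exact: tlift_linear.
- exact: linear_comp_fun lg (@free_ev_klinear A Q).
by move=> b v; rewrite tlift_pure // free_evE.
Qed.

End Sections.

Section CrossedSection.
Variables (k : fieldType) (A : algType k) (H : hopfAlgebra k).
Variables (w : weakAction A H) (f : {linear tensor H H -> A}).
Variable wf : is_crossed_product w f.
Local Notation E := (crossed wf).
Local Notation "a ## h" := (cpure wf a h) (at level 38).
Let bc : bilin (cpure wf) := tpure_bilin A H.

Definition eact (M : lmodType E) (a : A) (m : scalars M) : scalars M := ract (a ## 1) m.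

Fact eact_bilin M : bilin (@eact M).
Proof. have bM := @ract_bilin k E M; rewrite /eact; lin. Qed.

Fact eactM M a b m : @eact M a (eact b m) = eact (a * b) m.
Proof. by rewrite /eact ractM cpure_mulA. Qed.

Definition amodE (M : lmodType E) : amod A := @Amod k A (scalars M) (@eact M)
  (@eact_bilin M) (@eactM M) (@scale1r E M).

(** The map $(a \# h) \otimes q \mapsto a \otimes (1 \# h) q$ is [A]-linear and compatible with
    evaluation in [Q], as $(a \# 1)(1 \# h) = a \# h$. It turns an [E]-linear section of the free
    cover of [Q] into an [A]-linear section of $A \otimes Q \to Q$. *)
Definition crossed_split (Q : lmodType E) (e : E) (q : scalars Q) : tensor A (scalars Q) :=
  tlift (fun a h => a ⊗ ract (1 ## h) q) e.

Lemma crossed_split_bilin Q : bilin (@crossed_split Q).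
Proof.
have bQ := @ract_bilin k E Q; split=> [q|e]; first by apply: tlift_linear; lin.
by apply: Defs.linear_sum => p; lin.
Qed.

Lemma crossed_splitE Q a h q : @crossed_split Q (a ## h) q = a ⊗ ract (1 ## h) q.
Proof.
have bQ := @ract_bilin k E Q.
by rewrite /crossed_split tlift_pure //; lin.
Qed.

Lemma amodE_section (Q : lmodType E) : projective Q -> amod_section (amodE Q).
Proof.
move=> pQ; have [tau ltau tauK] := cid2 (free_section pQ).
have bQ := @ract_bilin k E Q; have bs := @crossed_split_bilin Q.
have ls := tlift_linear bs; have ltk := free_klinear ltau.
apply: (@AmodSection k A (amodE Q)
  (fun q => tlift (@crossed_split Q) (tau q : tensor E (scalars Q)))).
- exact: linear_comp_fun ls ltk.
- move=> W F a u bF.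
  have -> : tau (am_act (amodE Q) a u) = free_scale (a ## 1) (tau u) by exact: (linZ ltau).
  have lF := tlift_linear bF; have l1 := free_scale_linear (V := scalars Q) (a ## 1).
  have bF' : bilin (fun b v => F (a * b) v) by lin.
  have lF' := tlift_linear bF'.
  move: (tau u : tensor E (scalars Q)).
  apply: (tensor_ext (g := fun t => tlift F (tlift (@crossed_split Q) (free_scale (a ## 1) t)))
    (g' := fun t => tlift _ (tlift (@crossed_split Q) t))).
  + exact: linear_comp_fun lF (linear_comp_fun ls l1).
  + exact: linear_comp_fun lF' ls.
  move=> e v; rewrite free_scale_pure !tlift_pure //; move: e.
  apply: (crossed_ext (g := fun e => tlift F (crossed_split ((a ## 1) * e) v))
    (g' := fun e => tlift _ (crossed_split e v))); try lin.
  by move=> b h; rewrite cpure_mulA !crossed_splitE !tlift_pure.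
move=> W g u lg; rewrite -[in RHS](tauK u).
have bg : bilin (fun b v => g (eact b v)) by rewrite /eact; lin.
have lg' := tlift_linear bg.
move: (tau u : tensor E (scalars Q)).
apply: (tensor_ext (g := fun t => tlift _ (tlift (@crossed_split Q) t))
  (g' := fun t => g (free_ev Q t))).
- exact: linear_comp_fun lg' ls.
- exact: linear_comp_fun lg (@free_ev_klinear k E Q).
move=> e v; rewrite tlift_pure // free_evE; move: e.
apply: (crossed_ext (g := fun e => tlift _ (crossed_split e v)) (g' := fun e => g (ract e v))); try lin.
move=> b h; rewrite crossed_splitE tlift_pure //.
by rewrite -[am_act _ _ _]/(ract (b ## 1) (ract (1 ## h) v)) ractM -cpure_decomp.
Qed.

End CrossedSection.

(** * The action of the Hopf algebra on Hochschild cochains *)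

Section WeakActionOnWords.
Variables (k : fieldType) (A : algType k) (H : hopfAlgebra k) (w : weakAction A H).
Implicit Types (a b : nat -> A).
Let bw : bilin (wact w) := wact_bilin w.

Definition ncons (y : A) b : nat -> A := fun i => if i is j.+1 then b j else y.

(* [\sum beta (a_0^{h^(1)}, .., a_{s-1}^{h^(s)}) h^(s+1)], padding words by zeros. *)
Fixpoint wsum s (W : lmodType k) (h : H) a (beta : (nat -> A) -> H -> W) : W :=
  if s is s'.+1 then
    \sw_(x, y <- h) wsum s' y (nshift a) (fun b l => beta (ncons (w x (a 0%N)) b) l)
  else beta (fun=> 0) h.

Record wmulti s (W : lmodType k) (beta : (nat -> A) -> H -> W) : Prop := Wmulti {
  wmulti_lin : forall b, linear (beta b);
  wmulti_sub : forall b i l, (i < s)%N -> linear (fun y => beta (nsub b i y) l) }.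

Lemma ncons_sub y b i z : ncons y (nsub b i z) = nsub (ncons y b) i.+1 z.
Proof. by apply/funext => -[]. Qed.

Lemma nsub_cons y z b : nsub (ncons y b) 0 z = ncons z b.
Proof. by apply/funext => -[]. Qed.

Lemma wmulti_cons s (W : lmodType k) (beta : (nat -> A) -> H -> W) y :
  wmulti s.+1 beta -> wmulti s (fun b l => beta (ncons y b) l).
Proof.
move=> mb; split=> [b|b i l js]; first exact: (wmulti_lin mb).
have -> : (fun z => beta (ncons y (nsub b i z)) l) = (fun z => beta (nsub (ncons y b) i.+1 z) l).
  by apply/funext => z; rewrite ncons_sub.
exact: (wmulti_sub mb).
Qed.

Lemma wmulti_head s (W : lmodType k) (beta : (nat -> A) -> H -> W) b l :
  wmulti s.+1 beta -> linear (fun y => beta (ncons y b) l).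
Proof.
move=> mb; have -> : (fun y => beta (ncons y b) l) = (fun y => beta (nsub (ncons 0 b) 0 y) l).
  by apply/funext => z; rewrite nsub_cons.
exact: (wmulti_sub mb).
Qed.

Lemma wsum_ext s (W : lmodType k) h a (beta beta' : (nat -> A) -> H -> W) :
  (forall b l, beta b l = beta' b l) -> wsum s h a beta = wsum s h a beta'.
Proof.
elim: s h a beta beta' => [|s IHs] h a beta beta' e //=.
by apply: swe_ext => x y; apply: IHs => b l.
Qed.

Lemma wsum_linF s (U W : lmodType k) h a (beta : U -> (nat -> A) -> H -> W) :
  (forall b l, linear (fun u => beta u b l)) -> linear (fun u => wsum s h a (beta u)).
Proof.
elim: s h a beta => [|s IHs] h a beta lb //=.
apply: (@swe_linearF k H U W h (fun u x y => wsum s y (nshift a)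
  (fun b l => beta u (ncons (w x (a 0%N)) b) l))) => x y.
exact: (IHs y (nshift a) (fun u b l => beta u (ncons (w x (a 0%N)) b) l)).
Qed.

Lemma wsum_comp s (W W' : lmodType k) (g : W -> W') h a beta : linear g ->
  g (wsum s h a beta) = wsum s h a (fun b l => g (beta b l)).
Proof.
elim: s h a beta => [|s IHs] h a beta lg //=.
by rewrite (swe_comp _ _ lg); apply: swe_ext => x y; apply: IHs.
Qed.

(** The induction step of [wsum_linear], with the induction hypothesis as a premise. *)
Lemma wsum_bilin s (W : lmodType k) a (z : A) (beta : (nat -> A) -> H -> W) :
  (forall a beta, wmulti s beta -> linear (fun y => wsum s y a (beta : (nat -> A) -> H -> W))) ->
  wmulti s.+1 beta ->
  bilin (fun x y => wsum s y a (fun b l => beta (ncons (w x z) b) l)).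
Proof.
move=> IH mb; split=> [y|x]; last by apply: IH; apply: wmulti_cons.
apply: (@wsum_linF s H W y a (fun x b l => beta (ncons (w x z) b) l)) => b l.
have lb := @wmulti_head s W beta b l mb.
exact: (@linear_comp_fun _ _ _ _ _ (fun x => w x z) lb (bw.1 z)).
Qed.

Lemma wsum_linear s (W : lmodType k) a (beta : (nat -> A) -> H -> W) :
  wmulti s beta -> linear (fun h => wsum s h a beta).
Proof.
elim: s a beta => [|s IHs] a beta mb /=; first exact: (wmulti_lin mb).
apply: (@swe_linear k H H W (fun h => h)) => //.
exact: wsum_bilin.
Qed.

Lemma wsum_dep s (W : lmodType k) h a a' (beta : (nat -> A) -> H -> W) :
  (forall j, (j < s)%N -> a j = a' j) -> wsum s h a beta = wsum s h a' beta.
Proof.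
elim: s h a a' beta => [|s IHs] h a a' beta e //=.
by rewrite e //; apply: swe_ext => x y; apply: IHs => j js; apply: e.
Qed.

Lemma wsum_sub s (W : lmodType k) h a i (beta : (nat -> A) -> H -> W) :
  wmulti s beta -> (i < s)%N -> linear (fun z => wsum s h (nsub a i z) beta).
Proof.
elim: s h a i beta => [|s IHs] h a [|i] beta mb // js /=.
  apply: swe_linearF => x y.
  apply: (@wsum_linF s A W y (nshift a) (fun z b l => beta (ncons (w x z) b) l)) => b l.
  exact: (@linear_comp_fun _ _ _ _ _ (fun z => w x z) (@wmulti_head s W beta b l mb) (bw.2 x)).
apply: swe_linearF => x y.
apply: (IHs y (nshift a) i (fun b l => beta (ncons (w x (a 0%N)) b) l)) => //.
exact: wmulti_cons.
Qed.

Lemma wact_scalar h (c : k) : w h c%:A = (c * (counit H h : k))%:A.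
Proof. by rewrite (linZ (bw.2 h)) wact1 scalerA. Qed.

Lemma wsum0 s (W : lmodType k) h a (beta : (nat -> A) -> H -> W) :
  (forall b l, beta b l = 0) -> wsum s h a beta = 0.
Proof.
elim: s h a beta => [|s IHs] h a beta e //=.
by apply: big1 => p _; apply: IHs => b l; apply: e.
Qed.

Lemma wsum_normal s (W : lmodType k) h a i c (beta : (nat -> A) -> H -> W) :
  (forall b l c, b i = c%:A -> beta b l = 0) -> (i < s)%N -> a i = c%:A ->
  wsum s h a beta = 0.
Proof.
elim: s h a i beta => [|s IHs] h a [|i] beta nb // js ai /=; apply: big1 => -[x y] _ /=.
  apply: wsum0 => b l; apply: (nb _ _ (c * (counit H x : k))).
  by rewrite /= ai wact_scalar.
by apply: (IHs _ _ i) => // b l d bi; apply: (nb _ _ d).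
Qed.

Lemma wsum_last s (W : lmodType k) h a (beta : (nat -> A) -> H -> W) :
  wmulti s.+1 beta ->
  wsum s.+1 h a beta =
  wsum s h a (fun b l => \sw_(x, y <- l) beta (nsub b s (w x (a s))) y).
Proof.
elim: s h a beta => [|s IHs] h a beta mb.
  rewrite /=; apply: swe_ext => x y; congr (beta _ y).
  by apply/funext => -[].
transitivity (\sw_(x, y <- h)
   wsum s.+1 y (nshift a) (fun b l => beta (ncons (w x (a 0%N)) b) l)) => //.
transitivity (\sw_(x, y <- h) wsum s y (nshift a) (fun b l => \sw_(x', y' <- l)
  beta (nsub (ncons (w x (a 0%N)) b) s.+1 (w x' (a s.+1))) y')) => //.
apply: swe_ext => x y; rewrite IHs; last exact: wmulti_cons.
by apply: wsum_ext => b l; apply: swe_ext => x' y'; rewrite ncons_sub.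
Qed.

Lemma nmerge_cons y b i : nmerge (ncons y b) i.+1 = ncons y (nmerge b i).
Proof. by apply/funext => -[|j] //; rewrite /nmerge /= ltnS eqSS. Qed.

Lemma nmerge_cons0 y z b : nmerge (ncons y (ncons z b)) 0 = ncons (y * z) b.
Proof. by apply/funext => -[|j]. Qed.

(** For $i = 0$ this is coassociativity followed by $(ab)^h = a^{h_1} b^{h_2}$; larger $i$ reduce to
    it by shifting the sequence. *)
Lemma wsum_merge s (W : lmodType k) h a i (beta : (nat -> A) -> H -> W) :
  wmulti s beta -> (i < s)%N ->
  wsum s.+1 h a (fun b l => beta (nmerge b i) l) = wsum s h (nmerge a i) beta.
Proof.
elim: s h a i beta => [|s IHs] h a [|i] beta mb // js.
  transitivity (\sw_(x, y <- h) \sw_(x', y' <- y) wsum s y' (nshift (nshift a))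
    (fun b l => beta (ncons (w x (a 0%N) * w x' (a 1%N)) b) l)).
    apply: swe_ext => x y; apply: swe_ext => x' y'; apply: wsum_ext => b l.
    by rewrite nmerge_cons0.
  have l2 y' : linear (fun v => wsum s y' (nshift (nshift a)) (fun b l => beta (ncons v b) l)).
    apply: (@wsum_linF s A W y' _ (fun v b l => beta (ncons v b) l)) => b l.
    exact: (@wmulti_head s W beta b l mb).
  have l3 v : linear (fun y' => wsum s y' (nshift (nshift a)) (fun b l => beta (ncons v b) l)).
    by apply: wsum_linear; apply: wmulti_cons.
  rewrite -(swe_assoc (F := fun x x' y' => wsum s y' (nshift (nshift a))
    (fun b l => beta (ncons (w x (a 0%N) * w x' (a 1%N)) b) l))); last first.
    split=> [x' y'|x y'|x x'].
    - apply: (linear_comp_fun (l2 y') (g := fun x => w x (a 0%N) * w x' (a 1%N))); lin.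
    - apply: (linear_comp_fun (l2 y') (g := fun x' => w x (a 0%N) * w x' (a 1%N))); lin.
    exact: l3.
  apply: swe_ext => z y'; rewrite -(swe_comp _ _ (l2 y')).
  by rewrite [nmerge a 0 0%N]/(a 0%N * a 1%N) wactM.
transitivity (\sw_(x, y <- h)
    wsum s y (nmerge (nshift a) i) (fun b l => beta (ncons (w x (a 0%N)) b) l)).
  apply: swe_ext => x y; rewrite -IHs //; last exact: wmulti_cons.
  apply: swe_ext => x' y'; apply: wsum_ext => b l; congr (beta _ l).
  exact: nmerge_cons.
by apply: swe_ext => x y; rewrite nmerge_shift.
Qed.

Lemma sweedler_wsum s (W : lmodType k) h a (beta : (nat -> A) -> H -> W) :
  \sum_(v <- sweedler (comul H) s h)
    beta (fun i => if (i < s)%N then w v`_i (a i) else 0) v`_s = wsum s h a beta.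
Proof.
elim: s h a beta => [|s IHs] h a beta; first by rewrite big_seq1.
rewrite /= big_allpairs_dep; apply: eq_bigr => -[x y] _ /=; rewrite -IHs.
apply: eq_bigr => v _; congr (beta _ _); apply/funext => -[|i] //=.
Qed.

End WeakActionOnWords.

Section CochainAction.
Variables (k : fieldType) (A : algType k) (H : hopfAlgebra k).
Variables (w : weakAction A H) (f finv : {linear tensor H H -> A}).
Variables (wf : is_crossed_product w f) (fV : conv_inverse f finv).
Local Notation E := (crossed wf).
Local Notation "a ## h" := (cpure wf a h) (at level 38).
Local Notation c := (cinv wf finv).
Let bw : bilin (wact w) := wact_bilin w.
Let bc : bilin (cpure wf) := tpure_bilin A H.
Let lc : linear c := @cinv_linear k A H w f finv wf.

Section OneModule.
Variables (M N : lmodType E).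
Let bM := @ract_bilin k E M.
Let bN := @ract_bilin k E N.
Local Notation nc := (nc (amodE M) (amodE N)).
Implicit Type x : nc.

Definition nbeta x e (m : scalars M) : (nat -> A) -> H -> scalars N :=
  fun b l => ract e (x b (ract (1 ## l) m)).

Definition nact s (h : H) x : nc := fun a m =>
  \sw_(p, r <- h) wsum w s r a (nbeta x (c p) m).

Lemma nbeta_multi s x e m : multi s x -> wmulti s (nbeta x e m).
Proof.
move=> mx; split=> [b|b i l js]; rewrite /nbeta.
  by have lx := multi_lin mx b; lin.
have lx := multi_sub mx b (ract (1 ## l) m) js.
exact: linear_comp_fun (bN.2 e) lx.
Qed.

Lemma nbeta_bilin s x a m : multi s x ->
  bilin (fun e r => wsum w s r a (nbeta x e m)).
Proof.
move=> mx; split=> [r|e]; last exact/wsum_linear/nbeta_multi.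
apply: (@wsum_linF k A H w s E (scalars N) r a (fun e => nbeta x e m)) => b l.
exact: bN.1.
Qed.

Lemma nact_linear s h : linear (@nact s h).
Proof.
move=> d x y; apply/funext => a; apply/funext => m.
apply: (@swe_linearF k H nc (scalars N) h
  (fun x p r => wsum w s r a (nbeta x (c p) m))) => p r.
apply: (@wsum_linF k A H w s nc (scalars N) r a (fun x => nbeta x (c p) m)) => b l.
move=> d' x' y'; exact: (bN.2 (c p)).
Qed.

Lemma nact_good s h x : good _ _ s x -> good _ _ s (nact s h x).
Proof.
move=> [mx nx]; split; first split.
- move=> a; apply: swe_linearF => p r.
  apply: (@wsum_linF k A H w s (scalars M) (scalars N) r a (fun m => nbeta x (c p) m)) => b l.
  by rewrite /nbeta; have lx := multi_lin mx b; lin.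
- move=> a i m js; apply: swe_linearF => p r.
  by apply: wsum_sub => //; apply: nbeta_multi.
- by move=> a b ab; apply/funext => m; apply: swe_ext => p r; apply: wsum_dep.
move=> a i d js ai; apply/funext => m; apply: big1 => -[p r] _ /=.
apply: (@wsum_normal k A H w s _ r a i d) => // b l d' bi.
by rewrite /nbeta (nx b i d') //; apply: (lin0 (bN.2 _)).
Qed.

(** Face 0 commutes with the action by [cinv_act], the inner faces by multiplicativity of the weak
    action, and the last face by [cpure_mulH]. *)
Lemma nact_face s i h x : multi s x -> (i < s.+2)%N ->
  nact s.+1 h (face s i x) = face s i (nact s h x).
Proof.
move=> mx il; apply/funext => a; apply/funext => m.
case: i il => [|i] il.
  have bG := nbeta_bilin (nshift a) m mx.
  set G := (fun e r => _) in bG.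
  transitivity (\sw_(p, r <- h) \sw_(y, t <- r) G (c p * (w y (a 0%N) ## 1)) t).
    apply: swe_ext => p r; apply: swe_ext => y t; apply: wsum_ext => b l.
    by rewrite /nbeta -ractM.
  transitivity (\sw_(z, t <- h) G ((a 0%N ## 1) * c z) t).
    rewrite -(swe_assoc (F := fun p y t => G (c p * (w y (a 0%N) ## 1)) t)); last lin.
    apply: swe_ext => z t; rewrite -(cinv_act wf fV).
    by rewrite (swe_comp (g := fun e => G e t)) //; lin.
  rewrite /face -[RHS]/(ract (a 0%N ## 1) (nact s h x (nshift a) m)) /nact.
  have lr : linear (ract (M := N) (a 0%N ## 1)) by lin.
  rewrite (swe_comp _ _ lr); apply: swe_ext => z t.
  rewrite (wsum_comp _ _ _ _ _ lr); apply: wsum_ext => b l.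
  by rewrite /nbeta ractM.
have [is1|is1] := ltnP i s.
  rewrite [RHS]/face is1; apply: swe_ext => p r; rewrite -wsum_merge //; last exact: nbeta_multi.
  by apply: (@wsum_ext k A H w s.+1) => b l; rewrite /nbeta /face is1.
have {is1 il} -> : i = s by lia.
rewrite [RHS]/face ltnn; apply: swe_ext => p r; rewrite wsum_last; last first.
  exact/nbeta_multi/face_multi.
apply: wsum_ext => b l; rewrite /nbeta; have lx := multi_lin mx b.
transitivity (\sw_(y, t <- l) ract (c p) (x b (ract ((w y (a s) ## 1) * (1 ## t)) m))).
  apply: swe_ext => y t; rewrite -ractM /face ltnn nsub_same.
  by rewrite (multi_upd _ _ mx).
rewrite [am_act _ _ _]/(ract (a s ## 1) m) ractM cpure_mulH.
rewrite (swe_comp (g := fun e => ract (c p) (x b (ract e m)))); last lin.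
by apply: swe_ext => y t; rewrite -cpure_decomp.
Qed.

Lemma nact_hoch s h x : multi s x -> nact s.+1 h (hoch s x) = hoch s (nact s h x).
Proof.
move=> mx; rewrite /hoch (lin_sum (@nact_linear s.+1 h)); apply: eq_bigr => i _.
by rewrite (linZ (@nact_linear s.+1 h)) nact_face.
Qed.

Lemma nact0 h x a m : multi 0 x -> nact 0 h x a m =
  \sw_(p, r <- h) ract (c p) (x a (ract (1 ## r) m)).
Proof.
by move=> mx; apply: swe_ext => p r; rewrite /= /nbeta (multi_dep mx (b := a)).
Qed.

End OneModule.

Lemma nact_comp (M M' N : lmodType E) (g : M' -> M) s h (x : nc (amodE M) (amodE N)) :
  linear g -> nact s h (fun a (m : amodE M') => x a (g m)) =
    (fun a m => nact s h x a (g m)) :> nc (amodE M') (amodE N).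
Proof.
move=> lg; apply/funext => a; apply/funext => m.
apply: swe_ext => p r; apply: wsum_ext => b l.
by rewrite /nbeta (lin_ract _ _ lg).
Qed.

End CochainAction.

Section EndomorphismsOfBicomplexes.
Variables (k : pzRingType) (X : bicomplex k).
Variable F : forall s t, X s t -> X s t.
Hypothesis F_lin : forall s t, linear (@F s t).
Hypothesis F_sub : forall s t x, bi_sub X x -> bi_sub X (@F s t x).
Hypothesis F_d1 : forall s t x, bi_sub X x -> bi_d1 X (@F s t x) = F (bi_d1 X x).
Hypothesis F_d2 : forall s t x, bi_sub X x -> bi_d2 X (@F s t x) = F (bi_d2 X x).

Definition biprod_map (x : biprod X) : biprod X := fun s t => F (x s t).

Lemma biprod_map_tdeg n x : tdeg X n x -> tdeg X n (biprod_map x).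
Proof.
move=> [Gx x0]; split=> s t; first exact: F_sub.
by move=> st; rewrite /biprod_map x0 // (lin0 (@F_lin s t)).
Qed.

Lemma biprod_map_tot n x : tdeg X n x -> tot X (biprod_map x) = biprod_map (tot X x).
Proof.
move=> [Gx _]; apply: biprodP => s t; rewrite /biprod_map.
by case: s => [|s]; case: t => [|t]; rewrite !totE ?(lin0 (@F_lin _ _)) ?F_d1 ?F_d2
  ?(linD (@F_lin _ _)).
Qed.

Lemma erel_map (B : edge X) n (b b' : B n) x :
  edge_inj B n b' = F (edge_inj B n b) -> erel b x -> erel b' (biprod_map x).
Proof.
move=> bb [y [Cy yS y0]]; exists (biprod_map y).
have e s t : (biprod_map x - tot X (biprod_map y)) s t = F ((x - tot X y) s t).
  by rewrite (biprod_map_tot Cy) biprodB -(linB (@F_lin s t)).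
split=> [|s t|]; first exact: biprod_map_tdeg.
  by rewrite e yS (lin0 (@F_lin _ _)).
by rewrite e y0 bb.
Qed.

End EndomorphismsOfBicomplexes.

(** An operator on the whole double complex maps a linking total cocycle to a linking total cocycle,
    which carries an action from one edge to the other. *)
Lemma balance_map (k : pzRingType) (X : bicomplex k) (F : forall s t, X s t -> X s t)
    (B1 : edge X) (B2 : edge (btr X)) n (b2 b2' : B2 n) (b1 b1' : B1 n) :
  (forall s t, linear (@F s t)) ->
  (forall s t x, bi_sub X x -> bi_sub X (@F s t x)) ->
  (forall s t x, bi_sub X x -> bi_d1 X (@F s t x) = @F s.+1 t (bi_d1 X x)) ->
  (forall s t x, bi_sub X x -> bi_d2 X (@F s t x) = @F s t.+1 (bi_d2 X x)) ->
  edge_inj B1 n b1' = @F 0%N n (edge_inj B1 n b1) ->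
  edge_inj B2 n b2' = @F n 0%N (edge_inj B2 n b2) ->
  balance b2 b1 -> balance b2' b1'.
Proof.
move=> lF sF F1 F2 e1 e2 [x [Cx Dx r2 r1]]; exists (biprod_map F x); split.
- exact: biprod_map_tdeg.
- rewrite (@biprod_map_tot k X F lF F1 F2 _ _ Cx) Dx.
  by apply: biprodP => s t; apply: (lin0 (lF s t)).
- exact: (@erel_map k (btr X) (fun s t => @F t s) (fun s t => lF t s)
    (fun s t => sF t s) (fun s t => F2 t s) (fun s t => F1 t s) B2 n b2 b2').
exact: (erel_map lF sF F1 F2 e1 r1).
Qed.

Section CochainsOnSequences.
Variables (k : fieldType) (A : algType k) (H : hopfAlgebra k).
Variables (w : weakAction A H) (f finv : {linear tensor H H -> A}).
Variables (wf : is_crossed_product w f) (M N : lmodType (crossed wf)).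
Local Notation nc := (nc (amodE M) (amodE N)).

(** The padding 0 is a default, beyond the entries that a cochain of degree $s$ reads. *)
Definition ord_extend s (a : 'I_s -> A) : nat -> A :=
  fun j => if insub j is Some i then a i else 0.

Definition cnat s (phi : cochain M N s) : nc := fun a => phi (fun i : 'I_s => a i).

Definition cres s (x : nc) : cochain M N s := fun a => x (ord_extend a).

Lemma ord_extendE s (a : 'I_s -> A) (i : 'I_s) : ord_extend a i = a i.
Proof. by rewrite /ord_extend valK. Qed.

Lemma cnatK s : cancel (@cnat s) (@cres s).
Proof.
move=> phi; apply/funext => a; rewrite /cres /cnat; congr phi.
by apply/funext => i; rewrite ord_extendE.
Qed.

Lemma cresK s x : multi s x -> cnat (cres x : cochain M N s) = x.
Proof.
move=> mx; apply/funext => b; apply: (multi_dep mx) => j js.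
exact: (ord_extendE (fun i : 'I_s => b i) (Ordinal js)).
Qed.

Lemma cnat_hoch s (phi : cochain M N s) : cnat (hochschild_d phi) = hoch s (cnat phi).
Proof.
apply/funext => a; apply/funext => m; rewrite /hoch !fct_sumE big_ord_recl.
rewrite [(_ *: _) a m]scale1r big_ord_recr /= addrA; congr (_ + _ + _).
  apply: eq_bigr => i _; rewrite -[RHS]/((-1) ^+ i.+1 *: face s i.+1 (cnat phi) a m).
  rewrite /face ltn_ord /cnat; congr (_ *: phi _ m); apply/funext => j.
  rewrite /merge_args /nmerge -val_eqE /=.
  by case: ltnP => // _; case: eqP => // ->.
by rewrite -[RHS]/((-1) ^+ s.+1 *: face s s.+1 (cnat phi) a m) /face ltnn.
Qed.

Lemma cnat_good s (phi : cochain M N s) : normalized_cochain phi <-> good _ _ s (cnat phi).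
Proof.
have subE (b : nat -> A) (i : 'I_s) y :
    (fun j : 'I_s => nsub b i y j) = subst_arg (fun j : 'I_s => b j) i y.
  by apply/funext => j; rewrite /nsub /subst_arg -val_eqE.
split=> [[[l1 l2] n]|[[l1 l2 _] n]].
  split; first split.
  - by move=> a; apply: l1.
  - move=> a i m js z y y'; rewrite /cnat !(subE a (Ordinal js)).
    exact: (congr1 (fun g => g m) (l2 (fun j : 'I_s => a j) (Ordinal js) z y y')).
  - by move=> a b ab; rewrite /cnat; congr phi; apply/funext => i; apply: ab.
  move=> a i d js ai; exact: (n _ (Ordinal js) d).
rewrite -[phi]cnatK; set x := cnat phi in l1 l2 n *.
have e (a : 'I_s -> A) i y : cres x (subst_arg a i y) = x (nsub (ord_extend a) i y).
  rewrite /cres /x /cnat; congr phi; apply/funext => j.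
  by rewrite ord_extendE /subst_arg /nsub -val_eqE; case: eqP => // _; rewrite ord_extendE.
split; first split.
- by move=> a; apply: l1.
- move=> a i z y y'; apply/funext => m; rewrite !e.
  exact: (l2 (ord_extend a) i m (ltn_ord i) z y y').
move=> a i d ai; apply: (n _ i d) => //.
by rewrite ord_extendE.
Qed.

Lemma cnat_act s h (phi : cochain M N s) :
  cnat (cochain_act finv h phi) = nact finv s h (cnat phi).
Proof.
apply/funext => a; apply/funext => m.
rewrite /cnat /cochain_act /nact /= big_allpairs_dep.
apply: eq_bigr => -[p r] _ /=; rewrite -sweedler_wsum; apply: eq_bigr => v _.
rewrite /nbeta /cnat; congr (ract _ (phi _ _)).
by apply/funext => i; rewrite ltn_ord.
Qed.

End CochainsOnSequences.

(** * Equivariant comparison of Hom_A(Q, N) with Hochschild cochains *)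

Section InducedAction.
Variables (k : fieldType) (A : algType k) (H : hopfAlgebra k).
Variables (w : weakAction A H) (f finv : {linear tensor H H -> A}).
Variables (wf : is_crossed_product w f) (fV : conv_inverse f finv).
Local Notation E := (crossed wf).
Local Notation Hc := ((H : algType k)^c).
Variables (M N : lmodType E) (Q : projResolution M).

Let dU_lin t : linear (pres_d Q t : amodE (Q t.+1) -> amodE (Q t)) :=
  scalars_linear (linearP (pres_d Q t)).
Let dU_act t a (u : amodE (Q t.+1)) :
    (pres_d Q t (am_act (amodE (Q t.+1)) a u) : amodE (Q t)) =
    am_act (amodE (Q t)) a (pres_d Q t u) :=
  lin_ract _ _ (linearP (pres_d Q t)).
Let aug_lin : linear (pres_aug Q : amodE (Q 0%N) -> amodE M) :=
  scalars_linear (linearP (pres_aug Q)).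
Let aug_act a (u : amodE (Q 0%N)) : (pres_aug Q (am_act (amodE (Q 0%N)) a u) : amodE M) =
    am_act (amodE M) a (pres_aug Q u) :=
  lin_ract _ _ (linearP (pres_aug Q)).

Let X := hoch_bicomplex (amodE N) dU_lin dU_act (@pres_exact _ _ Q).
Let B1 : edge X := linA_edge (amodE N) dU_lin dU_act (@pres_exact _ _ Q).
Let B2 : edge (btr X) := hoch_edge (amodE N) dU_lin aug_lin dU_act aug_act
  (@pres_surj _ _ Q) (@pres_exact0 _ _ Q) (@pres_exact _ _ Q).

Local Notation LA s := (@linA_sub k A (amodE N) (fun t => amodE (Q t)) s).

(** [nact] commutes with both differentials. On 0-cochains it is the action on Hom_A(Q_s, N), and
    through the augmentation it is [cochain_act]. *)
Lemma balance_act s h (phi : cochain M N s) (b b' : B1 s) :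
  val (b' : subspace (LA s)) =
    homA_act_fun finv h (val (b : subspace (LA s)) : scalars (Q s) -> scalars N) ->
  balance (cnat phi : B2 s) b -> balance (cnat (cochain_act finv h phi) : B2 s) b'.
Proof.
move=> bE; apply: (@balance_map k X (fun s t => @nact k A H w f finv wf (Q t) N s h) B1 B2).
- by move=> s' t; apply: nact_linear.
- by move=> s' t x; apply: nact_good.
- by move=> s' t x [mx _]; symmetry; apply: nact_hoch.
- move=> s' t x _.
  pose xd : nc (amodE (Q t.+1)) (amodE N) :=
    fun a u => (x : nc (amodE (Q t)) (amodE N)) a (pres_d Q t u).
  rewrite -[RHS]/(nact finv s' h ((-1) ^+ s' *: xd)).
  rewrite (linZ (@nact_linear k A H w f finv wf (Q t.+1) N s' h)).
  congr (_ *: _); symmetry; exact: (nact_comp finv s' h x (linearP (pres_d Q t))).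
- apply/funext => a; apply/funext => u.
  rewrite -[LHS]/(val (b' : subspace (LA s)) u) bE nact0 //.
  by split=> // a'; case: (@subspaceP _ _ (LA s) b).
rewrite -[RHS]/(nact finv s h (fun a u => cnat phi a (pres_aug Q u))).
by rewrite nact_comp; [rewrite -cnat_act | exact: linearP].
Qed.

Lemma cocycleP s (phi : cochain M N s) :
  hoch_cocycle phi <-> ecoc (cnat phi : B2 s).
Proof.
split=> [[n d]|[g d]]; split.
- exact/cnat_good.
- by rewrite -[LHS]/(hoch s (cnat phi)) -cnat_hoch d.
- exact/cnat_good.
by rewrite -[hochschild_d phi]cnatK cnat_hoch [hoch s _]d.
Qed.

Lemma coboundaryP s (phi : cochain M N s) :
  hoch_coboundary phi <-> ecob (cnat phi : B2 s).
Proof.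
case: s phi => [|s] phi; split=> [].
- by move=> e; rewrite [phi]e.
- by move=> e; rewrite -[phi]cnatK [cnat phi]e.
- by case=> psi n ->; exists (cnat psi); [apply/cnat_good | rewrite cnat_hoch].
case=> x gx e; have [mx _] := gx; exists (cres x).
  by apply/cnat_good; rewrite cresK.
by rewrite -[phi]cnatK e -[RHS]cnatK cnat_hoch cresK.
Qed.

Lemma homA_linA s (g : homAQ fV N Q s) : linA_set (N := amodE N) (U := fun t => amodE (Q t))
  (homA_val g).
Proof. exact: homA_valP. Qed.

Lemma ecoc_homA s (g : homAQ fV N Q s) (b : B1 s) :
  val (b : subspace (LA s)) = homA_val g -> homAQ_d fV N Q s g = 0 <-> ecoc b.
Proof.
move=> bg; split=> [e|[_ e]].
  split=> //; apply: val_inj; apply/funext => u.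
  transitivity (homA_val g (pres_d Q s u)); first by rewrite -bg.
  exact: (congr1 (fun g' => homA_val g' u) e).
apply: homA_inj; apply/funext => u.
transitivity (val (b : subspace (LA s)) (pres_d Q s u)); first by rewrite bg.
exact: (congr1 (fun g' => val (g' : subspace (LA s.+1)) u) e).
Qed.

Lemma linA_homA s (b : B1 s) : exists g : homAQ fV N Q s,
  homA_val g = val (b : subspace (LA s)).
Proof.
by exists (@subel _ _ (homA_sub (Q s) N) _ (@subspaceP _ _ (LA s) b)).
Qed.

Lemma ecob_homA s (g : homAQ fV N Q s) (b : B1 s) :
  val (b : subspace (LA s)) = homA_val g ->
  ecob b <-> cobd (homAQ_d fV N Q) s g.
Proof.
case: s g b => [|s] g b bg; split=> [].
- by move=> e; apply: homA_inj; rewrite -bg [b]e.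
- by move=> e; apply: val_inj; rewrite bg [g]e.
- case=> b' _ e; have [g' gb'] := linA_homA b'; exists g'.
  by apply: homA_inj; rewrite -bg e; apply/funext => u; rewrite -[RHS]/(_ _) /= -gb'.
case=> g' e; exists (@subel _ _ (LA s) _ (homA_linA g')) => //.
by apply: val_inj; rewrite bg -e.
Qed.

Lemma homAQ_induced s : induced_module M N finv s (homAQ_cohom fV N Q s).
Proof.
have ex1 : exact1 X.
  by apply: hoch_exact1 => t; apply: amodE_section; apply: pres_proj.
have ex2 : exact1 (btr X) by apply: hoch_exact2.
pose Z := kernel (homAQ_d fV N Q s); pose bd := cobd (homAQ_d fV N Q) s.
pose rho (u : HochH M N s) (v : scalars (homAQ_cohom fV N Q s)) :=
  exists (z : subspace (hoch_cocycles M N s)) (y : subspace Z) (b : B1 s),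
  [/\ balance (cnat (val z) : B2 s) b,
      val (b : subspace (LA s)) = homA_val (val y),
      u = subquot_class (hoch_coboundaries M N s) z & v = subquot_class bd y].
have yP (b : B1 s) : ecoc b -> exists y : subspace Z,
    val (b : subspace (LA s)) = homA_val (val y).
  move=> cb; have [g gb] := linA_homA b.
  have Zg : Z g by apply/(ecoc_homA (b := b)).
  by exists (@subel _ _ Z _ Zg).
have yc (y : subspace Z) (b : B1 s) :
    val (b : subspace (LA s)) = homA_val (val y) -> ecoc b.
  by move=> e; apply/(ecoc_homA e); apply: (subspaceP y).
have zc (z : subspace (hoch_cocycles M N s)) : ecoc (cnat (val z) : B2 s).
  by apply/cocycleP; apply: (subspaceP z).
have [|u|v|u v|th bth thP] := @lin_rel_iso _ _ _ rho.
- move=> a _ _ _ _ [z [y [b [r e -> ->]]]] [z' [y' [b' [r' e' -> ->]]]].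
  exists (a *: z + z'), (a%:A *: y + y'), (a *: b + b'); split.
  + have -> : cnat (val (a *: z + z')) = a *: cnat (val z) + cnat (val z') by [].
    exact: (@balance_linear k X B1 B2 s a (cnat (val z)) (cnat (val z')) b b').
  + have -> : val (a *: b + b') = a *: val (b : subspace (LA s)) + val (b' : subspace (LA s)) by [].
    rewrite e e'; exact: (esym (homA_klinear a (val y) (val y'))).
  + by rewrite subquot_class_linear.
  by rewrite [RHS]subquot_class_linear.
- elim/subquot_ind: u => z; have [b cb r] := balance_left B1 ex1 (zc z).
  have [y yb] := yP b cb.
  by exists (subquot_class bd y), z, y, b.
- elim/subquot_ind: v => y; pose b : B1 s := @subel _ _ (LA s) _ (homA_linA (val y)).
  have cb : ecoc b by apply: (yc y).
  have [x cx r] := balance_right B2 ex2 cb; have [[mx nx] _] := cx.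
  have Zx : hoch_cocycles M N s (cres (x : nc (amodE M) (amodE N))).
    by apply/cocycleP; rewrite cresK.
  exists (subquot_class (hoch_coboundaries M N s) (@subel _ _ (hoch_cocycles M N s) _ Zx)).
  by exists (@subel _ _ (hoch_cocycles M N s) _ Zx), y, b; split=> //; rewrite /= cresK.
- move=> [z [y [b [r e -> ->]]]]; rewrite subquot_class_eq0.
  rewrite (@subquot_class_eq0 _ _ Z bd y).
  rewrite -(ecob_homA e) -(balance_ker ex1 ex2 (zc z) (yc y b e) r).
  exact: coboundaryP.
exists th => // h z.
have Zz' : hoch_cocycles M N s (cochain_act finv h (val z)).
  apply/cocycleP; have [[m1 m2] d] := zc z; split; rewrite cnat_act.
    exact: nact_good.
  rewrite -[LHS]/(hoch s (nact finv s h (cnat (val z)))) -(nact_hoch fV) //.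
  by rewrite [hoch s _]d (lin0 (@nact_linear k A H w f finv wf M N s.+1 h)).
exists (@subel _ _ (hoch_cocycles M N s) _ Zz') => //.
have [b0 cb0 r0] := balance_left B1 ex1 (zc z); have [y0 yb0] := yP b0 cb0.
have -> : th (subquot_class (hoch_coboundaries M N s) z) = subquot_class bd y0.
  by apply/thP; exists z, y0, b0.
transitivity (subquot_class bd ((h : Hc) *: y0)); last first.
  exact: (linZ (@subquot_class_linear _ _ Z bd) (h : Hc) y0).
apply/thP.
(* Applying [nact] to the total cocycle that links [z] and [b0] links their images under [h]; hence
   [th] is equivariant. *)
pose b' : B1 s := @subel _ _ (LA s) _ (homA_linA (val ((h : Hc) *: y0))).
exists (@subel _ _ (hoch_cocycles M N s) _ Zz'), ((h : Hc) *: y0), b'; split=> //.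
apply: (balance_act _ r0); apply/funext => q.
by rewrite yb0.
Qed.

End InducedAction.

Lemma Ext_kiso (k : fieldType) (R : algType k) (M N N' : lmodType R)
    (P : projResolution M) n : kiso N N' -> kiso (Ext N P n) (Ext N' P n).
Proof.
move=> [g [g' gK g'K]].
have lg' : linear g' by move=> a x y; apply: (can_inj gK); rewrite linearP !g'K.
have lgk := scalars_linear (linearP g).
apply: (subquot_kiso (R := fun (x : P n -> scalars N) (y : P n -> scalars N') =>
  y = g \o x)) => [a x x' _ _ -> ->|x [lx dx]|y [ly dy]|x y [lx dx] [ly dy] ->].
- by apply/funext => u; rewrite /= lgk.
- exists (g \o x) => //; split=> [a u v|u] /=; first by rewrite lx linearP.
  by rewrite dx; apply: linear0.
- exists (g' \o y); last by apply/funext => u /=; rewrite g'K.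
  split=> [a u v|u] /=; first by rewrite ly lg'.
  by rewrite dy; apply: (lin0 lg').
case: n x y lx dx ly dy => [|n] x y lx dx ly dy; split=> [].
- by move=> e; rewrite [x]e; apply/funext => u; apply: linear0.
- move=> e; apply/funext => u; apply: (can_inj gK).
  by rewrite [LHS](congr1 (fun h => h u) e); symmetry; apply: linear0.
- by case=> z lz ->; exists (g \o z) => // a u v /=; rewrite lz linearP.
case=> z lz e; exists (g' \o z) => [a u v|] /=; first by rewrite lz lg'.
apply/funext => u; apply: (can_inj gK); rewrite /= g'K.
exact: (congr1 (fun h => h u) e).
Qed.

Section InducedModules.
Variables (k : fieldType) (A : algType k) (H : hopfAlgebra k).
Variables (w : weakAction A H) (f finv : {linear tensor H H -> A}).
Variables (wf : is_crossed_product w f) (fV : conv_inverse f finv).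
Variables M N : lmodType (crossed wf).

(** In both structures [h] sends the class of [z] to that of [cochain_act h z], so the composite of
    the two identifications with [HochH] is [H]-linear. *)
Lemma induced_module_unique s (L L' : lmodType (H : algType k)^c) :
  induced_module M N finv s L -> induced_module M N finv s L' -> kiso L L'.
Proof.
move=> [th [thV thK thVK] thA] [th' bth' th'A].
have lV : linear thV by move=> a x y; apply: (can_inj thK); rewrite linearP !thVK.
have lg : linear (fun x : L => th' (thV x) : L').
  move=> h x y.
  have -> : thV (h *: x + y) = thV (h *: x) + thV y :=
    linD lV (h *: x : scalars L) (y : scalars L).
  rewrite (linearD th'); congr (_ + _).
  rewrite -{1}[x]thVK; elim/subquot_ind: (thV x) => z.
  have [z1 z1E <-] := thA h z; have [z2 z2E <-] := th'A h z.
  by rewrite thK; congr (th' (subquot_class _ _)); apply: val_inj; rewrite z1E z2E.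
exists (lin_pack lg); case: bth' => th'V th'K th'VK.
by exists (th \o th'V) => x /=; rewrite ?th'K ?thVK ?thK ?th'VK.
Qed.

Lemma crossed_spectral_sequence : exists L : nat -> lmodType (H : algType k)^c,
  (forall s, induced_module M N finv s (L s)) /\
  (forall (P : projResolution (trivial_module H)) (Q : projResolution M),
    exists ss : spectralSequence k,
      (forall r s, kiso (page ss 2 r s) (Ext (L s) P r)) /\
      converges ss (Ext N Q)).
Proof.
(* [L] has to be fixed before [Q] is given. The canonical resolution provides it, and uniqueness of
   induced modules identifies it with the coefficients computed from [Q]. *)
exists (homAQ_cohom fV N (can_res M)); split=> [s|P Q]; first exact: homAQ_induced.
have [ss [p2 cv]] := crossed_ss fV N P Q; exists ss; split=> // r s.
apply: kiso_trans (p2 r s) _; apply: Ext_kiso.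
by apply: (@induced_module_unique s); apply: homAQ_induced.
Qed.

End InducedModules.

(** * Vanishing of cohomology and global dimension *)

Section HopfHom.
Variables (k : fieldType) (H : hopfAlgebra k).
Local Notation S := (antipode H).
Local Notation Hc := ((H : algType k)^c).
Variables (W : lmodType H) (P X : lmodType Hc).
Let bW := @ract_bilin k H W.
Let bP : bilin (rmul (P := P)) := rmul_bilin P.
Let bX : bilin (rmul (P := X)) := rmul_bilin X.

Definition homR_act (h : Hc) (g : scalars W -> scalars X) : scalars W -> scalars X :=
  fun u => \sw_(h1, h2 <- (h : H)) rmul h2 (g (ract h1 u)).

(** Only [S] itself occurs, no inverse of it: linearity into [homR] in one variable and into [homL]
    in the other are the same condition on a map of two variables. *)
Definition homL_act (h : H) (g : scalars P -> scalars X) : scalars P -> scalars X :=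
  fun p => \sw_(h1, h2 <- h) rmul (S h2) (g (rmul h1 p)).

Fact homR_lin h g : linear g -> linear (homR_act h g).
Proof. by move=> lg; rewrite /homR_act; lin. Qed.

Fact homRA a b g : linear g -> homR_act a (homR_act b g) = homR_act (a * b) g.
Proof.
move=> lg; apply/funext => u; rewrite [RHS](swe_mul (b : H) (a : H)); last lin.
rewrite [RHS]swe_exchange; apply: swe_ext => a1 a2.
have lr : linear (rmul (P := X) a2) by lin.
rewrite (swe_comp _ _ lr); apply: swe_ext => b1 b2.
by rewrite rmulM ractM.
Qed.

Fact homR1 g : linear g -> homR_act 1 g = g.
Proof.
move=> lg; apply/funext => u; rewrite /homR_act swe_1; last lin.
by rewrite /rmul /ract !scale1r.
Qed.

Fact homRDl a b g : linear g -> homR_act (a + b) g = homR_act a g + homR_act b g.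
Proof.
move=> lg; apply/funext => u.
have l : linear (fun h : H => homR_act h g u) by rewrite /homR_act; lin.
exact: linD l a b.
Qed.

Fact homRDr a g g' : homR_act a (g + g') = homR_act a g + homR_act a g'.
Proof.
apply/funext => u; rewrite -[RHS]/(homR_act a g u + homR_act a g' u) /homR_act /swe -big_split; apply: eq_bigr => x _.
by rewrite fctE /rmul /ract scalerDr.
Qed.

Definition homR : lmodType Hc := linmod (LinAction homR_lin homRA homR1 homRDl homRDr).

Fact homL_lin h g : linear g -> linear (homL_act h g).
Proof. by move=> lg; rewrite /homL_act; lin. Qed.

Fact homLA a b g : linear g -> homL_act a (homL_act b g) = homL_act (a * b) g.
Proof.
move=> lg; apply/funext => p; rewrite [RHS]swe_mul; last lin.
apply: swe_ext => a1 a2.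
have lr : linear (rmul (P := X) (S a2)) by lin.
rewrite (swe_comp _ _ lr); apply: swe_ext => b1 b2.
by rewrite !rmulM antipodeM.
Qed.

Fact homL1 g : linear g -> homL_act 1 g = g.
Proof.
move=> lg; apply/funext => p; rewrite /homL_act swe_1; last lin.
by rewrite antipode1 /rmul /ract !scale1r.
Qed.

Fact homLDl a b g : linear g -> homL_act (a + b) g = homL_act a g + homL_act b g.
Proof.
move=> lg; apply/funext => p.
have l : linear (fun h : H => homL_act h g p) by rewrite /homL_act; lin.
exact: linD l a b.
Qed.

Fact homLDr a g g' : homL_act a (g + g') = homL_act a g + homL_act a g'.
Proof.
apply/funext => p; rewrite -[RHS]/(homL_act a g p + homL_act a g' p) /homL_act /swe -big_split; apply: eq_bigr => x _.
by rewrite fctE /rmul /ract scalerDr.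
Qed.

Definition homL : lmodType H := linmod (LinAction homL_lin homLA homL1 homLDl homLDr).

Lemma homR_scalar a g : linear g -> homR_act (a%:A : H) g = a *: g.
Proof.
move=> lg; apply/funext => u.
have l : linear (fun h : H => homR_act h g u) by rewrite /homR_act; lin.
by rewrite [LHS](linZ l a 1) homR1.
Qed.

Lemma homR_klinear : linear (@linval _ _ _ _ _ : scalars homR -> scalars W -> scalars X).
Proof.
by move=> a x y; rewrite -(homR_scalar _ (linvalP (x : homR))).
Qed.

Lemma homL_scalar a g : linear g -> homL_act (a%:A : H) g = a *: g.
Proof.
move=> lg; apply/funext => p.
have l : linear (fun h : H => homL_act h g p) by rewrite /homL_act; lin.
by rewrite [LHS](linZ l a 1) homL1.
Qed.

Lemma homL_klinear : linear (@linval _ _ _ _ _ : scalars homL -> scalars P -> scalars X).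
Proof.
by move=> a x y; rewrite -(homL_scalar _ (linvalP (x : homL))).
Qed.

(* phi(p h, u) = phi(p, h^(1) u) h^(2) for all h if and only if
   phi(p, h u) = phi(p h^(1), u) S(h^(2)) for all h. *)
Lemma homR_to_homL (x : P -> homR) : linear x ->
  exists2 F : W -> homL, linear F & forall p u, linval (F u) p = linval (x p) u.
Proof.
move=> lx; have lxk := scalars_linear lx.
have lxp u : linear (fun p : scalars P => linval (x p) u).
  by move=> a p p'; rewrite lxk homR_klinear.
pose F u : homL := linel _ (lxp u); exists F => // h u v.
apply: linval_inj; apply/funext => p.
change (linval (x p) (ract h u + v) =
  homL_act h (fun p => linval (x p) u) p + linval (x p) v).
rewrite (linD (linvalP (x p))); congr (_ + _).
have xE l q : linval (x (rmul l q)) u =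
    \sw_(l1, l2 <- l) rmul l2 (linval (x q) (ract l1 u)).
  by rewrite /rmul /ract (linZ lx).
have lq := linvalP (x p); symmetry.
transitivity (\sw_(h1, r <- h) \sw_(a, b <- r) rmul (a * S b) (linval (x p) (ract h1 u))).
  transitivity (\sw_(t, h3 <- h) \sw_(h1, h2 <- t) rmul (h2 * S h3) (linval (x p) (ract h1 u))).
    apply: swe_ext => t h3; rewrite xE.
    have lr : linear (rmul (P := X) (S h3)) by lin.
    by rewrite (swe_comp _ _ lr); apply: swe_ext => h1 h2; rewrite rmulM.
  by rewrite (swe_assoc (F := fun h1 h2 h3 => rmul (h2 * S h3) (linval (x p) (ract h1 u)))); last lin.
rewrite (swe_cancelr h (M := fun a b => a * S b) (u := 1)
  (F := fun h1 z => rmul z (linval (x p) (ract h1 u)))); try lin.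
  by rewrite /rmul /ract scale1r.
by move=> y; apply: (swe_antipoder y (g := fun x => x)).
Qed.

Lemma homL_to_homR (F : W -> homL) : linear F ->
  exists2 x : P -> homR, linear x & forall p u, linval (F u) p = linval (x p) u.
Proof.
move=> lF; have lFk := scalars_linear lF.
have lFp p : linear (fun u : scalars W => linval (F u) p).
  by move=> a u u'; rewrite lFk homL_klinear.
pose x p : homR := linel _ (lFp p); exists x => // h p q.
apply: linval_inj; apply/funext => u.
change (linval (F u) (rmul h p + q) =
  homR_act h (fun u => linval (F u) p) u + linval (F u) q).
rewrite (linD (linvalP (F u))); congr (_ + _).
have FE l v : linval (F (ract l v)) p =
    \sw_(l1, l2 <- l) rmul (S l2) (linval (F v) (rmul l1 p)).
  by rewrite /ract (linZ lF).
have lq := linvalP (F u); symmetry.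
transitivity (\sw_(h1, r <- (h : H)) \sw_(a, b <- r) rmul (S a * b) (linval (F u) (rmul h1 p))).
  transitivity (\sw_(t, h3 <- (h : H)) \sw_(h1, h2 <- t) rmul (S h2 * h3) (linval (F u) (rmul h1 p))).
    apply: swe_ext => t h3; rewrite FE.
    have lr : linear (rmul (P := X) h3) by lin.
    by rewrite (swe_comp _ _ lr); apply: swe_ext => h1 h2; rewrite rmulM.
  by rewrite (swe_assoc (F := fun h1 h2 h3 => rmul (S h2 * h3) (linval (F u) (rmul h1 p)))); last lin.
rewrite (swe_cancelr (h : H) (M := fun a b => S a * b) (u := 1)
  (F := fun h1 z => rmul z (linval (F u) (rmul h1 p)))); try lin.
  by rewrite /rmul /ract scale1r.
by move=> y; apply: (swe_antipodel y (g := fun x => x)).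
Qed.

End HopfHom.

Section KernelEdge.
Variables (k : pzRingType) (X : bicomplex k).

Definition ker_edge_set t (x : X 0%N t) := bi_sub X x /\ bi_d1 X x = 0.

Fact ker_edge0 t : ker_edge_set (0 : X 0%N t).
Proof. by split; [apply: submod0 | apply: linear0]. Qed.

Fact ker_edgeP t a (x y : X 0%N t) :
  ker_edge_set x -> ker_edge_set y -> ker_edge_set (a *: x + y).
Proof.
move=> [Gx dx] [Gy dy]; split; first exact: submodP.
by rewrite linearP dx dy scaler0 addr0.
Qed.

Fact ker_edge_d t (x : X 0%N t) : ker_edge_set x -> ker_edge_set (bi_d2 X x).
Proof.
move=> [Gx dx]; split; first exact: bi_d2_sub.
by have := bi_d12 Gx; rewrite dx linear0 addr0.
Qed.

(** The tautological edge, for use where only its vanishing matters. *)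
Definition ker_edge : edge X := @Edge k X (fun t => X 0%N t)
  (fun t => Submod (@ker_edge0 t) (@ker_edgeP t)) (fun t => @bi_d2 k X 0%N t)
  (fun t => idfun) ker_edge_d (fun t x gx => proj1 gx) (fun t x gx => proj2 gx)
  (fun t x gx dx => ex_intro2 _ _ x (conj gx dx) erefl) (fun t x _ e => e)
  (fun t x _ => erefl).

End KernelEdge.

Section LeftTrivialModule.
Variables (k : fieldType) (H : hopfAlgebra k).

Definition ltrivial : Type := let _ := H in k.

HB.instance Definition _ := GRing.Zmodule.copy ltrivial k.

Definition ltriv_scale (h : H) (x : ltrivial) : ltrivial := (counit H h : k) * x.

Fact ltriv_scaleA a b x : ltriv_scale a (ltriv_scale b x) = ltriv_scale (a * b) x.
Proof. by rewrite /ltriv_scale counitM mulrA. Qed.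
Fact ltriv_scale1 : left_id 1 ltriv_scale.
Proof. by move=> x; rewrite /ltriv_scale counit1 mul1r. Qed.
Fact ltriv_scaleDr : right_distributive ltriv_scale +%R.
Proof. by move=> a x y; apply: mulrDr. Qed.
Fact ltriv_scaleDl x : {morph ltriv_scale^~ x : a b / a + b}.
Proof.
move=> a b; rewrite /ltriv_scale.
by rewrite (raddfD (counit H) a b : _ = counit H a + counit H b :> k) [LHS]mulrDl.
Qed.

HB.instance Definition _ := GRing.Zmodule_isLmodule.Build H ltrivial
  ltriv_scaleA ltriv_scale1 ltriv_scaleDr ltriv_scaleDl.
End LeftTrivialModule.

Section ExtOverHopf.
Variables (k : fieldType) (H : hopfAlgebra k).
Local Notation Hc := ((H : algType k)^c).
Local Notation ε := (counit H).
Variables (W : projResolution (ltrivial H)) (P : projResolution (trivial_module H)).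
Variable X : lmodType Hc.
Let bX : bilin (rmul (P := X)) := rmul_bilin X.

Definition homRW s : lmodType Hc := homR (W s) X.

Let ldW s := scalars_linear (linearP (pres_d W s)).

Definition homRW_d_fun s (g : homRW s) : homRW s.+1 :=
  linel _ (linear_comp_fun (linvalP g) (@ldW s)).

Fact homRW_d_linear s : linear (@homRW_d_fun s).
Proof.
move=> h x y; apply: linval_inj; apply/funext => u.
change (homR_act h (linval x) (pres_d W s u) + linval y (pres_d W s u) =
  homR_act h (fun u => linval x (pres_d W s u)) u + linval y (pres_d W s u)).
congr (_ + _); apply: swe_ext => h1 h2.
by rewrite -(lin_ract _ _ (linearP (pres_d W s))).
Qed.

Definition homRW_d s : {linear homRW s -> homRW s.+1} := lin_pack (@homRW_d_linear s).

Lemma homRW_dd s x : homRW_d s.+1 (homRW_d s x) = 0.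
Proof.
apply: linval_inj; apply/funext => u.
change (linval x (pres_d W s (pres_d W s.+1 u)) = 0).
by rewrite pres_dd; apply: lin0 (linvalP x).
Qed.

Local Notation K := (hom_bicomplex P homRW_dd).

Lemma homRW_exact1 : exact1 K.
Proof.
move=> r s x lx dx; have [F lF FE] := homR_to_homL lx.
have ldk n := scalars_linear (linearP (pres_d P n)).
pose pre (g : homL (P r) X) : homL (P r.+1) X :=
  linel _ (linear_comp_fun (linvalP g) (ldk r)).
have lpre : linear pre.
  move=> h g g'; apply: linval_inj; apply/funext => p.
  change (homL_act h (linval g) (pres_d P r p) + linval g' (pres_d P r p) =
    homL_act h (fun p => linval g (pres_d P r p)) p + linval g' (pres_d P r p)).
  congr (_ + _); apply: swe_ext => h1 h2.
  by rewrite /rmul -(lin_ract _ _ (linearP (pres_d P r))).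
have [c lc cE] := linear_factor (ldk r).
have [|G lG GE] := projective_lift (g := lin_pack lpre) (@pres_proj _ _ W s) lF.
  move=> u; have lg := linvalP (F u).
  exists (linel _ (linear_comp_fun lg lc)); apply: linval_inj; apply/funext => p.
  apply: cE => // p' /pres_exact[p'' <-]; rewrite FE.
  have e0 : x (pres_d P r.+1 p'') = 0 by apply: (congr1 (fun g => g p'') dx).
  by rewrite e0.
have [y ly yE] := homL_to_homR lG.
exists y => //; apply/funext => p; apply: linval_inj; apply/funext => u.
transitivity (linval (y (pres_d P r p)) u) => //.
by rewrite -yE -FE -GE.
Qed.

Lemma homRW_exact s (g : homRW s.+1) : homRW_d s.+1 g = 0 -> exists g', homRW_d s g' = g.
Proof.
move=> dg; have [c lc cE] := linear_factor (@ldW s).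
exists (linel _ (linear_comp_fun (linvalP g) lc)); apply: linval_inj; apply/funext => u.
apply: (cE _ _ (linvalP g)) => v /pres_exact[v' <-].
exact: (congr1 (fun g : homRW s.+2 => linval g v') dg).
Qed.

(** Over a field [homRW] is exact in positive degrees, and Hom_H(P_r, -) preserves this as [P r] is
    projective. *)
Lemma homRW_exact2 : exact1 (btr K).
Proof.
move=> s r x lx dx.
have [|y ly yE] := projective_lift (g := homRW_d s) (@pres_proj _ _ P r) lx.
  by move=> p; apply: homRW_exact; apply: (hom_d2_eq0 (dX := homRW_d) p dx).
pose y' : hom_mod P homRW r s := y.
exists ((-1) ^+ r *: y'); first exact: (submod_scale (Z := hom_sub P homRW r s)).
transitivity ((-1) ^+ r *: hom_d2 homRW_d y'); first exact: (linZ (@hom_d2_linear _ _ _ P _ homRW_d r s)).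
rewrite /hom_d2 scalerA -expr2 sqrr_sign scale1r.
by apply/funext => p; apply: yE.
Qed.

Definition augw (u : W 0%N) : k := pres_aug W u.

Lemma augw_act h (u : W 0%N) : augw (h *: u) = (ε h : k) * augw u.
Proof. by rewrite /augw linearZZ. Qed.

Lemma augw_klinear : linear (augw : scalars (W 0%N) -> k^o).
Proof.
move=> a u v; rewrite /augw -[LHS]/(pres_aug W (a%:A *: u + v) : k) linearP.
congr (_ + _); exact: (congr1 (fun z => z * augw u) (counit_scalar H a)).
Qed.

Lemma augw_d u : augw (pres_d W 0 u) = 0.
Proof. by have : pres_aug W (pres_d W 0 u) = 0 by apply/pres_exact0; exists u. Qed.

Fact linX_inj_lin (x : scalars X) : linear (fun u : scalars (W 0%N) => augw u *: x).
Proof. by have la := augw_klinear; lin. Qed.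

Definition linX_inj_fun r (g : P r -> scalars X) : hom_mod P homRW r 0%N :=
  fun p => linel _ (linX_inj_lin (g p)).

Fact linX_inj_linear r : linear (@linX_inj_fun r).
Proof.
move=> a g g'; apply/funext => p; apply: linval_inj.
rewrite [RHS](homR_klinear a (linX_inj_fun g p) (linX_inj_fun g' p)).
apply/funext => u; rewrite -[LHS]/(augw u *: (a *: g p + g' p)) scalerDr.
by rewrite scale_comm.
Qed.

Definition linX_sub r : submod (P r -> scalars X) :=
  @Submod k (P r -> scalars X) (fun g => linear (g : P r -> X))
    (@linear_zero_fct k Hc X (P r)) (@ext_linear_subproof k Hc X (P r)).

Fact linX_pre_linear r :
  linear (fun g : P r -> scalars X => (g \o pres_d P r : P r.+1 -> scalars X)).
Proof. by []. Qed.

Fact linX_pre_sub r (g : P r -> scalars X) :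
  linX_sub r g -> linX_sub r.+1 (g \o pres_d P r).
Proof. by move=> lg a x y /=; rewrite linearP lg. Qed.

Fact linX_inj_sub r (g : P r -> scalars X) : linX_sub r g -> hom_sub P homRW r 0%N (linX_inj_fun g).
Proof.
move=> lg h p p'; apply: linval_inj; apply/funext => u.
change (augw u *: g (h *: p + p') =
  homR_act h (fun u => augw u *: g p) u + augw u *: g p').
rewrite lg scalerDr; congr (_ + _); rewrite /homR_act.
rewrite -[LHS](swe_counitl (h : H) (g := fun h => augw u *: rmul h (g p))); last lin.
apply: swe_ext => h1 h2; rewrite augw_act -(linZ (bX.2 h2)) -scalerA.
by symmetry; exact: (linZ (bX.2 h2)).
Qed.

Fact linX_inj_d r (g : P r -> scalars X) : linX_sub r g -> hom_d2 homRW_d (linX_inj_fun g) = 0.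
Proof.
move=> _; rewrite /hom_d2 (_ : hom_post _ _ = 0) ?scaler0 //.
apply/funext => p; apply: linval_inj; apply/funext => u.
by rewrite -[LHS]/(augw (pres_d W 0 u) *: g p) augw_d scale0r.
Qed.

Lemma augw_one : exists u, augw u = 1.
Proof. exact: (pres_surj W (1 : k)). Qed.

Fact linX_inj_ker r (x : hom_mod P homRW r 0%N) : hom_sub P homRW r 0%N x ->
  hom_d2 homRW_d x = 0 -> exists2 g, linX_sub r g & linX_inj_fun g = x.
Proof.
move=> lx dx; have [u1 u11] := augw_one.
have xE p u : linval (x p : homRW 0%N) u = augw u *: linval (x p : homRW 0%N) u1.
  have lg := linvalP (x p : homRW 0%N).
  apply/eqP; rewrite -subr_eq0 -(linZ lg) -(linB lg); apply/eqP.
  have e0 : augw (u - (augw u *: (u1 : scalars (W 0%N)) : W 0%N)) = 0.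
    by rewrite (linB augw_klinear) (linZ augw_klinear) u11 [_ *: _]mulr1 subrr.
  have [v <-] : exists v, pres_d W 0 v = u - (augw u *: (u1 : scalars (W 0%N)) : W 0%N).
    by apply/pres_exact0.
  exact: (congr1 (fun g : homRW 1%N => linval g v) (hom_d2_eq0 p dx)).
exists (fun p => linval (x p : homRW 0%N) u1); last first.
  by apply/funext => p; apply: linval_inj; apply/funext => u; rewrite xE.
move=> h p p'; rewrite lx -[LHS]/(homR_act h (linval (x p : homRW 0%N)) u1 + linval (x p' : homRW 0%N) u1).
congr (_ + _).
rewrite -[RHS](swe_counitl (h : H) (g := fun h => rmul h (linval (x p : homRW 0%N) u1))); last lin.
apply: (@swe_ext k H (scalars X) (h : H)) => h1 h2; rewrite xE augw_act u11 mulr1.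
exact: (linZ (bX.2 h2)).
Qed.

Fact linX_inj0 r (g : P r -> scalars X) : linX_sub r g -> linX_inj_fun g = 0 -> g = 0.
Proof.
move=> _ e; have [u1 u11] := augw_one; apply/funext => p.
rewrite -[LHS]scale1r -u11.
exact: (congr1 (fun x : hom_mod P homRW r 0%N => linval (x p : homRW 0%N) u1) e).
Qed.

(** [homRW] is a resolution of [X], embedded by sending $x$ to the map [u |-> augw u *: x], so the
    kernel in the direction of [W] is Hom_H(P_r, X). *)
Definition linX_edge : edge (btr K) := @Edge k (btr K) (fun r => P r -> scalars X)
  linX_sub (fun r => lin_pack (@linX_pre_linear r)) (fun r => lin_pack (@linX_inj_linear r))
  linX_pre_sub linX_inj_sub linX_inj_d linX_inj_ker linX_inj0
  (fun r g _ => erefl).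

(** If $W_n = 0$ then Hom_k(W_n, X) is zero, and balancing against [linX_edge] kills Ext of right
    modules although [W] consists of left modules. *)
Lemma Ext_trivial_vanish n (e : Ext X P n) : (forall u : W n, u = 0) -> e = 0.
Proof.
move=> W0; elim/subquot_ind: e => g; apply/subquot_class_eq0; have [lg dg] := subspaceP g.
have c : ecoc (val g : linX_edge n) by split=> //; apply/funext => u; apply: dg.
have : ecob (val g : linX_edge n).
  apply: (edge_vanish (ker_edge K) homRW_exact1 homRW_exact2) c => x lx.
  apply/funext => p; apply: linval_inj; apply/funext => u; rewrite (W0 u).
  exact: lin0 (linvalP ((x : hom_mod P homRW 0%N n) p : homRW n)).
by case: n {W0 c} g lg dg => [|n] g lg dg.
Qed.

End ExtOverHopf.

Section Restriction.
Variables (k : fieldType) (A : algType k) (H : hopfAlgebra k).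
Variables (w : weakAction A H) (f : {linear tensor H H -> A}).
Variable wf : is_crossed_product w f.
Local Notation E := (crossed wf).

Definition resA (M : lmodType E) : Type := M.

Section OneModule.
Variable M : lmodType E.
HB.instance Definition _ := GRing.Zmodule.on (resA M).

Definition resA_scale (a : A) (m : resA M) : resA M := eact a (m : scalars M).

Fact resA_scaleA a b m : resA_scale a (resA_scale b m) = resA_scale (a * b) m.
Proof. exact: eactM. Qed.
Fact resA_scale1 : left_id 1 resA_scale.
Proof. exact: (@scale1r E M). Qed.
Fact resA_scaleDr : right_distributive resA_scale +%R.
Proof. by move=> a; apply: scalerDr. Qed.
Fact resA_scaleDl m : {morph resA_scale^~ m : a b / a + b}.
Proof. exact: (linD ((eact_bilin M).1 m)). Qed.

HB.instance Definition _ := GRing.Zmodule_isLmodule.Build A (resA M)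
  resA_scaleA resA_scale1 resA_scaleDr resA_scaleDl.
End OneModule.

(** The Hochschild double complex is taken over an [A]-projective resolution of the restriction of
    [M], whose term in degree $n$ is zero. *)
Lemma HochH_vanish (M N : lmodType E) (P : projResolution (resA M)) n (z : HochH M N n) :
  (forall u : P n, u = 0) -> z = 0.
Proof.
move=> P0; elim/subquot_ind: z => z; apply/subquot_class_eq0.
have [nz dz] := subspaceP z.
have gz : good (amodE M) (amodE N) n (cnat (val z)) by apply/cnat_good.
have hz : hoch n (cnat (val z)) = 0 by rewrite -cnat_hoch dz.
have dlin t : linear (pres_d P t : amodA (P t.+1) -> amodA (P t)).
  exact: scalars_linear (linearP (pres_d P t)).
have alin : linear (pres_aug P : amodA (P 0%N) -> amodE M).
  move=> a u v; apply: etrans (linearP (pres_aug P) a%:A u v) _.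
  exact: (congr1 (fun y : amodE M => y + pres_aug P v) (@am_scalar k A (amodE M) a (pres_aug P u))).
have dact t a (u : amodA (P t.+1)) : (pres_d P t (am_act (amodA (P t.+1)) a u) : amodA (P t)) =
    am_act (amodA (P t)) a (pres_d P t u).
  exact: (lin_ract a u (linearP (pres_d P t))).
have aact a (u : amodA (P 0%N)) : (pres_aug P (am_act (amodA (P 0%N)) a u) : amodE M) =
    am_act (amodE M) a (pres_aug P u).
  exact: (linZ (linearP (pres_aug P)) a u).
have := hoch_vanish dlin alin dact aact (pres_surj P) (@pres_exact0 _ _ P)
  (@pres_exact _ _ P) (fun t => amodA_section (@pres_proj _ _ P t)) P0 gz hz.
case: n {P0 gz hz dz} z nz => [|n] z nz e.
  by rewrite -[val z]cnatK [cnat _]e.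
case: e => x gx e; exists (cres x).
  by apply/cnat_good; rewrite cresK //; case: gx.
by rewrite -[val z]cnatK e -[RHS]cnatK cnat_hoch cresK //; case: gx.
Qed.

End Restriction.

Lemma kiso_trivial (k : pzRingType) (U V : lmodType k) :
  kiso U V -> (forall v : V, v = 0) -> forall u : U, u = 0.
Proof.
by move=> [g bg] V0 u; apply: (bij_inj bg); rewrite linear0; apply: V0.
Qed.

Lemma page_trivial (k : fieldType) (ss : spectralSequence k) p q r :
  (forall x : page ss 2 p q, x = 0) -> forall x : page ss r.+2 p q, x = 0.
Proof.
move=> p0; elim: r => [//|r IHr]; apply: kiso_trivial (page_next _ _ _ _) _ => //.
elim/subquot_ind=> x; apply/subquot_class_eq0.
by rewrite (IHr (val x)); apply: submod0.
Qed.

Lemma converges_trivial (k : fieldType) (ss : spectralSequence k) T n :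
  converges ss T -> (forall p q (x : page ss 2 p q), (p + q)%N = n -> x = 0) ->
  forall x : T n, x = 0.
Proof.
move=> [F [F0 Flast _ Fk]] p0 x; apply: Flast.
suff H p : (p <= n.+1)%N -> F n p x by apply: H.
elim: p => [//|p IHp pn]; have {IHp} := IHp (ltnW pn).
have pq : (p + (n - p))%N = n by lia.
(* Page $n + 2$ is stable at every $(p, q)$ with $p + q = n$. *)
have := Fk p (n - p)%N n.+2; rewrite pq => /(_ _ _)[||g bg Fp]; try lia.
apply/(@subquot_class_eq0 _ _ (F n p) (F n p.+1) (subel Fp)).
have [g' _ gg'] := bg; rewrite -[LHS]gg'.
rewrite (_ : g' _ = 0) ?linear0 //.
apply: page_trivial => y; exact: (p0 p (n - p)%N).
Qed.

Lemma Ext_trivial (k : fieldType) (R : algType k) (M N : lmodType R)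
    (P : projResolution M) n (e : Ext N P n) : (forall x : N, x = 0) -> e = 0.
Proof.
move=> N0; elim/subquot_ind: e => g; apply/subquot_class_eq0.
by rewrite (_ : val g = 0); [apply: submod0 | apply/funext => u; apply: N0].
Qed.

(** * Projective dimension and syzygies *)

Section ProjectiveDimension.
Variables (k : fieldType) (R : algType k).
Implicit Type M : lmodType R.

Lemma projective_retract M M' (i : {linear M -> M'}) (p : {linear M' -> M}) :
  (forall x, p (i x) = x) -> projective M' -> projective M.
Proof.
move=> pi pM' U V g h gs.
have l : linear (fun x => h (p x)) by move=> a x y; rewrite !linearP.
have [h' h'E] := pM' U V g (lin_pack l) gs.
have l' : linear (fun x => h' (i x)) by move=> a x y; rewrite !linearP.
by exists (lin_pack l') => x; rewrite /= h'E /= pi.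
Qed.

(** For [t] over [u] the element [t - r t] depends only on [u], so it defines an [R]-linear section
    of the free cover, and [M] is a retract of a free module. *)
Lemma split_projective M (r : free R (scalars M) -> subspace (kernel (free_ev M))) :
  linear r -> (forall z, r (val z) = z) -> projective M.
Proof.
move=> lr rK; pose rv t : free R (scalars M) := val (r t).
have lrv : linear rv by move=> a x y; rewrite /rv lr.
have rv_id t : free_ev M t = 0 -> rv t = t.
  by move=> e; apply: (congr1 val (rK (@subel _ _ (kernel (free_ev M)) t e))).
have rv_ev t : free_ev M (rv t) = 0 by apply: (subspaceP (r t)).
have [s0 s0E] := choice (@free_ev_surj k R M).
pose s u : free R (scalars M) := s0 u - rv (s0 u).
have lev := linearP (free_ev M).
have sE t t' : free_ev M t = free_ev M t' -> t - rv t = t' - rv t'.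
  move=> e; have : rv (t - t') = t - t' by apply: rv_id; rewrite (linB lev) e subrr.
  rewrite (linB lrv) => e'; apply/eqP; rewrite -subr_eq0; apply/eqP.
  by rewrite opprD addrACA -opprD e' subrr.
have ls : linear s.
  move=> a u v; rewrite /s (sE _ (a *: s0 u + s0 v)); last by rewrite lev !s0E.
  by rewrite lrv opprD addrACA scalerBr.
apply: (projective_retract (i := lin_pack ls) (p := free_ev M)).
  by move=> u; rewrite [LHS](linB lev) s0E rv_ev subr0.
exact: free_projective.
Qed.

(* A vanishing Ext^(d+1)(M, K), K the (d+1)-st syzygy of M, splits the inclusion of K. *)
Lemma syz_projective M d :
  (forall e : Ext (syz M d.+1) (can_res M) d.+1, e = 0) -> projective (syz M d).
Proof.
move=> E0; pose ev : can_mod M d.+1 -> scalars (syz M d.+1) := free_ev (syz M d.+1).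
have ce : ext_cocycle (P := can_res M) (n := d.+1) ev.
  by split=> [|x]; [exact: linearP | apply/(@can_dP k R M d.+1); exists x].
have /subquot_class_eq0[r lr evE] := E0 (subquot_class _ (@subel _ _
  (Submod (@ext_cocycle0 _ _ _ (syz M d.+1) (can_res M) d.+1) (@ext_cocycleP _ _ _ _ _ d.+1)) ev ce)).
apply: (@split_projective _ r lr) => z; have [t <-] := @free_ev_surj k R (syz M d.+1) z.
by rewrite -[RHS]/(ev t) [in RHS](evE : ev = _).
Qed.

Definition zero_mod M : lmodType R := subspace (kernel (idfun : {linear M -> M})).

Lemma zero_mod0 M (u : zero_mod M) : u = 0.
Proof. by apply: val_inj; apply: (subspaceP u). Qed.

Fact zero_map_linear M M' : linear (fun _ : M => 0 : M').
Proof. by move=> a x y; rewrite scaler0 addr0. Qed.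

Definition zero_map M M' : {linear M -> M'} := lin_pack (@zero_map_linear M M').

Lemma projective_zero M : projective (zero_mod M).
Proof.
move=> U V g h _; exists (zero_map _ _) => x.
by rewrite (zero_mod0 x) !linear0.
Qed.

Lemma pdim_projective M : projective M -> pdim_le M 0.
Proof.
move=> pM; pose X n : lmodType R := if n is 0%N then M else zero_mod M.
pose dX n : {linear X n.+1 -> X n} := zero_map _ _.
have pX n : projective (X n) by case: n => [//|n]; apply: projective_zero.
have ex0 (x : X 0%N) : (idfun x : M) = 0 <-> exists y, dX 0%N y = x.
  by split=> [e|[y <-] //]; exists 0; rewrite [RHS]e.
have ex n (x : X n.+1) : dX n x = 0 <-> exists y, dX n.+1 y = x.
  by split=> // _; exists 0; rewrite [RHS](zero_mod0 x).
exists (@ProjResolution R M X dX idfun pX (fun m => ex_intro _ m erefl) ex0 ex).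
by case=> [|n] x // _; apply: zero_mod0.
Qed.

(** Prepend the free cover of [M], whose kernel is [syz M 1]. *)
Lemma pdim_succ M n : pdim_le (syz M 1) n -> pdim_le M n.+1.
Proof.
move=> [P P0]; pose X n : lmodType R := if n is n'.+1 then P n' else can_mod M 0.
have l : linear (fun x : P 0%N => val (pres_aug P x) : can_mod M 0).
  by move=> a x y; rewrite linearP.
pose dX n : {linear X n.+1 -> X n} :=
  match n with 0%N => lin_pack l | n'.+1 => pres_d P n' end.
have pX m : projective (X m) by case: m => [|m]; [apply: free_projective | apply: pres_proj].
have ex0 (x : X 0%N) : free_ev M x = 0 <-> exists y, dX 0%N y = x.
  split=> [e|[y <-]]; last exact: (subspaceP (pres_aug P y)).
  have [y yE] := pres_surj P (@subel _ _ (kernel (free_ev M)) x e : syz M 1).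
  by exists y; rewrite /= yE.
have ex m (x : X m.+1) : dX m x = 0 <-> exists y, dX m.+1 y = x.
  case: m x => [|m] x; last exact: pres_exact.
  by rewrite -pres_exact0; split=> [e|e]; [apply: val_inj | rewrite /= e].
exists (@ProjResolution R M X dX (free_ev M) pX (@free_ev_surj k R M) ex0 ex).
by case=> [|m] x // mn; apply: P0.
Qed.

Lemma pdim_syz M d n : pdim_le (syz M d) n -> pdim_le M (d + n).
Proof.
elim: d n => [//|d IHd] n pd; rewrite addSnnS; apply: IHd.
exact: (@pdim_succ (syz M d)).
Qed.

End ProjectiveDimension.

Lemma gldim_leP (R : pzRingType) n : gldim_le R n -> (gldim R <= n%:Z%:E)%E.
Proof.
move=> Rn; rewrite /gldim; case: pselect => [e|[]]; last by exists n; apply/asboolP.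
by rewrite lee_fin lez_nat; case: ex_minnP => m _ ->//; apply/asboolP.
Qed.

Lemma gldim_cases (R : pzRingType) :
  gldim R = +oo%E \/ exists2 n, gldim_le R n & gldim R = n%:Z%:E.
Proof.
rewrite /gldim; case: pselect => [e|_]; [right | by left].
by exists (ex_minn e) => //; case: ex_minnP => m /asboolP.
Qed.

(** * The bound on the global dimension of the crossed product *)

Section GlobalDimensionBound.
Variables (k : fieldType) (A : algType k) (H : hopfAlgebra k).
Variables (w : weakAction A H) (f finv : {linear tensor H H -> A}).
Variables (wf : is_crossed_product w f) (fV : conv_inverse f finv).

Lemma crossed_Ext_vanish m n (M N : lmodType (crossed wf)) :
  gldim_le A m -> gldim_le H n -> forall e : Ext N (can_res M) (m + n).+1, e = 0.
Proof.
move=> gA gH; have [L [indL ssL]] := crossed_spectral_sequence fV M N.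
have [ss [p2 cv]] := ssL (can_res _) (can_res M).
apply: (converges_trivial cv) => p q x pq; move: x; apply: kiso_trivial (p2 p q) _ => e.
(* From $p + q = m + n + 1$, either $q > m$ and the coefficients vanish, or $p > n$ and the
   cohomology of [H] does. *)
have [mq|qm] := ltnP m q; last first.
  have [W W0] := gH (ltrivial H); apply: (@Ext_trivial_vanish k H W (can_res (trivial_module H)) (L q) p e) => u.
  by apply: W0; lia.
apply: Ext_trivial => x; have [th [thV _ thVK] _] := indL q.
have [P P0] := gA (resA M).
rewrite -[x]thVK (HochH_vanish (P := P) (thV x)) ?linear0 // => u.
exact: P0.
Qed.

Lemma crossed_gldim_le m n :
  gldim_le A m -> gldim_le H n -> gldim_le (crossed wf) (m + n).
Proof.
move=> gA gH M; rewrite -[X in pdim_le M X]addn0; apply: pdim_syz.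
by apply/pdim_projective/syz_projective/crossed_Ext_vanish.
Qed.

(** [gldim] is $+\infty$ or a natural number, never $-\infty$, so a sum with an infinite term is
    $+\infty$ and only the finite case remains. *)
Lemma crossed_gldim : (gldim (crossed wf) <= gldim A + gldim H)%E.
Proof.
have [->|[m gA ->]] := gldim_cases A.
  by rewrite addye ?leey //; have [->|[n _ ->]] := gldim_cases H.
have [->|[n gH ->]] := gldim_cases H; first by rewrite addey // leey.
exact: gldim_leP (crossed_gldim_le gA gH).
Qed.

End GlobalDimensionBound.
Theorem mainTheorem18 (k : fieldType) (A : algType k) (H : hopfAlgebra k)
  (w : weakAction A H) (f finv : {linear tensor H H -> A})
  (wf : is_crossed_product w f) (fV : conv_inverse f finv) :
  (forall M N : lmodType (crossed wf),
     exists L : nat -> lmodType (H : algType k)^c,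
       (forall s, induced_module M N finv s (L s)) /\
       (forall (P : projResolution (trivial_module H)) (Q : projResolution M),
          exists ss : spectralSequence k,
            (forall r s, kiso (page ss 2 r s) (Ext (L s) P r)) /\
            converges ss (Ext N Q))) /\
  (gldim (crossed wf) <= gldim A + gldim H)%E.
Proof.
split; last exact: crossed_gldim fV.
exact: crossed_spectral_sequence fV.
Qed.
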